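(* Let $k\ge 1$ be an integer, let $1\le p<\infty$, and let $\rho>0$. There is a constant $C>0$, depending only on $k,p,\rho$, such that for every quasi-uniform set $X\subset\mathbb{R}$ with mesh ratio $\rho_X\le\rho$ and every $f\in L^{2k+2,p}(\mathbb{R})$, $$\mathcal{E}(f,S_X(\Phi_{1,k}))_p\le C\,h_X^{2k}\,|f|_{L^{2k+2,p}(\mathbb{R})}.$$
   Context: One-dimensional Wendland functions: for a positive integer $\ell$ let $\phi_\ell(r)=(1-r)_+^\ell$, $r\ge 0$, and let $(\mathcal{I}\phi)(r)=\int_r^\infty t\,\phi(t)\,dt$. Then $\Phi_{1,k}(x)=(\mathcal{I}^k\phi_{k+1})(|x|)$ for $x\in\mathbb{R}$ (positive constant multiples are immaterial). Fourier transform: $\hat f(\omega)=(2\pi)^{-1/2}\int_{\mathbb{R}}f(x)e^{-ix\omega}\,dx$. The Bessel potential space is $L^{s,p}(\mathbb{R})=\{f:\hat f=(1+|\cdot|^2)^{-s/2}\hat g,\ g\in L^p(\mathbb{R})\}$, with $\|f\|_{L^{s,p}}=\|g\|_p$. Here, for even $s$, $|f|_{L^{s,p}(\mathbb{R})}=\|(1-\Delta)^{s/2}f\|_p=\|g\|_p$. For $X\subset\mathbb{R}$ countable, the fill distance is $h_X=\sup_{x\in\mathbb{R}}\inf_{\xi\in X}|x-\xi|$, the separation radius is $q_X=\frac12\inf_{\xi\ne\xi'\in X}|\xi-\xi'|$, and the mesh ratio is $\rho_X=h_X/q_X$. $X$ is quasi-uniform if $h_X<\infty$, $q_X>0$ and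 $\rho_X$ is bounded by a (fixed) constant. For a function $\Phi$ on $\mathbb{R}$, $$S_X(\Phi)=\Big\{\sum_{\xi\in Y}a_\xi\Phi(\cdot-\xi):\ Y\subset X,\ \#Y<\infty,\ a_\xi\in\mathbb{R}\Big\}\cap L^1(\mathbb{R}),$$ and $\mathcal{E}(f,S_X(\Phi))_p=\inf_{S\in S_X(\Phi)}\|f-S\|_{L^p(\mathbb{R})}$. *)

(* Defs.v *)
From mathcomp Require Import all_boot all_order all_algebra.
From mathcomp Require Import complex.
From mathcomp Require Import all_classical all_reals all_analysis.

Set Implicit Arguments.
Unset Strict Implicit.
Unset Printing Implicit Defensive.

Import Order.TTheory GRing.Theory Num.Theory.
Import numFieldNormedType.Exports.

Local Open Scope classical_set_scope.
Local Open Scope ring_scope.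
Local Open Scope complex_scope.

Section Wendland.
Context {R : realType}.

Definition trunc_power (l : nat) (r : R) : R := (Num.max (1 - r) 0) ^+ l.

Definition wendland_int (phi : R -> R) (r : R) : R :=
  \int[lebesgue_measure]_(t in `[r, +oo[) (t * phi t).

Definition wendland1 (k : nat) (x : R) : R :=
  iter k wendland_int (trunc_power k.+1) `|x|.

End Wendland.

Section Fourier.
Context {R : realType}.

Definition cintegral (h : R -> R[i]) : R[i] :=
  (\int[lebesgue_measure]_x complex.Re (h x))
    +i* (\int[lebesgue_measure]_x complex.Im (h x)).

Definition fourier (h : R -> R[i]) (w : R) : R[i] :=
  ((Num.sqrt (2 * pi))^-1)%:C
    * cintegral (fun x => h x * (cos (x * w) -i* sin (x * w))).

Definition real_schwartz (u : R -> R) : Prop :=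
  (forall (n : nat) (x : R), derivable (u^`(n))%classic x 1) /\
  (forall m n : nat, exists M : R, forall x : R, `|x| ^+ m * `|(u^`(n))%classic x| <= M).

Definition schwartz (phi : R -> R[i]) : Prop :=
  real_schwartz (fun x => complex.Re (phi x)) /\
  real_schwartz (fun x => complex.Im (phi x)).

(* The bilinear pairing of the tempered distribution induced by a real
   function with a Schwartz function. *)
Definition pairing (f : R -> R) (phi : R -> R[i]) : R[i] :=
  cintegral (fun x => (f x)%:C * phi x).

End Fourier.

Section Bessel.
Context {R : realType}.

(* The identity \hat f = (1 + |.|^2)^(-s/2) \hat g of tempered distributions,
   tested against Schwartz functions: \hat f pairs with phi as f pairs with
   \hat phi, and a smooth factor moves to the test function.  For p > 2 the
   transforms \hat f and \hat g need not be functions. *)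
Definition bessel_potential_of (s : R) (g f : R -> R) : Prop :=
  forall phi : R -> R[i], schwartz phi ->
    pairing f (fourier phi) =
    pairing g (fourier (fun w => ((1 + w ^+ 2) `^ (- (s / 2)))%:C * phi w)).

(* The functions g in L^p of which f is the Bessel potential; they agree almost
   everywhere. *)
Definition bessel_densities (s p : R) (f : R -> R) : set (R -> R) :=
  [set g | g \in Lfun lebesgue_measure p%:E /\ bessel_potential_of s g f].

(* L^{s,p} for s >= 0, where it is contained in L^p: asking f to be in L^p only
   says that the distribution is given by a function. *)
Definition bessel_space (s p : R) : set (R -> R) :=
  [set f | f \in Lfun lebesgue_measure p%:E /\ bessel_densities s p f !=set0].

(* The infimum runs over the representatives g of a single class in L^p: it is
   the common value of their norms. *)
Definition bessel_norm (s p : R) (f : R -> R) : \bar R :=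
  ereal_inf [set Lnorm lebesgue_measure p%:E (EFin \o g)
            | g in bessel_densities s p f].

End Bessel.

Section Centers.
Context {R : realType}.
Local Open Scope ereal_scope.

Definition fill_distance (X : set R) : \bar R :=
  ereal_sup [set ereal_inf [set `|x - xi|%:E | xi in X] | x in [set: R]].

Definition separation_radius (X : set R) : \bar R :=
  (2^-1)%:E * ereal_inf [set `|xy.1 - xy.2|%:E | xy in
                          [set xy : R * R | [/\ X xy.1, X xy.2 & xy.1 <> xy.2]]].

Definition mesh_ratio (X : set R) : \bar R :=
  fill_distance X / separation_radius X.

Definition quasi_uniform (rho : R) (X : set R) : Prop :=
  [/\ countable X, fill_distance X < +oo, 0 < separation_radius X
    & mesh_ratio X <= rho%:E].

Definition shift_space (Phi : R -> R) (X : set R) : set (R -> R) :=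
  [set S | S \in Lfun lebesgue_measure 1 /\
    exists (Y : set R) (a : R -> R), [/\ finite_set Y, Y `<=` X &
      S = (fun x => \sum_(xi \in Y) a xi * Phi (x - xi))%R]].

Definition approx_error (p : R) (f : R -> R) (V : set (R -> R)) : \bar R :=
  ereal_inf [set Lnorm lebesgue_measure p%:E (fun x => (f x - S x)%:E)
            | S in V].

End Centers.

(* Main.v *)
(* Write [lor w = 1 / (1 + w ^ 2)] and [t = h ^ 2], where [h <= 1] is comparable
   to the fill distance, and let [E = exp (t Delta / 2)].  Testing the Bessel
   identity against Gaussian wave packets shows that [(1 - E) ^ (k + 1) f] is [g]
   convolved with a kernel whose symbol is [((1 - E^) lor) ^ (k + 1)]; two
   derivatives of this symbol are O(t ^ k lor), so the kernel is O(t ^ k lor).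
   The rest, a combination of the [E ^ j f] with [1 <= j <= k + 1], has the
   Gaussian symbol times [lor ^ (k + 1)].  The Fourier transform of the Wendland
   function is comparable to [lor ^ (k + 1)] together with two derivatives: up to
   a power of the frequency it is the convolution power of order [k + 1] of
   [1 - cos].  Dividing by it writes the smooth part as a convolution
   [Phi * G] with [|G| = O(h ^ -1) lor * |g|].

   The line is cut into cells of length [4 h]; on each cell [Phi (y - .)] is
   replaced by its Lagrange interpolant of degree [2 k] at nodes of [X].  As [Phi]
   has a Taylor expansion of order [2 k + 1] everywhere, this costs
   O(h ^ (2 k + 1)) lor * |G|, that is O(h ^ (2 k)) in norm by Young's
   inequality; truncating to finitely many cells costs an arbitrarily small
   amount. *)
Require Import Defs.
From mathcomp Require Import all_boot all_order all_algebra.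
From mathcomp Require Import complex ring lra zify qpoly.
From mathcomp Require Import all_classical all_reals all_analysis measurable_realfun.

Set Implicit Arguments.
Unset Strict Implicit.
Unset Printing Implicit Defensive.

Import Order.TTheory GRing.Theory Num.Theory.
Import numFieldNormedType.Exports.

Local Open Scope classical_set_scope.
Local Open Scope ring_scope.

(** Two obstacles shape the proof. A function [f] in L^p is known only through pairings with
    Schwartz functions, so every identity concerns Gaussian averages of [f] at a positive time. The
    term of order zero of the binomial expansion, [f] itself, is recovered by letting an additional
    smoothing time tend to zero in integrals over intervals, followed by Lebesgue differentiation.
    Second, dividing by the symbol of [wendland1 k] needs a positive lower bound of the exact order
    [lor ^ (k + 1)]. The convolution powers of [1 - cos] are nonnegative, and from the square on
    they are positive on the open half-line and grow polynomially. Here [1 <= k] enters: [1 - cos]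
    itself has zeros.

    All bounds are pointwise and of one form, a multiple of [lor] convolved with an absolute value,
    and Young's inequality comes only at the end. To this end kernels are estimated through their
    symbols: a function bounded with two derivatives by an integrable majorant has a transform of
    quadratic decay. When the fill distance is not small, the zero function is a sufficient
    approximant. *)

Ltac nonneg := solve [repeat first
  [ assumption | done | exact: sqr_ge0 | exact: normr_ge0 | exact: expR_ge0
  | exact: powR_ge0 | apply: ltW; assumption | apply: mulr_ge0 | apply: addr_ge0
  | apply: divr_ge0 | apply: exprn_ge0 ]].

(** * Invariance of the Lebesgue integral under reflections and translations *)

Section Reflection.
Context {R : realType}.
Notation mu := (@lebesgue_measure R).
Lemma measurable_reflect (c : R) : measurable_fun [set: R] (fun x : R => c - x).
Proof. exact: measurable_funB. Qed.

Lemma lebesgue_reflect (c : R) (A : set R) : measurable A ->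
  mu ((fun x => c - x) @^-1` A) = mu A.
Proof.
move=> mA; apply/esym.
pose phi (x : measurableTypeR R) : measurableTypeR R := c - x.
have mphi : measurable_fun [set: measurableTypeR R] phi by exact: measurable_reflect.
apply: (@lebesgue_measure_unique R (pushforward mu phi)) => //.
move=> X [[a b] _ <-].
rewrite /pushforward /phi.
(* The reflected interval is open at the other end, which its measure does not see. *)
transitivity (mu [set` `[c - b, c - a[%R]); last first.
  by congr (mu _); apply/seteqP; split=> x /=; rewrite !in_itv/=; lra.
rewrite !lebesgue_measure_itv /= !lte_fin ltrD2l ltrN2.
case: ifP => // _; congr (_%:E); ring.
Qed.

Lemma integral_reflect (c : R) (f : R -> \bar R) : measurable_fun setT f ->
  (\int[mu]_x f (c - x)%R = \int[mu]_x f x)%E.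
Proof.
move=> mf.
have H (g : R -> \bar R) : measurable_fun setT g -> (forall x, 0 <= g x)%E ->
    (\int[mu]_x g (c - x)%R = \int[mu]_x g x)%E.
  move=> mg g0.
  pose phi (x : measurableTypeR R) : measurableTypeR R := c - x.
  have mphi : measurable_fun [set: measurableTypeR R] phi by exact: measurable_reflect.
  have := @ge0_integral_pushforward _ _ _ _ R _ mphi mu setT g measurableT mg (fun y _ => g0 y).
  rewrite preimage_setT => <-.
  by apply: eq_measure_integral => A mA _; exact: lebesgue_reflect.
rewrite [LHS]integralE [RHS]integralE; congr (_ - _)%E.
- rewrite -(H _ (measurable_funepos mf) (funepos_ge0 f)).
  by apply: eq_integral => x _; rewrite !unlock.
- rewrite -(H _ (measurable_funeneg mf) (funeneg_ge0 f)).
  by apply: eq_integral => x _; rewrite !unlock.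
Qed.

(** A translation is the composition of two reflections. *)
Lemma integral_shift (c : R) (f : R -> \bar R) : measurable_fun setT f ->
  (\int[mu]_x f (x + c)%R = \int[mu]_x f x)%E.
Proof.
move=> mf; rewrite -(integral_reflect 0 mf) -[RHS](integral_reflect (- c)).
  by apply: eq_integral => x _; congr f; ring.
by apply: measurableT_comp => //; exact: measurable_reflect.
Qed.
End Reflection.

(** * The Lorentzian, and measurability and Fubini lemmas for real integrals *)

Section Lorentzian.
Context {R : realType}.
Notation mu := (@lebesgue_measure R).

(** It plays two roles: on the frequency side it is the symbol of [(1 - Delta)^-1], on the space
    side it is the integrable majorant of all kernels. *)
Definition lor (x : R) : R := (1 + x ^+ 2)^-1.

Lemma one_sqr_gt0 (x : R) : 0 < 1 + x ^+ 2.
Proof. by rewrite ltr_pwDl// sqr_ge0. Qed.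

Lemma lor_gt0 x : 0 < lor x.
Proof. by rewrite invr_gt0 one_sqr_gt0. Qed.

Lemma lor_ge0 x : 0 <= lor x.
Proof. exact/ltW/lor_gt0. Qed.

Lemma lor_le1 x : lor x <= 1.
Proof. by rewrite invf_le1 ?one_sqr_gt0// lerDl sqr_ge0. Qed.

Lemma continuous_lor : continuous lor.
Proof.
move=> x; apply: cvgV; first by rewrite gt_eqF// one_sqr_gt0.
by apply: cvgD; [exact: cvg_cst|exact: exprn_continuous].
Qed.

Lemma measurable_lor : measurable_fun setT lor.
Proof. exact: continuous_measurable_fun continuous_lor. Qed.

Lemma integral_lor_scale (s : R) : 0 < s ->
  (\int[mu]_x (lor (s * x))%:E = (pi / s)%:E)%E.
Proof.
move=> s0.
have cs : continuous (fun x => lor (s * x)).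
  move=> x; apply: (@continuous_comp _ _ _ ( *%R s) lor); last exact: continuous_lor.
  exact: mulrl_continuous.
rewrite ge0_symfun_integralT//; last 2 first.
- by move=> x; exact: lor_ge0.
- by move=> x /=; rewrite /lor mulrN sqrrN.
rewrite -set_itvcy (@ge0_continuous_FTC2y _ _ (fun x => s^-1 * atan (s * x)) 0 (s^-1 * (pi / 2))).
- by rewrite -EFinB -EFinM mulr0 atan0; congr (_%:E); field; rewrite gt_eqF.
- by move=> x _; exact: lor_ge0.
- by apply: continuous_subspaceT => x; exact: cs.
- apply: cvgMl_tmp; apply: (cvg_comp (fun x => s * x) atan); last exact: cvgy_atan.
  exact: gt0_cvgMry.
- by move=> x _; apply: ex_derive.
- apply: cvg_at_right_filter; apply: cvgMr.
  apply: (@continuous_comp _ _ _ ( *%R s) atan); first exact: mulrl_continuous.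
  exact: continuous_atan.
- move=> x _; rewrite derive1E; apply: derive_val; apply: is_derive_eq.
  by rewrite /lor /= ?scaler1 ?derive_id /GRing.scale/=; field; rewrite !gt_eqF// one_sqr_gt0.
Qed.

Lemma integral_lor : (\int[mu]_x (lor x)%:E = pi%:E)%E.
Proof.
rewrite -[pi]divr1 -integral_lor_scale//.
by apply: eq_integral => x _; rewrite mul1r.
Qed.

Lemma integral_lor_reflect (c : R) : (\int[mu]_x (lor (c - x))%:E = pi%:E)%E.
Proof.
rewrite -integral_lor -(@integral_reflect _ c (EFin \o lor))//.
by apply/measurable_EFinP; exact: measurable_lor.
Qed.

Lemma integrable_ge0_fin (f : R -> R) : measurable_fun setT f ->
  (forall x, 0 <= f x) -> (\int[mu]_x (f x)%:E < +oo)%E ->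
  mu.-integrable setT (EFin \o f).
Proof.
move=> mf f0 foo; apply/integrableP; split; first exact/measurable_EFinP.
by under eq_integral do rewrite /= ger0_norm//.
Qed.

Lemma integrable_le (f g : R -> R) : measurable_fun setT f ->
  mu.-integrable setT (EFin \o g) -> (forall x, `|f x| <= g x) ->
  mu.-integrable setT (EFin \o f).
Proof.
move=> mf ig fg; apply: (le_integrable measurableT _ _ ig).
  exact/measurable_EFinP.
by move=> x _ /=; rewrite lee_fin (le_trans (fg x))// ler_norm.
Qed.

Lemma integrable_addr (f g : R -> R) : mu.-integrable setT (EFin \o f) ->
  mu.-integrable setT (EFin \o g) ->
  mu.-integrable setT (EFin \o (fun x => f x + g x)).
Proof.
move=> fi gi; have := integrableD measurableT fi gi.
by apply: eq_integrable.
Qed.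

Lemma integrable_mull (c : R) (f : R -> R) : mu.-integrable setT (EFin \o f) ->
  mu.-integrable setT (EFin \o (fun x => c * f x)).
Proof.
move=> fi; have := integrableZl measurableT c fi.
by apply: eq_integrable.
Qed.

Lemma integrable_subr (f g : R -> R) : mu.-integrable setT (EFin \o f) ->
  mu.-integrable setT (EFin \o g) ->
  mu.-integrable setT (EFin \o (fun x => f x - g x)).
Proof.
move=> fi gi; have := integrable_addr fi (integrable_mull (-1) gi).
by apply: eq_integrable => // x _ /=; rewrite mulN1r.
Qed.

Lemma integrable_abs (f : R -> R) : mu.-integrable setT (EFin \o f) ->
  mu.-integrable setT (EFin \o (fun x => `|f x|)).
Proof. by move=> fi; have := integrable_norm fi. Qed.

Lemma integrable_lor_scale (s : R) : 0 < s ->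
  mu.-integrable setT (EFin \o (fun x => lor (s * x))).
Proof.
move=> s0; apply: integrable_ge0_fin.
- apply: measurableT_comp; first exact: measurable_lor.
  exact: mulrl_measurable.
- by move=> x; exact: lor_ge0.
- by rewrite integral_lor_scale// ltry.
Qed.

Lemma measurable_lor_reflect c : measurable_fun setT (fun x : R => lor (c - x)).
Proof. by apply: measurableT_comp; [exact: measurable_lor|exact: measurable_reflect]. Qed.

Lemma integrable_lor_reflect (c : R) :
  mu.-integrable setT (EFin \o (fun x => lor (c - x))).
Proof.
apply: integrable_ge0_fin.
- exact: measurable_lor_reflect.
- by move=> x; exact: lor_ge0.
- by rewrite integral_lor_reflect ltry.
Qed.

Lemma integrable_lor : mu.-integrable setT (EFin \o lor).
Proof.
apply: integrable_ge0_fin; [exact: measurable_lor|exact: lor_ge0|].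
by rewrite integral_lor ltry.
Qed.

Lemma measurable_ge0_integral_param (H : R * R -> \bar R) :
  measurable_fun setT H -> (forall z, 0 <= H z)%E ->
  measurable_fun setT (fun x => \int[mu]_t H (x, t))%E.
Proof.
move=> mH H0; apply: (eq_measurable_fun (fubini_F mu H)) => //.
exact: measurable_fun_fubini_tonelli_F.
Qed.

(** The real integral is the finite part of the difference of the integrals of the positive and
    negative parts, and each of these is measurable in the parameter by Tonelli; parameters with a
    divergent integral are covered too. *)
Lemma measurable_Rintegral_param (H : R * R -> R) : measurable_fun setT H ->
  measurable_fun setT (fun x => \int[mu]_t H (x, t)).
Proof.
move=> mH.
have mEH : measurable_fun setT (EFin \o H) by exact/measurable_EFinP.
rewrite /Rintegral; apply: measurableT_comp => //.
under eq_fun do rewrite integralE.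
apply: emeasurable_funB.
  apply: (eq_measurable_fun (fun x => \int[mu]_t (EFin \o H)^\+ (x, t))%E).
    by move=> x _; apply: eq_integral => t _; rewrite !unlock.
  apply: measurable_ge0_integral_param; first exact: measurable_funepos.
  by move=> z; exact: funepos_ge0.
apply: (eq_measurable_fun (fun x => \int[mu]_t (EFin \o H)^\- (x, t))%E).
  by move=> x _; apply: eq_integral => t _; rewrite !unlock.
apply: measurable_ge0_integral_param; first exact: measurable_funeneg.
by move=> z; exact: funeneg_ge0.
Qed.

Lemma tonelli (H : R -> R -> \bar R) :
  measurable_fun setT (fun z : R * R => H z.1 z.2) ->
  (forall x y, 0 <= H x y)%E ->
  (\int[mu]_x \int[mu]_y H x y = \int[mu]_y \int[mu]_x H x y)%E.
Proof.
move=> mH H0.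
exact: (@fubini_tonelli _ _ _ _ R mu mu (fun z => H z.1 z.2) mH (fun z => H0 z.1 z.2)).
Qed.

(** All sections are integrable, not just almost all, so that the finite parts taken by the inner
    integrals can be undone at every point. *)
Lemma fubini_Rintegral (H : R -> R -> R) :
  measurable_fun setT (fun z : R * R => H z.1 z.2) ->
  (\int[mu]_x \int[mu]_y `|H x y|%:E < +oo)%E ->
  (forall x, mu.-integrable setT (EFin \o H x)) ->
  (forall y, mu.-integrable setT (EFin \o H^~ y)) ->
  \int[mu]_x \int[mu]_y H x y = \int[mu]_y \int[mu]_x H x y.
Proof.
move=> mH Hoo Hx Hy.
have iH : (mu \x mu)%E.-integrable setT (fun z : R * R => (H z.1 z.2)%:E).
  apply/integrableP; split; first exact/measurable_EFinP.
  rewrite (@fubini_tonelli1 _ _ _ _ R mu mu (fun z => (`|H z.1 z.2|%:E)%E))//.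
  by apply/measurable_EFinP; exact: measurableT_comp.
have := Fubini iH; rewrite /= => HE.
rewrite /Rintegral; congr fine.
transitivity (\int[mu]_x \int[mu]_y (H x y)%:E)%E.
  apply: eq_integral => x _; rewrite fineK//.
  exact: (integrable_fin_num measurableT (Hx x)).
rewrite HE; apply: eq_integral => y _; rewrite fineK//.
exact: (integrable_fin_num measurableT (Hy y)).
Qed.

Lemma Lnorm_EFinE (p : R) (f : R -> R) :
  Lnorm mu p%:E (EFin \o f) = ((\int[mu]_x (`|f x| `^ p)%:E) `^ p^-1)%E.
Proof. by rewrite unlock. Qed.

Lemma le_Lnorm_ae (p : R) (f g : R -> R) : 1 <= p ->
  measurable_fun setT f -> measurable_fun setT g ->
  {ae mu, forall x, `|f x| <= `|g x|} ->
  (Lnorm mu p%:E (EFin \o f) <= Lnorm mu p%:E (EFin \o g))%E.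
Proof.
move=> p1 mf mg fg; rewrite !Lnorm_EFinE.
have p0 : 0 <= p by rewrite (le_trans _ p1).
have mpow (u : R -> R) : measurable_fun setT u ->
    measurable_fun setT (fun x => (`|u x| `^ p)%:E).
  move=> mu_; apply/measurable_EFinP; apply: (measurableT_comp (measurable_powR p)).
  exact: measurableT_comp.
apply: gt0_ler_poweR.
- by rewrite invr_ge0.
- by rewrite in_itv/= leey andbT integral_ge0// => x _; rewrite lee_fin powR_ge0.
- by rewrite in_itv/= leey andbT integral_ge0// => x _; rewrite lee_fin powR_ge0.
apply: ae_ge0_le_integral => //.
- exact: mpow.
- exact: mpow.
- case: fg => N [mN N0 sub]; exists N; split => //.
  apply: subset_trans sub; apply: subsetC => x /= fgx _.
  by rewrite lee_fin ge0_ler_powR// nnegrE.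
Qed.

End Lorentzian.

(** * Young's inequality for the convolution with the Lorentzian *)

Section Young.
Context {R : realType}.
Notation mu := (@lebesgue_measure R).

(** The convex function of exponent [p] lies above its tangent at [c]. For [p > 1] this is Young's
    inequality for products, with the exponents [p] and [p / (p - 1)]. *)
Lemma powR_tangent (p c v : R) : 1 <= p -> 0 <= c -> 0 <= v ->
  p * c `^ (p - 1) * v <= v `^ p + (p - 1) * c `^ p.
Proof.
rewrite le_eqVlt => /predU1P[<- c0 v0|p1 c0 v0].
  by rewrite subrr powRr0 !mul1r mul0r addr0 powRr1.
have p0 : 0 < p by rewrite (lt_trans _ p1).
have p10 : 0 < p - 1 by rewrite subr_gt0.
have pq : p^-1 + (p / (p - 1))^-1 = 1.
  by field; rewrite !gt_eqF.
have := @conjugate_powR R v (c `^ (p - 1)) p (p / (p - 1)) v0 (powR_ge0 _ _) p0 (divr_gt0 p0 p10) pq.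
rewrite -powRrM (_ : (p - 1) * (p / (p - 1)) = p); last by field; rewrite gt_eqF.
move=> h.
have := ler_wpM2l (ltW p0) h.
rewrite mulrDr (_ : p * (v `^ p / p) = v `^ p); last by field; rewrite gt_eqF.
rewrite (_ : p * (c `^ p / (p / (p - 1))) = (p - 1) * c `^ p); last by field; rewrite !gt_eqF.
by rewrite (mulrC v) mulrA.
Qed.

(** This replaces Hölder's inequality wherever an L^p function has to be integrable on a set of
    finite measure or against a bounded integrable kernel. *)
Lemma ler_1_powR (p v : R) : 1 <= p -> 0 <= v -> v <= 1 + v `^ p.
Proof.
move=> p1 v0; have [v1|v1] := leP v 1.
  by rewrite (le_trans v1)// lerDl powR_ge0.
by rewrite -{1}[v]powRr1// (le_trans (ler_powR (ltW v1) p1))// lerDr.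
Qed.

(** Convolution with [lor], that is, [pi] times the Poisson integral at height one. *)
Definition pois (v : R -> R) (x : R) : R := \int[mu]_t (lor (x - t) * v t).

Lemma Lfun_measurable (p : R) (v : R -> R) : v \in Lfun mu p%:E ->
  measurable_fun setT v.
Proof. by move=> /andP[]; rewrite !inE. Qed.

Lemma integrable_powR (p : R) (v : R -> R) : 1 <= p -> v \in Lfun mu p%:E ->
  mu.-integrable setT (EFin \o (fun x => `|v x| `^ p)).
Proof. by move=> p1 vp; exact: Lfun_integrable. Qed.

Lemma Lfun_pois_integrable (p : R) (v : R -> R) (x : R) : 1 <= p ->
  v \in Lfun mu p%:E ->
  mu.-integrable setT (EFin \o (fun t => lor (x - t) * v t)).
Proof.
move=> p1 vp; have mv := Lfun_measurable vp.
apply: (@integrable_le _ _ (fun t => lor (x - t) + `|v t| `^ p)).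
- by apply: measurable_funM => //; exact: measurable_lor_reflect.
- apply: integrable_addr; first exact: integrable_lor_reflect.
  exact: integrable_powR.
- move=> t; rewrite normrM (ger0_norm (lor_ge0 _)).
  apply: (@le_trans _ _ (lor (x - t) * (1 + `|v t| `^ p))).
    by rewrite ler_wpM2l ?lor_ge0// ler_1_powR.
  by rewrite mulrDr mulr1 lerD2l ler_piMl ?powR_ge0 ?lor_le1.
Qed.

Lemma measurable_lorB : measurable_fun [set: R * R] (fun z : R * R => lor (z.1 - z.2)).
Proof.
apply: measurableT_comp; first exact: measurable_lor.
by apply: measurable_funB; [exact: measurable_fst|exact: measurable_snd].
Qed.

Lemma measurable_pois (v : R -> R) : measurable_fun setT v ->
  measurable_fun setT (pois v).
Proof.
move=> mv.
apply: (@measurable_Rintegral_param R (fun z => lor (z.1 - z.2) * v z.2)).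
apply: measurable_funM; first exact: measurable_lorB.
by apply: measurableT_comp => //; exact: measurable_snd.
Qed.

Lemma pois_ge0 v x : (forall t, 0 <= v t) -> 0 <= pois v x.
Proof. by move=> v0; apply: Rintegral_ge0 => t _; rewrite mulr_ge0 ?lor_ge0. Qed.

(** Jensen's inequality for the measure of density [lor (x - t)], whose mass is [pi]: integrate the
    tangent inequality taken at the mean [c = u / pi]. *)
Lemma pois_powR (p : R) (v : R -> R) (x : R) : 1 <= p -> v \in Lfun mu p%:E ->
  (pois (fun t => `|v t|) x) `^ p <= pi `^ (p - 1) * pois (fun t => `|v t| `^ p) x.
Proof.
move=> p1 vp; have mv := Lfun_measurable vp.
have p0 : 0 < p by rewrite (lt_le_trans _ p1).
set u := pois _ x; have u0 : 0 <= u by exact: pois_ge0.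
pose c := u / pi; have c0 : 0 <= c by rewrite divr_ge0// pi_ge0.
have iv : mu.-integrable setT (EFin \o (fun t => lor (x - t) * `|v t|)).
  have := Lfun_pois_integrable x p1 vp => /integrable_norm.
  apply: eq_integrable => // t _ /=.
  by rewrite normrM (ger0_norm (lor_ge0 _)).
have ivp : mu.-integrable setT (EFin \o (fun t => lor (x - t) * `|v t| `^ p)).
  apply: (integrable_le _ (integrable_powR p1 vp)).
    apply: measurable_funM; first exact: measurable_lor_reflect.
    by apply/measurable_EFinP; have /measurable_int := integrable_powR p1 vp.
  by move=> t; rewrite ger0_norm ?mulr_ge0 ?lor_ge0 ?powR_ge0// ler_piMl ?powR_ge0 ?lor_le1.
have key : p * c `^ (p - 1) * u <= pois (fun t => `|v t| `^ p) x + (p - 1) * c `^ p * pi.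
  have -> : pi = \int[mu]_t lor (x - t) by rewrite /Rintegral integral_lor_reflect.
  rewrite /u /pois -!RintegralZl//; [|exact: integrable_lor_reflect].
  rewrite -RintegralD//; last first.
    exact: (integrable_mull _ (integrable_lor_reflect x)).
  apply: le_Rintegral => //.
  - exact: (integrable_mull _ iv).
  - apply: integrable_addr => //.
    exact: (integrable_mull _ (integrable_lor_reflect x)).
  - move=> t _; have := ler_wpM2l (lor_ge0 (x - t)) (powR_tangent p1 c0 (normr_ge0 (v t))).
    by congr (_ <= _); rewrite /=; ring.
have pi0 : 0 < (pi : R) by exact: pi_gt0.
have uE : u = c * pi by rewrite /c divfK// gt_eqF.
have ccE : c `^ (p - 1) * c = c `^ p.
  have [->|cn0] := eqVneq c 0; first by rewrite mulr0 powR0// gt_eqF.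
  by rewrite -[X in _ * X]powRr1// -powRD ?subrK//; rewrite cn0 implybT.
have : pi * c `^ p <= pois (fun t => `|v t| `^ p) x.
  move: key; rewrite uE (_ : p * _ * _ = p * (c `^ (p - 1) * c) * pi); last by ring.
  rewrite ccE; lra.
rewrite uE powRM// ?(ltW pi0)// => h.
have -> : pi `^ p = pi `^ (p - 1) * pi :> R.
  by rewrite -[X in _ * X]powRr1 ?(ltW pi0)// -powRD ?subrK//; rewrite (gt_eqF pi0) implybT.
by rewrite mulrC -mulrA ler_wpM2l// powR_ge0.
Qed.

(** Jensen contributes [pi] to the power [p - 1], and integrating [lor] in the outer variable, by
    Tonelli, contributes the last factor [pi]. *)
Lemma young_pois (p : R) (v : R -> R) : 1 <= p -> v \in Lfun mu p%:E ->
  (Lnorm mu p%:E (EFin \o pois (fun t => `|v t|%R)) <= pi%:E * Lnorm mu p%:E (EFin \o v))%E.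
Proof.
move=> p1 vp; have mv := Lfun_measurable vp.
have p0 : 0 < p by rewrite (lt_le_trans _ p1).
have pi0 : 0 < (pi : R) by exact: pi_gt0.
have mvp : measurable_fun setT (fun t => `|v t| `^ p).
  by apply/measurable_EFinP; have /measurable_int := integrable_powR p1 vp.
have ivp (x : R) : mu.-integrable setT (EFin \o (fun t => lor (x - t) * `|v t| `^ p)).
  apply: (integrable_le _ (integrable_powR p1 vp)).
    by apply: measurable_funM => //; exact: measurable_lor_reflect.
  by move=> t; rewrite ger0_norm ?mulr_ge0 ?lor_ge0 ?powR_ge0// ler_piMl ?powR_ge0 ?lor_le1.
rewrite !Lnorm_EFinE.
have I0 (u : R -> R) : (0 <= \int[mu]_x (`|u x| `^ p)%:E)%E.
  by apply: integral_ge0 => x _; rewrite lee_fin powR_ge0.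
have -> : (pi%:E = (pi `^ p)%:E `^ p^-1 :> \bar R)%E.
  by rewrite poweR_EFin -powRrM divff ?gt_eqF// powRr1// ltW.
rewrite -poweRM ?lee_fin ?powR_ge0//.
apply: gt0_ler_poweR.
- by rewrite invr_ge0 ltW.
- by rewrite in_itv/= leey andbT I0.
- by rewrite in_itv/= leey andbT mule_ge0// ?lee_fin ?powR_ge0.
apply: (@le_trans _ _ (\int[mu]_x ((pi `^ (p - 1))%:E * \int[mu]_t (lor (x - t) * `|v t| `^ p)%:E))%E).
  apply: ge0_le_integral => //.
  - apply/measurable_EFinP; apply: (measurableT_comp (measurable_powR p)).
    apply: measurableT_comp => //; apply: measurable_pois.
    exact: measurableT_comp.
  - apply: measurable_funeM.
    apply: (@measurable_ge0_integral_param R (fun z : R * R => (lor (z.1 - z.2) * `|v z.2| `^ p)%:E)).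
      apply/measurable_EFinP; apply: measurable_funM; first exact: measurable_lorB.
      by apply: (measurableT_comp mvp); exact: measurable_snd.
    by move=> z; rewrite lee_fin mulr_ge0 ?lor_ge0 ?powR_ge0.
  - move=> x _; rewrite ger0_norm ?pois_ge0//.
    have := pois_powR x p1 vp.
    rewrite -lee_fin EFinM; congr (_ <= _ * _)%E.
    rewrite /pois /Rintegral fineK//.
    exact: (integrable_fin_num measurableT (ivp x)).
rewrite ge0_integralZl//; last 3 first.
- apply: (@measurable_ge0_integral_param R (fun z : R * R => (lor (z.1 - z.2) * `|v z.2| `^ p)%:E)).
    apply/measurable_EFinP; apply: measurable_funM; first exact: measurable_lorB.
    by apply: (measurableT_comp mvp); exact: measurable_snd.
  by move=> z; rewrite lee_fin mulr_ge0 ?lor_ge0 ?powR_ge0.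
- by move=> x _; apply: integral_ge0 => t _; rewrite lee_fin mulr_ge0 ?lor_ge0 ?powR_ge0.
- by rewrite lee_fin powR_ge0.
rewrite (@tonelli R (fun x y => (lor (x - y) * `|v y| `^ p)%:E)); last 2 first.
- apply/measurable_EFinP; apply: measurable_funM; first exact: measurable_lorB.
  by apply: (measurableT_comp mvp); exact: measurable_snd.
- by move=> x y; rewrite lee_fin mulr_ge0 ?lor_ge0 ?powR_ge0.
have -> : (\int[mu]_y \int[mu]_x (lor (x - y) * `|v y| `^ p)%:E = \int[mu]_y (pi%:E * (`|v y| `^ p)%:E))%E.
  apply: eq_integral => y _.
  under eq_integral do rewrite EFinM muleC.
  rewrite ge0_integralZl//; last 2 first.
  - apply/measurable_EFinP; apply: measurableT_comp; first exact: measurable_lor.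
    exact: measurable_funB.
  - by move=> x _; rewrite lee_fin lor_ge0.
  rewrite muleC; congr (_ * _)%E.
  rewrite (@integral_shift _ (- y) (EFin \o lor)) ?integral_lor//.
  by apply/measurable_EFinP; exact: measurable_lor.
rewrite ge0_integralZl//; last 2 first.
- exact/measurable_EFinP.
- by rewrite lee_fin ltW.
rewrite muleA -EFinM.
have -> : pi `^ p = pi `^ (p - 1) * pi :> R.
  by rewrite -[X in _ * X]powRr1 ?(ltW pi0)// -powRD ?subrK//; rewrite (gt_eqF pi0) implybT.
by [].
Qed.

Lemma Lfun_pois (p : R) (v : R -> R) : 1 <= p -> v \in Lfun mu p%:E ->
  pois (fun t => `|v t|) \in Lfun mu p%:E.
Proof.
move=> p1 vp; have mv := Lfun_measurable vp.
rewrite inE; apply/andP; split; rewrite inE /=.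
  by apply: measurable_pois; exact: measurableT_comp.
apply: (le_lt_trans (young_pois p1 vp)).
rewrite lte_mul_pinfty// ?lee_fin ?pi_ge0//.
by move: vp => /andP[_]; rewrite inE.
Qed.

End Young.

(** * Functions bounded together with two derivatives, and their second differences *)

Section SecondDifferences.
Context {R : realType}.
Notation mu := (@lebesgue_measure R).

(** A single majorant serves the function and both derivatives, which makes the class stable under
    products: the second derivative of a product has weights 1, 2, 1, whence the factor 4 in
    [C2bd_mul]. *)
Definition C2bd (F b : R -> R) := exists F1 F2 : R -> R,
  [/\ forall x : R, is_derive x 1 F (F1 x), forall x : R, is_derive x 1 F1 (F2 x) &
      forall x, [/\ `|F x| <= b x, `|F1 x| <= b x & `|F2 x| <= b x]].

Lemma C2bd_le F b b' : C2bd F b -> (forall x, b x <= b' x) -> C2bd F b'.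
Proof.
move=> [F1 [F2 [d1 d2 h]]] bb'; exists F1, F2; split => // x.
by have [? ? ?] := h x; split; apply: le_trans (bb' x).
Qed.

Lemma C2bd_ext F G b : C2bd F b -> F =1 G -> C2bd G b.
Proof. by move=> h /funext <-. Qed.

Lemma C2bd_continuous F b : C2bd F b -> continuous F.
Proof.
move=> [F1 [F2 [d1 _ _]]] x; apply: differentiable_continuous.
by apply/derivable1_diffP; exact: ex_derive.
Qed.

Lemma C2bd_ge0 F b x : C2bd F b -> 0 <= b x.
Proof. by move=> [F1 [F2 [_ _ /(_ x)[h _ _]]]]; rewrite (le_trans _ h). Qed.

Lemma C2bd_abs F b x : C2bd F b -> `|F x| <= b x.
Proof. by move=> [F1 [F2 [_ _ /(_ x)[]]]]. Qed.

Lemma C2bd_mul F G a b : C2bd F a -> C2bd G b ->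
  C2bd (fun x => F x * G x) (fun x => 4 * (a x * b x)).
Proof.
move=> Fa Gb; have a0 x := C2bd_ge0 x Fa; have b0 x := C2bd_ge0 x Gb.
case: Fa => [F1 [F2 [d1 d2 h]]]; case: Gb => [G1 [G2 [e1 e2 k]]].
exists (fun x => F1 x * G x + F x * G1 x).
exists (fun x => F2 x * G x + F1 x * G1 x *+ 2 + F x * G2 x).
split.
- move=> x; have := d1 x; have := e1 x => ? ?.
  by apply: is_derive_eq; rewrite /GRing.scale /=; ring.
- move=> x; have := d1 x; have := e1 x; have := d2 x; have := e2 x => ? ? ? ?.
  by apply: is_derive_eq; rewrite /GRing.scale /=; ring.
- move=> x; have [h0 h1 h2] := h x; have [k0 k1 k2] := k x.
  have M (u v : R) : `|u| <= a x -> `|v| <= b x -> `|u * v| <= a x * b x.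
    by move=> ua vb; rewrite normrM ler_pM.
  have ab0 : 0 <= a x * b x by rewrite mulr_ge0.
  split.
  + by apply: (le_trans (M _ _ h0 k0)); lra.
  + apply: (le_trans (ler_normD _ _)).
    by have := M _ _ h1 k0; have := M _ _ h0 k1; lra.
  + apply: (le_trans (ler_normD _ _)).
    have := ler_normD (F2 x * G x) (F1 x * G1 x *+ 2).
    rewrite normrMn.
    by have := M _ _ h2 k0; have := M _ _ h1 k1; have := M _ _ h0 k2; lra.
Qed.

Lemma C2bd_cst c : C2bd (fun=> c) (fun=> `|c|).
Proof.
exists (fun=> 0), (fun=> 0); split => [x|x|x].
- exact: is_derive_cst.
- exact: is_derive_cst.
- by rewrite normr0.
Qed.

Lemma C2bd_pow F (b : R) n : C2bd F (fun=> b) ->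
  C2bd (fun x => F x ^+ n) (fun=> (4 * b) ^+ n).
Proof.
move=> Fb; elim: n => [|n ih].
  apply: (@C2bd_ext (fun=> 1)) => //; apply: C2bd_le (C2bd_cst 1) _ => x.
  by rewrite normr1 expr0.
apply: (@C2bd_ext (fun x => F x * F x ^+ n)); last by move=> x; rewrite exprS.
apply: C2bd_le (C2bd_mul Fb ih) _ => x.
by rewrite exprS mulrA.
Qed.

Lemma is_derive_comp (F u : R -> R) (x du dF : R) : is_derive x 1 u du ->
  is_derive (u x) 1 F dF -> is_derive x 1 (fun y => F (u y)) (du * dF).
Proof. by move=> hu hF; rewrite mulrC; exact: (@is_derive1_comp _ F u x dF du hF hu). Qed.

Lemma is_derive_addl (w x : R) : is_derive x 1 (fun y => w + y) 1.
Proof.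
have := is_deriveD (is_derive_cst w x 1) (is_derive_id x 1).
by rewrite add0r.
Qed.

Lemma is_derive_subl (w x : R) : is_derive x 1 (fun y => w - y) (-1).
Proof.
have := is_deriveB (is_derive_cst w x 1) (is_derive_id x 1).
by rewrite sub0r.
Qed.

Lemma mvt_abs_le (f df : R -> R) (a b B : R) : a <= b ->
  (forall x : R, is_derive x 1 f (df x)) ->
  (forall x, a <= x <= b -> `|df x| <= B) -> `|f b - f a| <= B * (b - a).
Proof.
move=> ab fdf dfB.
have [|c cab ->] := @MVT_segment R f df a b ab (fun x _ => fdf x).
- apply: continuous_subspaceT => x; apply: differentiable_continuous.
  by apply/derivable1_diffP; have := fdf x => ?; exact: ex_derive.
- rewrite normrM (ger0_norm (_ : 0 <= b - a)) ?subr_ge0//.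
  by rewrite ler_wpM2r ?subr_ge0// dfB.
Qed.

(** The mean value bound is used twice: for [g r = F (w + r) + F (w - r)], and for [F1] between
    [w - r] and [w + r], which bounds the derivative of [g]. This loses a harmless factor 2. *)
Lemma second_difference_le (F F1 F2 : R -> R) (w s B : R) : 0 <= s ->
  (forall x : R, is_derive x 1 F (F1 x)) -> (forall x : R, is_derive x 1 F1 (F2 x)) ->
  (forall x, w - s <= x <= w + s -> `|F2 x| <= B) ->
  `|F (w + s) + F (w - s) - 2 * F w| <= 2 * B * s ^+ 2.
Proof.
move=> s0 d1 d2 hB.
have B0 : 0 <= B by rewrite (le_trans _ (hB w _))//; lra.
pose g r := F (w + r) + F (w - r).
have dg (r : R) : is_derive r 1 g (F1 (w + r) - F1 (w - r)).
  have D1 := d1 (w + r); have D2 := d1 (w - r).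
  have E1 := is_derive_comp (is_derive_addl w r) D1.
  have E2 := is_derive_comp (is_derive_subl w r) D2.
  by apply: is_derive_eq; rewrite mul1r mulN1r.
have -> : F (w + s) + F (w - s) - 2 * F w = g s - g 0.
  by rewrite /g addr0 subr0; ring.
have := @mvt_abs_le g _ 0 s (2 * B * s) s0 dg.
rewrite subr0 expr2 mulrA; apply => r /andP[r0 rs].
have h : `|F1 (w + r) - F1 (w - r)| <= B * (w + r - (w - r)).
  apply: mvt_abs_le => // [|x /andP[x1 x2]]; first lra.
  by apply: hB; lra.
by apply: (le_trans h); nra.
Qed.

End SecondDifferences.

(** * Cosine transforms and their quadratic decay *)

Section CosineTransform.
Context {R : realType}.
Notation mu := (@lebesgue_measure R).

(** The symbols to which this is applied are even, so that up to normalisation it is their Fourier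
    transform, and a real one. *)
Definition ctr (F : R -> R) (z : R) : R := \int[mu]_w (F w * cos (z * w)).

Lemma measurable_cosM (z : R) : measurable_fun setT (fun w : R => cos (z * w)).
Proof.
apply: continuous_measurable_fun => x.
apply: (@continuous_comp _ _ _ ( *%R z) cos); first exact: mulrl_continuous.
exact: continuous_cos.
Qed.

Lemma cos_abs_le1 (x : R) : `|cos x| <= 1.
Proof. by rewrite ler_norml cos_geN1 cos_le1. Qed.

Lemma measurable_integrable (F : R -> R) : mu.-integrable setT (EFin \o F) ->
  measurable_fun setT F.
Proof. by move=> /measurable_int h; apply/measurable_EFinP. Qed.

Lemma integrable_mul_bounded (F u : R -> R) : mu.-integrable setT (EFin \o F) ->
  measurable_fun setT u -> (forall x, `|u x| <= 1) ->
  mu.-integrable setT (EFin \o (fun x => F x * u x)).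
Proof.
move=> iF m_u u1; apply: (@integrable_le _ _ (fun x => `|F x|)).
- by apply: measurable_funM => //; exact: measurable_integrable.
- exact: integrable_abs.
- by move=> x; rewrite normrM ler_piMr.
Qed.

Lemma integrable_ctr (F : R -> R) (z : R) : mu.-integrable setT (EFin \o F) ->
  mu.-integrable setT (EFin \o (fun w => F w * cos (z * w))).
Proof.
move=> iF; apply: integrable_mul_bounded => //; first exact: measurable_cosM.
by move=> x; exact: cos_abs_le1.
Qed.

Lemma integrable_shift (F : R -> R) (s : R) : mu.-integrable setT (EFin \o F) ->
  mu.-integrable setT (EFin \o (fun w => F (w + s))).
Proof.
move=> iF; have mF := measurable_integrable iF.
apply/integrableP; split.
  apply/measurable_EFinP; apply: measurableT_comp => //.
  exact: measurable_funD.
rewrite (@integral_shift _ s (fun x => `|(F x)%:E|)%E).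
  by have /integrableP[] := iF.
by apply: measurableT_comp => //; exact/measurable_EFinP.
Qed.

Lemma Rintegral_shift (F : R -> R) (s : R) : measurable_fun setT F ->
  \int[mu]_w F (w + s) = \int[mu]_w F w.
Proof.
move=> mF; congr fine; rewrite (@integral_shift _ s (EFin \o F))//.
exact/measurable_EFinP.
Qed.

Lemma Rintegral_reflect (F : R -> R) (s : R) : measurable_fun setT F ->
  \int[mu]_w F (s - w) = \int[mu]_w F w.
Proof.
move=> mF; congr fine; rewrite (@integral_reflect _ s (EFin \o F))//.
exact/measurable_EFinP.
Qed.

Lemma le_abs_Rintegral (F G : R -> R) : measurable_fun setT F ->
  mu.-integrable setT (EFin \o G) -> (forall x, `|F x| <= G x) ->
  `|\int[mu]_x F x| <= \int[mu]_x G x.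
Proof.
move=> mF iG FG; have iF := integrable_le mF iG FG.
apply: (le_trans (le_normr_Rintegral measurableT iF)).
by apply: le_Rintegral => //; exact: integrable_abs.
Qed.

(** Translation invariance moves the shifts of [F] onto the cosine, and the two shifted cosines add
    up to [2 * cos (z * s) * cos (z * w)]. *)
Lemma ctr_second_difference (F : R -> R) (z s : R) :
  mu.-integrable setT (EFin \o F) ->
  \int[mu]_w ((F (w + s) + F (w - s) - 2 * F w) * cos (z * w)) =
  (2 * cos (z * s) - 2) * ctr F z.
Proof.
move=> iF; have mF := measurable_integrable iF.
have ip := integrable_shift s iF; have im := integrable_shift (- s) iF.
have split3 : \int[mu]_w ((F (w + s) + F (w - s) - 2 * F w) * cos (z * w)) =
    \int[mu]_w (F (w + s) * cos (z * w)) + \int[mu]_w (F (w - s) * cos (z * w))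
    - 2 * ctr F z.
  rewrite /ctr -RintegralZl//; last exact: integrable_ctr.
  rewrite -RintegralD//; [|exact: integrable_ctr|exact: integrable_ctr].
  rewrite -RintegralB//.
  - by apply: eq_Rintegral => w _; ring.
  - by apply: integrable_addr; exact: integrable_ctr.
  - by apply: integrable_mull; exact: integrable_ctr.
have sh (t : R) : \int[mu]_w (F (w + t) * cos (z * w)) = \int[mu]_w (F w * cos (z * (w - t))).
  rewrite -(@Rintegral_shift (fun w => F w * cos (z * (w - t))) t).
    by apply: eq_Rintegral => w _; rewrite addrK.
  apply: measurable_funM => //.
  apply: (measurableT_comp (measurable_cosM z)); exact: measurable_funB.
rewrite split3 !sh mulrBl; congr (_ - _).
have isc (t : R) : mu.-integrable setT (EFin \o (fun w => F w * cos (z * (w - t)))).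
  apply: integrable_mul_bounded => //.
    by apply: (measurableT_comp (measurable_cosM z)); exact: measurable_funB.
  by move=> x; exact: cos_abs_le1.
rewrite -RintegralD//.
rewrite /ctr -RintegralZl//; last exact: integrable_ctr.
apply: eq_Rintegral => w _.
rewrite opprK mulrBr mulrDr cosB cosD; ring.
Qed.

Lemma lor_inv_sqr (z : R) : 1 <= `|z| -> (z ^+ 2)^-1 <= 2 * lor z.
Proof.
move=> z1; have z2 : 1 <= z ^+ 2 by rewrite -real_normK ?num_real// expr_ge1.
rewrite /lor ler_pdivlMr ?one_sqr_gt0// mulrC ler_pdivrMr; last lra.
by lra.
Qed.

Lemma lor_ge_half (z : R) : `|z| <= 1 -> 1 <= 2 * lor z.
Proof.
move=> z1; have z2 : z ^+ 2 <= 1 by rewrite -real_normK ?num_real// expr_le1.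
by rewrite /lor ler_pdivlMr ?one_sqr_gt0// mul1r; lra.
Qed.

(** From [w ^ 2 <= 2 * x ^ 2 + 2 * A ^ 2]. The factor depends on the dilation [s0] only through its
    upper bound [S], which keeps the later constants uniform for small Gaussian times. *)
Lemma lor_shift (S A s0 w x : R) : 0 <= s0 -> s0 <= S -> `|w - x| <= A ->
  lor (s0 * x) <= (2 + 2 * S ^+ 2 * A ^+ 2) * lor (s0 * w).
Proof.
move=> s00 s0S wxA.
rewrite /lor -[X in X <= _]mul1r ler_pdivrMr ?one_sqr_gt0//.
rewrite mulrAC ler_pdivlMr ?one_sqr_gt0// mul1r !exprMn.
have A0 : 0 <= A by exact: (le_trans _ wxA).
have wx : (w - x) ^+ 2 <= A ^+ 2.
  by rewrite -[leLHS]real_normK ?num_real//; apply: lerXn2r; rewrite // nnegrE.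
have w2 : w ^+ 2 <= 2 * x ^+ 2 + 2 * A ^+ 2.
  have := sqr_ge0 (w - 2 * x); move: wx; rewrite !sqrrB exprMn; lra.
have s2 : s0 ^+ 2 <= S ^+ 2 by apply: lerXn2r; rewrite // nnegrE// (le_trans s00).
have : s0 ^+ 2 * w ^+ 2 <= s0 ^+ 2 * (2 * x ^+ 2 + 2 * A ^+ 2).
  by rewrite ler_wpM2l ?sqr_ge0.
have : s0 ^+ 2 * A ^+ 2 <= S ^+ 2 * A ^+ 2 by rewrite ler_wpM2r ?sqr_ge0.
have : 0 <= S ^+ 2 * A ^+ 2 * (s0 ^+ 2 * x ^+ 2) by nonneg.
have : 0 <= s0 ^+ 2 * x ^+ 2 by nonneg.
lra.
Qed.

(* With step [s = pi / z], the second difference of the cosine wave at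
   frequency [z] is [-4] times itself, so two derivatives of [F] give the
   quadratic decay without integrating by parts. *)
Lemma ctr_le_lor (S : R) : 0 < S -> exists2 C : R, 0 < C &
  forall s0, 0 < s0 -> s0 <= S -> forall F M,
    C2bd F (fun w => M * lor (s0 * w)) ->
    forall z, `|ctr F z| <= C * M / s0 * lor z.
Proof.
move=> S0; have pi0 : 0 < (pi : R) := pi_gt0 R.
pose D := 2 + 2 * S ^+ 2 * pi ^+ 2.
have D0 : 0 < D by rewrite /D; nra.
(* The term [2 * pi] serves [|z| <= 1]. For larger [|z|] the squared step gives [pi ^ 2] and the
   mass of the Lorentzian one more [pi]. *)
exists (2 * pi + D * pi ^+ 3); first by rewrite addr_gt0 ?mulr_gt0 ?exprn_gt0.
move=> s0 s00 s0S F M FM z.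
have M0 : 0 <= M.
  by have := C2bd_ge0 0 FM; rewrite pmulr_lge0// lor_gt0.
have il := integrable_mull M (integrable_lor_scale s00).
(* The factor [1 / s0] of the statement is the mass of the dilated Lorentzian. *)
have Il : \int[mu]_w (M * lor (s0 * w)) = M * (pi / s0).
  rewrite RintegralZl//; last exact: integrable_lor_scale.
  by rewrite /Rintegral integral_lor_scale.
have mF : measurable_fun setT F by apply: continuous_measurable_fun; exact: C2bd_continuous FM.
have iF : mu.-integrable setT (EFin \o F).
  by apply: (integrable_le mF il) => x; exact: (C2bd_abs x FM).
have l0 := lor_gt0 z.
have Ms0 : 0 <= M / s0 by rewrite divr_ge0// ltW.
have Dpi : 0 <= D * pi ^+ 3 by rewrite mulr_ge0 ?exprn_ge0 ?ltW.
have [z1|z1] := leP `|z| 1.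
  have : `|ctr F z| <= M * (pi / s0).
    rewrite -Il; apply: le_abs_Rintegral => //.
      by apply: measurable_funM => //; exact: measurable_cosM.
    move=> x; rewrite normrM; apply: (le_trans _ (C2bd_abs x FM)).
    by rewrite ler_piMr// cos_abs_le1.
  move=> /le_trans; apply.
  have l1 := lor_ge_half z1.
  rewrite (_ : M * (pi / s0) = pi * (M / s0)); last by ring.
  rewrite (_ : _ * lor z = pi * (M / s0) * (2 * lor z) + D * pi ^+ 3 * (M / s0) * lor z); last by ring.
  have h1 : pi * (M / s0) <= pi * (M / s0) * (2 * lor z).
    by rewrite ler_peMr// mulr_ge0// ltW.
  have h2 : 0 <= D * pi ^+ 3 * (M / s0) * lor z.
    exact: (mulr_ge0 (mulr_ge0 Dpi Ms0) (ltW l0)).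
  by lra.
pose s := pi / `|z|.
have z0 : 0 < `|z| by lra.
have s_0 : 0 <= s by rewrite divr_ge0// ltW.
have spi : s <= pi by rewrite ler_pdivrMr// ler_peMr ?ltW.
have cs : cos (z * s) = -1.
  have [zp|zn] := leP 0 z.
    by rewrite /s (ger0_norm zp) mulrC divfK ?cospi// gt_eqF// -(ger0_norm zp).
  have -> : z * s = - pi by rewrite /s (ltr0_norm zn); field; rewrite lt_eqF.
  by rewrite cosN cospi.
have Dlor (w x : R) : w - s <= x <= w + s -> lor (s0 * x) <= D * lor (s0 * w).
  move=> /andP[x1 x2]; apply: lor_shift => //; first exact: ltW.
  by rewrite ler_norml; lra.
have key : `|\int[mu]_w ((F (w + s) + F (w - s) - 2 * F w) * cos (z * w))| <=
    2 * D * s ^+ 2 * (M * (pi / s0)).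
  rewrite -Il -RintegralZl//.
  apply: le_abs_Rintegral.
  - apply: measurable_funM; last exact: measurable_cosM.
    apply: measurable_funB; last exact: measurable_funM.
    by apply: measurable_funD; apply: measurableT_comp => //;
       [exact: measurable_funD|exact: measurable_funB].
  - exact: integrable_mull.
  - move=> w; rewrite normrM; apply: (@le_trans _ _ `|F (w + s) + F (w - s) - 2 * F w|).
      by rewrite ler_piMr// cos_abs_le1.
    case: FM => [F1 [F2 [d1 d2 h]]].
    have := @second_difference_le _ F F1 F2 w s (D * (M * lor (s0 * w))) s_0 d1 d2.
    rewrite (_ : 2 * (D * _) * _ = 2 * D * s ^+ 2 * (M * lor (s0 * w))); last by ring.
    apply=> x xs; have [_ _ h2] := h x; apply: (le_trans h2).
    by rewrite mulrCA ler_wpM2l// Dlor.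
move: key; rewrite ctr_second_difference// cs normrM.
rewrite (_ : `|2 * -1 - 2| = 4); last by rewrite ltr0_norm; lra.
have -> : s ^+ 2 = pi ^+ 2 * (z ^+ 2)^-1 by rewrite /s expr_div_n real_normK ?num_real.
have zz := lor_inv_sqr (ltW z1).
set q := `|ctr F z| => key.
rewrite (_ : 2 * D * _ * _ = 2 * (D * pi ^+ 3) * (M / s0) * (z ^+ 2)^-1) in key; last by ring.
have k2 : 2 * (D * pi ^+ 3) * (M / s0) * (z ^+ 2)^-1 <= 2 * (D * pi ^+ 3) * (M / s0) * (2 * lor z).
  by rewrite ler_wpM2l// mulr_ge0// mulr_ge0.
have k3 : 0 <= 2 * pi * (M / s0) * lor z.
  by apply: mulr_ge0 (ltW l0); apply: mulr_ge0 => //; apply: mulr_ge0 => //; exact: ltW.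
rewrite (_ : _ / s0 * _ = 2 * pi * (M / s0) * lor z + D * pi ^+ 3 * (M / s0) * lor z); last by ring.
by lra.
Qed.
End CosineTransform.

(** * Differentiation under the integral sign *)

Section UnderIntegral.
Context {R : realType}.
Notation mu := (@lebesgue_measure R).

Lemma is_derive_under_integral (D : set R) (f df : R -> R -> R) (g : R -> R) (a : R) :
  measurable D ->
  (forall x, mu.-integrable D (EFin \o f x)) ->
  (forall x y : R, is_derive x 1 (f^~ y) (df x y)) ->
  mu.-integrable D (EFin \o g) ->
  (forall x y, `|x - a| < 1 -> D y -> `|df x y| <= g y) ->
  is_derive a 1 (fun x => \int[mu]_(y in D) f x y) (\int[mu]_(y in D) df a y).
Proof.
move=> mD intf dfE ig dg.
have Ia : `]a - 1, a + 1[%classic a by rewrite /= in_itv /=; apply/andP; split; lra.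
have intg : mu.-integrable D (EFin \o (fun y => `|g y|)) by exact: integrable_norm.
have der x y : derivable (f^~ y) x 1 by have := dfE x y => ?; exact: ex_derive.
have p1E x y : partial1of2 f x y = df x y.
  by rewrite partial1of2E; have := dfE x y => ?; exact: derive_val.
have ub x y : `]a - 1, a + 1[%classic x -> D y -> `|partial1of2 f x y| <= `|g y|.
  rewrite /= in_itv /= p1E => /andP[x1 x2] Dy.
  by rewrite (le_trans (dg _ _ _ Dy)) ?ler_norm// ltr_norml; lra.
apply: DeriveDef.
  exact: (@derivable_under_integral R _ _ mu f D mD a (a - 1) (a + 1) Ia
    (fun x _ => intf x) (fun x y _ _ => der x y) _ (fun y => normr_ge0 _) intg ub).
rewrite -derive1E.
rewrite (@differentiation_under_integral R _ _ mu f D mD a (a - 1) (a + 1) Ia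
    (fun x _ => intf x) (fun x y _ _ => der x y) _ (fun y => normr_ge0 _) intg ub).
by apply: eq_Rintegral => y _; exact: p1E.
Qed.

(* [int G(w + s) dw] does not depend on [s]; differentiate at [s = 0]. *)
Lemma integral_derive_eq0 (G G1 g : R -> R) :
  mu.-integrable setT (EFin \o G) -> (forall x : R, is_derive x 1 G (G1 x)) ->
  mu.-integrable setT (EFin \o g) ->
  (forall s w, `|s| < 1 -> `|G1 (w + s)| <= g w) ->
  \int[mu]_w G1 w = 0.
Proof.
move=> iG dG ig G1g.
have H := @is_derive_under_integral setT (fun s w => G (w + s)) (fun s w => G1 (w + s)) g 0 measurableT.
have d0 : is_derive (0 : R) 1 (fun s => \int[mu]_w G (w + s)) (\int[mu]_w G1 (w + 0)).
  apply: H => //.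
  - by move=> s; exact: integrable_shift.
  - move=> s w; rewrite -[G1 _]mul1r.
    exact: (@is_derive_comp _ G (fun s => w + s) s 1 (G1 (w + s)) (is_derive_addl w s) (dG _)).
  - by move=> s w; rewrite subr0 => s1 _; exact: G1g.
have c0 : is_derive (0 : R) 1 (fun s => \int[mu]_w G (w + s)) 0.
  rewrite (_ : (fun s => _) = cst (\int[mu]_w G w)); last first.
    by apply/funext => s; apply: Rintegral_shift; exact: measurable_integrable.
  exact: is_derive_cst.
have := @derive_val _ _ _ _ _ _ _ d0; have := @derive_val _ _ _ _ _ _ _ c0.
move=> -> /esym; under eq_Rintegral do rewrite addr0.
by [].
Qed.

End UnderIntegral.

(** * Bounds with two derivatives on Gaussians and damped symbols *)

Section GaussianBounds.
Context {R : realType}.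
Notation mu := (@lebesgue_measure R).

(** The symbol of [exp (t Delta / 2)]. It is multiplicative in [t], so that powers of the operator
    amount to longer times. *)
Definition gexp (t w : R) : R := expR (- (t * w ^+ 2 / 2)).

Lemma gexp_gt0 t w : 0 < gexp t w. Proof. exact: expR_gt0. Qed.

Lemma gexp_le1 t w : 0 <= t -> gexp t w <= 1.
Proof. by move=> t0; rewrite -expR0 ler_expR oppr_le0; nonneg. Qed.

Lemma is_derive_gexp (t w : R) : is_derive w 1 (gexp t) (- (t * w) * gexp t w).
Proof.
have h : is_derive w 1 (fun w => - (t * w ^+ 2 / 2)) (- (t * w)).
  by apply: is_derive_eq; rewrite /GRing.scale /=; field.
exact: (is_derive_comp h (is_derive_expR _)).
Qed.

Lemma is_derive2_gexp (t w : R) :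
  is_derive w 1 (fun w => - (t * w) * gexp t w) ((t ^+ 2 * w ^+ 2 - t) * gexp t w).
Proof.
have := is_derive_gexp t w => h.
have h2 : is_derive w 1 (fun w => - (t * w)) (- t).
  by apply: is_derive_eq; rewrite /GRing.scale /=; ring.
by apply: is_derive_eq; rewrite /GRing.scale /=; ring.
Qed.

Lemma lorV (w : R) : (1 + w ^+ 2) * lor w = 1.
Proof. by rewrite /lor divff// gt_eqF// one_sqr_gt0. Qed.

(** With [u = sqrt t * w], the Gaussian is the squared inverse of [exp (u ^ 2 / 4)], which is at
    least [(1 + u ^ 2) / 4]. The square leaves one factor [lor] to absorb the quadratic polynomials
    that two derivatives produce. *)
Lemma gexp_le_lor (t w : R) : 0 <= t -> gexp t w <= 16 * lor (Num.sqrt t * w) ^+ 2.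
Proof.
move=> t0; set u := Num.sqrt t * w.
have uE : t * w ^+ 2 = u ^+ 2 by rewrite /u exprMn sqr_sqrtr.
have -> : gexp t w = (expR (u ^+ 2 / 4))^-1 ^+ 2.
  rewrite /gexp uE -expRN -expRM_natl; congr expR; by field.
have u0 : 0 <= u ^+ 2 := sqr_ge0 u.
have -> : 16 * lor u ^+ 2 = (4 * lor u) ^+ 2 by rewrite exprMn; congr (_ * _); ring.
apply: lerXn2r; rewrite ?nnegrE ?invr_ge0 ?expR_ge0//.
  by rewrite mulr_ge0 ?lor_ge0.
have e1 : (1 + u ^+ 2) / 4 <= expR (u ^+ 2 / 4).
  by apply: (le_trans _ (expR_ge1Dx _)); lra.
have h : 0 < (1 + u ^+ 2) / 4 by lra.
have -> : 4 * lor u = ((1 + u ^+ 2) / 4)^-1 by rewrite /lor invf_div.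
by rewrite lef_pV2 ?posrE ?expR_gt0.
Qed.

Lemma gexp_le_lor1 (t w : R) : 0 <= t ->
  (1 + t * w ^+ 2) * gexp t w <= 16 * lor (Num.sqrt t * w).
Proof.
move=> t0; have := gexp_le_lor w t0; have := lorV (Num.sqrt t * w).
rewrite exprMn sqr_sqrtr//; have := lor_gt0 (Num.sqrt t * w).
set l := lor _ => l0 lE h.
have u0 : 0 <= 1 + t * w ^+ 2 by nonneg.
have := ler_wpM2l u0 h.
have -> : (1 + t * w ^+ 2) * (16 * l ^+ 2) = 16 * ((1 + t * w ^+ 2) * l) * l by ring.
by rewrite lE mulr1.
Qed.

(** The factors brought by the derivatives are at most [(1 + T) * (1 + t * w ^ 2)], which
    [gexp_le_lor1] absorbs. The majorant has mass of order [t ^ (-1/2)]: this is the origin of the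
    factor [1 / Num.sqrt t] in the kernels. *)
Lemma C2bd_gexp (T t : R) : 0 <= t -> t <= T ->
  C2bd (gexp t) (fun w => 16 * (1 + T) * lor (Num.sqrt t * w)).
Proof.
move=> t0 tT; exists (fun w => - (t * w) * gexp t w).
exists (fun w => (t ^+ 2 * w ^+ 2 - t) * gexp t w).
split; [exact: is_derive_gexp|exact: is_derive2_gexp|move=> w].
have h := gexp_le_lor1 w t0; have g0 := gexp_gt0 t w.
have u0 : 0 <= t * w ^+ 2 by nonneg.
have T0 : 0 <= T by lra.
have key (c : R) : `|c| <= (1 + T) * (1 + t * w ^+ 2) ->
    `|c * gexp t w| <= 16 * (1 + T) * lor (Num.sqrt t * w).
  move=> hc; rewrite normrM (gtr0_norm g0).
  apply: (@le_trans _ _ ((1 + T) * (1 + t * w ^+ 2) * gexp t w)).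
    by rewrite ler_wpM2r// ltW.
  have T1 : 0 <= 1 + T by lra.
  by have := ler_wpM2l T1 h; rewrite mulrA; lra.
have TT : 0 <= T * (t * w ^+ 2) by nonneg.
split.
- by rewrite -[gexp t w]mul1r; apply: key; rewrite normr1; nra.
- apply: key; rewrite normrN ler_norml.
  have := mulr_ge0 t0 (sqr_ge0 (w + 1)); have := mulr_ge0 t0 (sqr_ge0 (w - 1)).
  by rewrite sqrrB sqrrD => *; apply/andP; split; nra.
- apply: key; rewrite ler_norml.
  have : 0 <= t * (t * w ^+ 2) by nonneg.
  have : t * (t * w ^+ 2) <= T * (t * w ^+ 2) by rewrite ler_wpM2r.
  by move=> *; apply/andP; split; nra.
Qed.

Lemma C2bd_gexp1 (t : R) : 0 <= t -> t <= 1 -> C2bd (gexp t) (fun=> 32).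
Proof.
move=> t0 t1; apply: C2bd_le (C2bd_gexp t0 t1) _ => x.
by have := lor_le1 (Num.sqrt t * x); lra.
Qed.

Lemma is_derive_lor (w : R) : is_derive w 1 lor (- (2 * w) * lor w ^+ 2).
Proof.
have h : is_derive w 1 (fun w => 1 + w ^+ 2) (2 * w).
  by apply: is_derive_eq; rewrite /GRing.scale /=; ring.
have n0 : 1 + w ^+ 2 != 0 by rewrite gt_eqF// one_sqr_gt0.
have h2 := is_deriveV (f := fun w : R => 1 + w ^+ 2) n0 h.
apply: (is_derive_eq h2); rewrite /GRing.scale /= /lor; field.
by rewrite ?expf_neq0.
Qed.

Lemma is_derive2_lor (w : R) : is_derive w 1 (fun w => - (2 * w) * lor w ^+ 2)
  (- 2 * lor w ^+ 2 + 8 * w ^+ 2 * lor w ^+ 3).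
Proof.
have := is_derive_lor w => h.
by apply: is_derive_eq; rewrite /GRing.scale /=; ring.
Qed.

Lemma lor_abs1 (w : R) : `|w| * lor w <= 1.
Proof.
have := lorV w; have := lor_gt0 w; set l := lor w => l0 lE.
rewrite -lE ler_wpM2r ?(ltW l0)//.
by rewrite -[w ^+ 2]real_normK ?num_real//; have := sqr_ge0 (`|w| - 1); nra.
Qed.

Lemma lor_sqr1 (w : R) : w ^+ 2 * lor w <= 1.
Proof. by have := lorV w; have := lor_gt0 w; nra. Qed.

Lemma lor_derive_le (w : R) :
  `|- (2 * w) * lor w ^+ 2| <= lor w /\
  `|- (2 * w) * lor w ^+ 2| <= 2 * `|w| * lor w ^+ 2 /\
  `|- 2 * lor w ^+ 2 + 8 * w ^+ 2 * lor w ^+ 3| <= 10 * lor w.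
Proof.
have l0 := lor_gt0 w; have l1 := lor_le1 w; have := lorV w; have := lor_sqr1 w.
set l := lor w in l0 l1 * => w2 lE.
have E1 : `|- (2 * w) * l ^+ 2| = 2 * `|w| * l ^+ 2.
  by rewrite normrM normrN normrM normr_nat (ger0_norm (sqr_ge0 l)).
rewrite E1; split; last split => //.
- have hh : 2 * `|w| <= 1 + w ^+ 2.
    by rewrite -[w ^+ 2]real_normK ?num_real//; have := sqr_ge0 (`|w| - 1); nra.
  apply: (le_trans (ler_wpM2r (sqr_ge0 l) hh)).
  by rewrite [l ^+ 2]expr2 mulrA lE mul1r.
- apply: (le_trans (ler_normD _ _)); rewrite normrM normrN normr_nat (ger0_norm (sqr_ge0 l)).
  rewrite ger0_norm; last by nonneg.
  have -> : 8 * w ^+ 2 * l ^+ 3 = 8 * (w ^+ 2 * l) * l * l by ring.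
  have ll : l * l <= l by rewrite ler_piMl// ltW.
  have : (w ^+ 2 * l) * (l * l) <= l * l by rewrite ler_piMl// mulr_ge0 ?ltW.
  by lra.
Qed.

Lemma C2bd_lor : C2bd (@lor R) (fun w => 10 * lor w).
Proof.
exists (fun w => - (2 * w) * lor w ^+ 2).
exists (fun w => - 2 * lor w ^+ 2 + 8 * w ^+ 2 * lor w ^+ 3).
split; [exact: is_derive_lor|exact: is_derive2_lor|move=> w].
have [h1 [_ h2]] := lor_derive_le w; have l0 := lor_gt0 w.
by split; rewrite ?(gtr0_norm l0)//; lra.
Qed.

(** The symbol of [(1 - exp (t Delta / 2)) (1 - Delta)^-1]: the first factor is small only at low
    frequency, like [t * w ^ 2], and [lor] compensates the growth of [w ^ 2]. *)
Definition damp (t w : R) : R := (1 - gexp t w) * lor w.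

Lemma C2bd_one_sub_gexp (t : R) : 0 <= t -> t <= 1 ->
  C2bd (fun w => 1 - gexp t w) (fun=> 33).
Proof.
move=> t0 t1; have [G1 [G2 [d1 d2 h]]] := C2bd_gexp1 t0 t1.
exists (fun w => - G1 w), (fun w => - G2 w); split.
- move=> w; have := d1 w => ?; rewrite -[- _]add0r; exact: is_deriveB.
- by move=> w; have := d2 w => ?; exact: is_deriveN.
- move=> w; have [h0 h1 h2] := h w; rewrite !normrN; split; try lra.
  by apply: (le_trans (ler_normB _ _)); rewrite normr1; lra.
Qed.

Lemma C2bd_damp_lor (t : R) : 0 <= t -> t <= 1 ->
  C2bd (damp t) (fun w => 1320 * lor w).
Proof.
move=> t0 t1; apply: C2bd_le (C2bd_mul (C2bd_one_sub_gexp t0 t1) C2bd_lor) _ => w.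
by lra.
Qed.

(** The product rule [C2bd_mul] would lose the factor [t], since [1 - gexp t w] is O([t]) only after
    multiplication by [lor]. Hence each product of derivatives is estimated separately, through
    [1 - gexp t w <= t * w ^ 2 / 2] and [w ^ 2 * lor w <= 1]. The second derivative gives
    [25 = 16 + 2 * 2 + 5]. *)
Lemma C2bd_damp_cst (t : R) : 0 <= t -> t <= 1 -> C2bd (damp t) (fun=> 25 * t).
Proof.
move=> t0 t1.
pose e1 w := t * w * gexp t w; pose e2 w := (t - t ^+ 2 * w ^+ 2) * gexp t w.
pose l1 (w : R) := - (2 * w) * lor w ^+ 2.
pose l2 (w : R) := - 2 * lor w ^+ 2 + 8 * w ^+ 2 * lor w ^+ 3.
have de (w : R) : is_derive w 1 (fun w => 1 - gexp t w) (e1 w).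
  have h := is_derive_gexp t w.
  apply: (is_derive_eq (is_deriveB (is_derive_cst (1 : R) w 1) h)).
  by rewrite /e1; ring.
have de2 (w : R) : is_derive w 1 e1 (e2 w).
  have h := is_deriveN (is_derive2_gexp t w).
  rewrite /e1 (_ : (fun w => _) = - (fun w : R => - (t * w) * gexp t w)).
    by apply: (is_derive_eq h); rewrite /e2; ring.
  by apply/funext => x; rewrite -[RHS]/(- (- (t * x) * gexp t x)) /e1; ring.
exists (fun w => e1 w * lor w + (1 - gexp t w) * l1 w).
exists (fun w => e2 w * lor w + 2 * (e1 w * l1 w) + (1 - gexp t w) * l2 w).
split.
- move=> w; have := de w; have := is_derive_lor w => ? ?.
  by apply: is_derive_eq; rewrite /GRing.scale /= /l1; ring.
- move=> w; have := de w; have := is_derive_lor w; have := de2 w.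
  have := is_derive2_lor w; rewrite -/l1 -/(l1 w) -/(l2 w) => ? ? ? ?.
  by apply: is_derive_eq; rewrite /GRing.scale /= ; ring.
- move=> w; have g0 := gexp_gt0 t w; have g1 := gexp_le1 w t0.
  have E0 : `|1 - gexp t w| <= t * w ^+ 2 / 2.
    rewrite ger0_norm ?subr_ge0// lerBlDl -lerBlDr -[leLHS]/(1 + - (t * w ^+ 2 / 2)).
    exact: expR_ge1Dx.
  have E1 : `|e1 w| <= t * `|w|.
    rewrite /e1 !normrM (ger0_norm t0) (gtr0_norm g0) ler_piMr//; nonneg.
  have E2 : `|e2 w| <= 16 * t.
    rewrite /e2 (_ : t - t ^+ 2 * w ^+ 2 = t * (1 - t * w ^+ 2)); last by ring.
    rewrite !normrM (ger0_norm t0) (gtr0_norm g0) -mulrA mulrC ler_wpM2r//.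
    have := gexp_le_lor1 w t0; have := lor_le1 (Num.sqrt t * w).
    have : `|1 - t * w ^+ 2| <= 1 + t * w ^+ 2.
      have : 0 <= t * w ^+ 2 by nonneg.
      by rewrite ler_norml => ?; lra.
    move=> /(ler_wpM2r (ltW g0)); lra.
  have [L1 [L1' L2]] := lor_derive_le w.
  have l0 := lor_gt0 w; have ll1 := lor_le1 w.
  have w1 := lor_abs1 w; have w2 := lor_sqr1 w.
  rewrite -/(l1 w) in L1 L1'; rewrite -/(l2 w) in L2.
  have A0 : `|(1 - gexp t w) * lor w| <= t.
    rewrite normrM (gtr0_norm l0); apply: (le_trans (ler_wpM2r (ltW l0) E0)).
    by have := ler_wpM2l t0 w2; lra.
  have A1 : `|e1 w * lor w| <= t.
    rewrite normrM (gtr0_norm l0); apply: (le_trans (ler_wpM2r (ltW l0) E1)).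
    by have := ler_wpM2l t0 w1; lra.
  have A2 : `|(1 - gexp t w) * l1 w| <= t.
    rewrite normrM; apply: (le_trans (ler_pM _ _ E0 L1)) => //.
    by have := ler_wpM2l t0 w2; lra.
  have A3 : `|e2 w * lor w| <= 16 * t.
    rewrite normrM (gtr0_norm l0); apply: (le_trans (ler_pM _ _ E2 ll1)) => //.
      exact: ltW.
    by lra.
  have A4 : `|e1 w * l1 w| <= 2 * t.
    rewrite normrM; apply: (le_trans (ler_pM _ _ E1 L1')) => //.
    have -> : t * `|w| * (2 * `|w| * lor w ^+ 2) = 2 * t * ((`|w| * lor w) * (`|w| * lor w)).
      by ring.
    have : (`|w| * lor w) * (`|w| * lor w) <= 1 * 1.
      by apply: ler_pM => //; rewrite mulr_ge0// ltW.
    have : 0 <= 2 * t by lra.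
    by move=> h /(ler_wpM2l h); lra.
  have A5 : `|(1 - gexp t w) * l2 w| <= 5 * t.
    rewrite normrM; apply: (le_trans (ler_pM _ _ E0 L2)) => //.
    by have := ler_wpM2l t0 w2; lra.
  split; rewrite /damp.
  + by lra.
  + by apply: (le_trans (ler_normD _ _)); lra.
  + apply: (le_trans (ler_normD _ _)).
    have := ler_normD (e2 w * lor w) (2 * (e1 w * l1 w)).
    have -> : `|2 * (e1 w * l1 w)| = 2 * `|e1 w * l1 w| by rewrite normrM normr_nat.
    by lra.
Qed.

(** Of the [k + 1] factors, [k] are bounded by multiples of [t] and the remaining one by a multiple
    of [lor], which keeps the majorant integrable. The factor [gexp d] is the regularisation to be
    removed later, and the bound is uniform in it. *)
Lemma C2bd_damp_pow (k : nat) : exists2 C : R, 0 < C & forall t d, 0 <= t -> t <= 1 ->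
  0 <= d -> d <= 1 ->
  C2bd (fun w => damp t w ^+ k.+1 * gexp d w) (fun w => C * t ^+ k * lor w).
Proof.
have ck : 0 < (4 * 25 : R) ^+ k by apply: exprn_gt0; lra.
exists (4 * (4 * (1320 * (4 * 25) ^+ k) * 32)); first by lra.
move=> t d t0 t1 d0 d1.
have h := C2bd_mul (C2bd_damp_lor t0 t1) (C2bd_pow k (C2bd_damp_cst t0 t1)).
have := C2bd_mul h (C2bd_gexp1 d0 d1).
move=> /C2bd_ext -/(_ (fun w => damp t w ^+ k.+1 * gexp d w)) h2.
apply: C2bd_le (h2 _) _ => [w|w]; first by rewrite exprS.
have -> : (4 * (25 * t)) ^+ k = (4 * 25) ^+ k * t ^+ k by rewrite mulrA exprMn.
by rewrite le_eqVlt; apply/orP; left; apply/eqP; ring.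
Qed.

End GaussianBounds.

(** * The cosine transform of a Gaussian *)

Section GaussianTransform.
Context {R : realType}.
Notation mu := (@lebesgue_measure R).

Lemma continuous_gexp (t : R) : continuous (gexp t).
Proof.
move=> w; apply: differentiable_continuous; apply/derivable1_diffP.
by have := is_derive_gexp t w => ?; exact: ex_derive.
Qed.

Lemma measurable_gexp (t : R) : measurable_fun setT (gexp t).
Proof. exact: continuous_measurable_fun (@continuous_gexp t). Qed.

Lemma measurable_sinM (z : R) : measurable_fun setT (fun w : R => sin (z * w)).
Proof.
apply: continuous_measurable_fun => x.
apply: (@continuous_comp _ _ _ ( *%R z) sin); first exact: mulrl_continuous.
exact: continuous_sin.
Qed.

Lemma integrable_C2bd_lor (F : R -> R) (M s : R) : 0 < s ->
  C2bd F (fun w => M * lor (s * w)) -> mu.-integrable setT (EFin \o F).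
Proof.
move=> s0 h.
have mF : measurable_fun setT F.
  by apply: continuous_measurable_fun; exact: (C2bd_continuous h).
apply: (integrable_le mF (integrable_mull M (integrable_lor_scale s0))) => x.
exact: (C2bd_abs x h).
Qed.

Lemma integrable_gexp (t : R) : 0 < t -> mu.-integrable setT (EFin \o gexp t).
Proof.
move=> t0; have s0 : 0 < Num.sqrt t by rewrite sqrtr_gt0.
exact: (integrable_C2bd_lor s0 (C2bd_gexp (ltW t0) (lexx t))).
Qed.

Lemma integral_gexp (t : R) : 0 < t ->
  \int[mu]_w gexp t w = Num.sqrt (2 * pi / t).
Proof.
move=> t0; pose s := (Num.sqrt t)^-1.
have s0 : s != 0 by rewrite invr_neq0// gt_eqF// sqrtr_gt0.
have s2 : s ^+ 2 = t^-1 by rewrite exprVn sqr_sqrtr// ltW.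
have E : \int[mu]_w normal_pdf 0 s w = 1 by rewrite /Rintegral integral_normal_pdf.
have pdfE w : normal_pdf 0 s w = normal_peak s * gexp t w.
  rewrite /normal_pdf (negbTE s0) /normal_fun /gexp s2 subr0.
  congr (_ * expR _); rewrite -mulr_natr; by field; rewrite gt_eqF.
move: E; under eq_Rintegral do rewrite pdfE.
rewrite RintegralZl//; last exact: integrable_gexp.
have pk : normal_peak s != 0 by rewrite gt_eqF// normal_peak_gt0.
move=> /(congr1 (fun x => (normal_peak s)^-1 * x)).
rewrite mulrA mulVf// mul1r mulr1 => ->.
rewrite /normal_peak invrK s2; congr Num.sqrt; rewrite -mulr_natr; ring.
Qed.

Lemma is_derive_ctr_gexp (t z : R) : 0 < t ->
  is_derive z 1 (ctr (gexp t)) (\int[mu]_w (- (w * gexp t w * sin (z * w)))).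
Proof.
move=> t0; have st0 : 0 < Num.sqrt t by rewrite sqrtr_gt0.
pose g (w : R) := t^-1 * (16 * (1 + t) * lor (Num.sqrt t * w)).
have wg w : `|w * gexp t w| <= g w.
  have [G1 [G2 [d1 d2 h]]] := C2bd_gexp (ltW t0) (lexx t).
  have [_ h1 _] := h w.
  (* [C2bd] hides its derivatives; uniqueness of the derivative identifies [G1], whose bound is then
     a bound on [w * gexp t w]. *)
  have E : G1 w = - (t * w) * gexp t w.
    have <- := @derive_val _ _ _ _ _ _ _ (d1 w).
    by have <- := @derive_val _ _ _ _ _ _ _ (is_derive_gexp t w).
  have -> : w * gexp t w = - t^-1 * G1 w by rewrite E; field; rewrite gt_eqF.
  by rewrite normrM normrN (gtr0_norm (_ : 0 < t^-1)) ?invr_gt0// /g ler_wpM2l// invr_ge0 ltW.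
apply: (@is_derive_under_integral R setT (fun z w => gexp t w * cos (z * w))
  (fun z w => - (w * gexp t w * sin (z * w))) g z measurableT) => //.
- by move=> x; apply: integrable_ctr; exact: integrable_gexp.
- move=> x w.
  have h : is_derive x 1 (fun x => x * w) w.
    by apply: is_derive_eq; rewrite /GRing.scale /=; ring.
  have h2 := is_derive_comp h (is_derive_cos (x * w)).
  have h3 := is_deriveM (is_derive_cst (gexp t w) x 1) h2.
  by apply: (is_derive_eq h3); rewrite /GRing.scale /=; ring.
- exact: integrable_mull (integrable_mull _ (integrable_lor_scale st0)).
- move=> x w _ _; rewrite normrN normrM (le_trans _ (wg w))//.
  by rewrite ler_piMr// ler_norml sin_geN1 sin_le1.
Qed.

(** As the derivative of [gexp t w * sin (y * w)] has integral zero, the transform satisfies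
    [u' = - (y / t) * u]. Hence its product with [exp (y ^ 2 / (2 * t))] is constant, and the value
    at 0 is the Gaussian integral. *)
Lemma ctr_gexp (t z : R) : 0 < t ->
  ctr (gexp t) z = Num.sqrt (2 * pi / t) * gexp t^-1 z.
Proof.
move=> t0; have st0 : 0 < Num.sqrt t by rewrite sqrtr_gt0.
have iwg : mu.-integrable setT (EFin \o (fun w => w * gexp t w)).
  have [G1 [G2 [d1 d2 h]]] := C2bd_gexp (ltW t0) (lexx t).
  have E w : G1 w = - (t * w) * gexp t w.
    have <- := @derive_val _ _ _ _ _ _ _ (d1 w).
    by have <- := @derive_val _ _ _ _ _ _ _ (is_derive_gexp t w).
  have h1 : mu.-integrable setT (EFin \o G1).
    apply: (@integrable_le _ _ (fun w => 16 * (1 + t) * lor (Num.sqrt t * w))).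
    - apply: (eq_measurable_fun (fun w => - (t * w) * gexp t w)); first by move=> w _; rewrite E.
      apply: measurable_funM; last exact: measurable_gexp.
      by apply: measurableT_comp => //; exact: mulrl_measurable.
    - exact: (integrable_mull _ (integrable_lor_scale st0)).
    - by move=> w; have [] := h w.
  have := integrable_mull (- t^-1) h1.
  apply: eq_integrable => // w _ /=; rewrite E; congr (_%:E); by field; rewrite gt_eqF.
have iws (z' : R) : mu.-integrable setT (EFin \o (fun w => w * gexp t w * sin (z' * w))).
  apply: integrable_mul_bounded => //.
    exact: measurable_sinM.
  by move=> x; rewrite ler_norml sin_geN1 sin_le1.
have ode (y : R) : \int[mu]_w (- (w * gexp t w * sin (y * w))) = - (y / t) * ctr (gexp t) y.
  have := @integral_derive_eq0 R (fun w => gexp t w * sin (y * w))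
    (fun w => - (t * w) * gexp t w * sin (y * w) + y * (gexp t w * cos (y * w)))
    (fun w => 16 * (1 + t) * (1 + `|y|) * ((2 + 2 * Num.sqrt t ^+ 2 * 1 ^+ 2) * lor (Num.sqrt t * w))).
  have -> : \int[mu]_w (- (t * w) * gexp t w * sin (y * w) + y * (gexp t w * cos (y * w))) =
      t * \int[mu]_w (- (w * gexp t w * sin (y * w))) + y * ctr (gexp t) y.
    have iN : mu.-integrable setT (EFin \o (fun w => - (w * gexp t w * sin (y * w)))).
      have := integrable_mull (-1) (iws y).
      by apply: eq_integrable => // w _ /=; rewrite mulN1r.
    rewrite /ctr -!RintegralZl//; last by apply: integrable_ctr; exact: integrable_gexp.
    rewrite -RintegralD//.
    - by apply: eq_Rintegral => w _; ring.
    - exact: integrable_mull.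
    - by apply: integrable_mull; apply: integrable_ctr; exact: integrable_gexp.
  move=> H; suff : t * \int[mu]_w (- (w * gexp t w * sin (y * w))) + y * ctr (gexp t) y = 0.
    move=> /eqP; rewrite addr_eq0 => /eqP /(congr1 (fun x => t^-1 * x)).
    by rewrite mulrA mulVf ?gt_eqF// mul1r => ->; ring.
  apply: H.
  - apply: integrable_mul_bounded; first exact: integrable_gexp.
      exact: measurable_sinM.
    by move=> x; rewrite ler_norml sin_geN1 sin_le1.
  - move=> w; have h1 := is_derive_gexp t w.
    have h : is_derive w 1 (fun w => y * w) y.
      by apply: is_derive_eq; rewrite /GRing.scale /=; ring.
    have h2 := is_derive_comp h (is_derive_sin (y * w)).
    by apply: (is_derive_eq (is_deriveM h1 h2)); rewrite /GRing.scale /=; ring.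
  - exact: integrable_mull (integrable_mull _ (integrable_lor_scale st0)).
  - move=> s w s1.
    have [G1 [G2 [d1 d2 h]]] := C2bd_gexp (ltW t0) (lexx t).
    have [h0 h1 _] := h (w + s).
    have E : G1 (w + s) = - (t * (w + s)) * gexp t (w + s).
      have <- := @derive_val _ _ _ _ _ _ _ (d1 (w + s)).
      by have <- := @derive_val _ _ _ _ _ _ _ (is_derive_gexp t (w + s)).
    have sh : lor (Num.sqrt t * (w + s)) <= (2 + 2 * Num.sqrt t ^+ 2 * 1 ^+ 2) * lor (Num.sqrt t * w).
      apply: lor_shift; rewrite ?(ltW st0)//.
      by rewrite opprD addNKr normrN ltW.
    rewrite -E; set L := lor (Num.sqrt t * (w + s)) in h0 h1 sh *.
    apply: (@le_trans _ _ (16 * (1 + t) * (1 + `|y|) * L)); last first.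
      by rewrite ler_wpM2l//; nonneg.
    apply: (le_trans (ler_normD _ _)); rewrite !normrM.
    have a1 : `|G1 (w + s)| * `|sin (y * (w + s))| <= 16 * (1 + t) * L.
      by apply: (le_trans _ h1); rewrite ler_piMr// ler_norml sin_geN1 sin_le1.
    have a2 : `|gexp t (w + s)| * `|cos (y * (w + s))| <= 16 * (1 + t) * L.
      by apply: (le_trans _ h0); rewrite ler_piMr// cos_abs_le1.
    have a3 := ler_wpM2l (normr_ge0 y) a2.
    by lra.
have dh (y : R) : is_derive y 1 (fun y => ctr (gexp t) y * expR (y ^+ 2 / (2 * t))) 0.
  have h1 := is_derive_ctr_gexp y t0; rewrite ode in h1.
  have h : is_derive y 1 (fun y => y ^+ 2 / (2 * t)) (y / t).
    apply: is_derive_eq; rewrite /GRing.scale /=; by field; rewrite gt_eqF.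
  have h2 := is_derive_comp h (is_derive_expR (y ^+ 2 / (2 * t))).
  by apply: (is_derive_eq (is_deriveM h1 h2)); rewrite /GRing.scale /=; ring.
have := is_derive_0_is_cst z 0 dh.
rewrite expr0n mul0r expR0 mulr1.
have -> : ctr (gexp t) 0 = Num.sqrt (2 * pi / t).
  rewrite -integral_gexp//; apply: eq_Rintegral => w _.
  by rewrite mul0r cos0 mulr1.
move=> <-; rewrite -mulrA /gexp -expRD.
rewrite (_ : z ^+ 2 / (2 * t) + _ = 0) ?expR0 ?mulr1//.
by by field; rewrite gt_eqF.
Qed.

End GaussianTransform.

(** * Gaussian wave packets are Schwartz functions *)

Section GaussianSchwartz.
Context {R : realType}.

(** A class containing the real and imaginary parts of the wave packets and closed under
    differentiation, so that all derivatives are bounded at once. *)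
Definition trig_gauss (t y : R) (p q : {poly R}) (w : R) : R :=
  (p.[w] * cos (y * w) + q.[w] * sin (y * w)) * gexp t w.

Lemma is_derive_horner (p : {poly R}) (w : R) : is_derive w 1 (horner p) p^`().[w].
Proof.
apply: DeriveDef; first exact: derivable_horner.
by rewrite -derive1E derivE.
Qed.

Lemma is_derive_trig_gauss (t y : R) (p q : {poly R}) (w : R) :
  is_derive w 1 (trig_gauss t y p q)
    (trig_gauss t y (p^`() + y *: q - t *: ('X * p)) (q^`() - y *: p - t *: ('X * q)) w).
Proof.
have hp := is_derive_horner p w; have hq := is_derive_horner q w.
have hg := is_derive_gexp t w.
have h : is_derive w 1 (fun w => y * w) y.
  by apply: is_derive_eq; rewrite /GRing.scale /=; ring.
have hc := is_derive_comp h (is_derive_cos (y * w)).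
have hs := is_derive_comp h (is_derive_sin (y * w)).
apply: (is_derive_eq (is_deriveM (is_deriveD (is_deriveM hp hc) (is_deriveM hq hs)) hg)).
rewrite /trig_gauss !(hornerD, hornerN, hornerZ, hornerM, hornerX).
by rewrite /GRing.scale /= -[(_ + _ : R -> R) w]/(p.[w] * cos (y * w) + q.[w] * sin (y * w)); ring.
Qed.

Lemma derive1n_trig_gauss (t y : R) (p q : {poly R}) (n : nat) :
  exists p' q', ((trig_gauss t y p q)^`(n))%classic = trig_gauss t y p' q'.
Proof.
elim: n => [|n [p' [q' ih]]]; first by exists p, q; rewrite derive1n0.
exists (p'^`() + y *: q' - t *: ('X * p')), (q'^`() - y *: p' - t *: ('X * q')).
rewrite derive1nS ih; apply/funext => w; rewrite derive1E.
by have h := is_derive_trig_gauss t y p' q' w; apply: derive_val.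
Qed.

Lemma gexp_linear_bound (t w : R) : 0 < t -> `|w| * gexp t w <= 16 * (1 + t^-1).
Proof.
move=> t0; have := gexp_le_lor1 w (ltW t0); have := lor_le1 (Num.sqrt t * w).
have g0 := gexp_gt0 t w => l1 h.
have ti : 0 < t^-1 by rewrite invr_gt0.
have w1 : `|w| <= (1 + t^-1) * (1 + t * w ^+ 2).
  have -> : (1 + t^-1) * (1 + t * w ^+ 2) = 1 + w ^+ 2 + t * w ^+ 2 + t^-1.
    by field; rewrite gt_eqF.
  have : 0 <= t * w ^+ 2 by nonneg.
  by rewrite -[w ^+ 2]real_normK ?num_real//; have := sqr_ge0 (`|w| - 1); nra.
apply: (le_trans (ler_wpM2r (ltW g0) w1)).
have ti1 : 0 <= 1 + t^-1 by lra.
rewrite -mulrA mulrC [leRHS]mulrC [in leRHS]mulrC; apply: ler_wpM2r => //; lra.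
Qed.

Lemma gexp_double (t w : R) : gexp (t *+ 2) w = gexp t w * gexp t w.
Proof. by rewrite /gexp -expRD; congr expR; rewrite -mulr_natr; field. Qed.

(** Induction on the polynomial, for all times together: half of the Gaussian absorbs one factor
    [w], the other half goes to the induction hypothesis. *)
Lemma horner_gexp_bounded (p : {poly R}) (t : R) : 0 < t ->
  exists M, forall w, `|p.[w]| * gexp t w <= M.
Proof.
elim/poly_ind: p t => [|p c ih] t t0.
  by exists 0 => w; rewrite horner0 normr0 mul0r.
have t2 : 0 < t / 2 by rewrite divr_gt0.
have [M hM] := ih _ t2.
exists (M * (16 * (1 + (t / 2)^-1)) + `|c|) => w.
rewrite hornerMXaddC; have g0 := gexp_gt0 t w.
apply: (le_trans (ler_wpM2r (ltW g0) (ler_normD _ _))).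
rewrite mulrDl lerD//; last by rewrite ler_piMr// gexp_le1// ltW.
rewrite normrM {g0}[in gexp t w](_ : t = (t / 2) *+ 2); last by rewrite -mulr_natr divfK.
rewrite gexp_double mulrACA; apply: ler_pM => //.
- by rewrite mulr_ge0// ltW// gexp_gt0.
- by rewrite mulr_ge0// ltW// gexp_gt0.
- exact: gexp_linear_bound.
Qed.

Lemma real_schwartz_trig_gauss (t y : R) (p q : {poly R}) : 0 < t ->
  real_schwartz (trig_gauss t y p q).
Proof.
move=> t0; split=> [n x|m n].
  have [p' [q' ->]] := derive1n_trig_gauss t y p q n.
  by have h := is_derive_trig_gauss t y p' q' x; exact: ex_derive.
have [p' [q' ->]] := derive1n_trig_gauss t y p q n.
have [M1 h1] := horner_gexp_bounded ('X^m * p') t0.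
have [M2 h2] := horner_gexp_bounded ('X^m * q') t0.
exists (M1 + M2) => w.
have := h1 w; have := h2 w; rewrite !hornerM !hornerXn !normrM !normrX => k2 k1.
have g0 := gexp_gt0 t w.
rewrite (gtr0_norm g0).
have hh : `|p'.[w] * cos (y * w) + q'.[w] * sin (y * w)| <= `|p'.[w]| + `|q'.[w]|.
  apply: (le_trans (ler_normD _ _)); rewrite !normrM lerD// ler_piMr//.
    exact: cos_abs_le1.
  by rewrite ler_norml sin_geN1 sin_le1.
have w0 : 0 <= `|w| ^+ m by rewrite exprn_ge0.
have := ler_wpM2l w0 (ler_wpM2r (ltW g0) hh).
by move=> /le_trans; apply; rewrite !mulrA mulrDr mulrDl; lra.
Qed.

End GaussianSchwartz.

(** * The Bessel identity tested against wave packets *)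

Section BesselIdentity.
Context {R : realType}.
Notation mu := (@lebesgue_measure R).
Local Open Scope complex_scope.

Lemma Rintegral_odd (u : R -> R) : measurable_fun setT u ->
  (forall w, u (- w) = - u w) -> mu.-integrable setT (EFin \o u) ->
  \int[mu]_w u w = 0.
Proof.
move=> m_u odd_u iu.
have := Rintegral_reflect 0 m_u.
have -> : \int[mu]_w u (0 - w) = - \int[mu]_w u w.
  rewrite -mulN1r -RintegralZl//; apply: eq_Rintegral => w _.
  by rewrite sub0r odd_u mulN1r.
lra.
Qed.

(** Modulation by the frequency [y] translates the transform by [y], and evenness of [F] kills its
    imaginary part. *)
Lemma fourier_modulated (F : R -> R) (y x : R) :
  mu.-integrable setT (EFin \o F) -> (forall w, F (- w) = F w) ->
  fourier (fun w => (F w * cos (y * w)) +i* (F w * sin (y * w))) x =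
  ((Num.sqrt (2 * pi))^-1 * ctr F (x - y))%:C.
Proof.
move=> iF evF.
have m_F := measurable_integrable iF.
rewrite /fourier /cintegral.
set a := \int[mu]_x0 _; set b := \int[mu]_x0 _.
have -> : a = ctr F (x - y).
  apply: eq_Rintegral => w _ /=.
  rewrite mulrBl cosB [x * w]mulrC; ring.
have -> : b = 0.
  have -> : b = \int[mu]_w (F w * sin ((y - x) * w)).
    apply: eq_Rintegral => w _ /=.
    rewrite mulrBl sinB [x * w]mulrC; ring.
  have isn : mu.-integrable setT (EFin \o (fun w => F w * sin ((y - x) * w))).
    apply: integrable_mul_bounded => //; first exact: measurable_sinM.
    by move=> w; rewrite ler_norml sin_geN1 sin_le1.
  apply: Rintegral_odd => //; first exact: measurable_integrable.
  by move=> w; rewrite evF mulrN sinN mulrN.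
rewrite -[LHS]/(Complex (_ * _ - 0 * 0) (_ * 0 + 0 * _)).
by rewrite !mulr0 mul0r subr0 addr0.
Qed.

Lemma pairing_real (f K : R -> R) :
  pairing f (fun x => (K x)%:C) = (\int[mu]_x (f x * K x))%:C.
Proof.
rewrite /pairing /cintegral; congr (_ +i* _).
  by apply: eq_Rintegral => x _ /=; rewrite mul0r subr0.
under eq_Rintegral do rewrite /= mulr0 mul0r addr0.
by rewrite Rintegral_cst// mul0r.
Qed.

Lemma bessel_weightE (k : nat) (w : R) :
  (1 + w ^+ 2) `^ (- ((2 * k + 2)%:R / 2)) = lor w ^+ k.+1.
Proof.
have -> : ((2 * k + 2)%:R / 2 : R) = k.+1%:R.
  by rewrite natrD natrM -natr1; field.
by rewrite powRN powR_mulrn ?(ltW (one_sqr_gt0 _))// /lor exprVn.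
Qed.

(* The defining identity of the Bessel potential, tested against the Gaussian
   wave packet of frequency [y], whose Fourier transform is a translated
   Gaussian. *)
Lemma bessel_gaussian_identity (k : nat) (f g : R -> R) (t y : R) : 0 < t ->
  bessel_potential_of (2 * k + 2)%:R g f ->
  \int[mu]_x (f x * ((Num.sqrt (2 * pi))^-1 * ctr (gexp t) (x - y))) =
  \int[mu]_x (g x * ((Num.sqrt (2 * pi))^-1 * ctr (fun w => lor w ^+ k.+1 * gexp t w) (x - y))).
Proof.
move=> t0 H.
pose phi w := (gexp t w * cos (y * w)) +i* (gexp t w * sin (y * w)).
have sphi : schwartz phi.
  split; rewrite /phi /=.
    rewrite (_ : (fun x => _) = trig_gauss t y 1 0); first exact: real_schwartz_trig_gauss.
    by apply/funext => w; rewrite /trig_gauss horner0 mul0r addr0 hornerE mul1r mulrC.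
  rewrite (_ : (fun x => _) = trig_gauss t y 0 1); first exact: real_schwartz_trig_gauss.
  by apply/funext => w; rewrite /trig_gauss horner0 mul0r add0r hornerE mul1r mulrC.
have := H _ sphi.
have -> : fourier phi = (fun x => ((Num.sqrt (2 * pi))^-1 * ctr (gexp t) (x - y))%:C).
  apply/funext => x; apply: fourier_modulated; first exact: integrable_gexp.
  by move=> w; rewrite /gexp sqrrN.
pose Jg w := lor w ^+ k.+1 * gexp t w.
have -> : (fun w => ((1 + w ^+ 2) `^ (- ((2 * k + 2)%:R / 2)))%:C * phi w) =
    (fun w => (Jg w * cos (y * w)) +i* (Jg w * sin (y * w))).
  apply/funext => w; rewrite bessel_weightE.
  rewrite -[LHS]/(Complex (_ * _ - 0 * _) (_ * _ + 0 * _)) !mul0r subr0 addr0.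
  by rewrite /Jg !mulrA.
have iJ : mu.-integrable setT (EFin \o Jg).
  apply: (integrable_le _ (integrable_gexp t0)).
    apply: measurable_funM; last exact: measurable_gexp.
    by apply: measurable_funX; exact: measurable_lor.
  move=> w; rewrite normrM (gtr0_norm (gexp_gt0 _ _)) ler_piMl ?(ltW (gexp_gt0 _ _))//.
  by rewrite normrX (gtr0_norm (lor_gt0 _)) exprn_ile1 ?lor_ge0 ?lor_le1.
have -> : fourier (fun w => (Jg w * cos (y * w)) +i* (Jg w * sin (y * w))) =
    (fun x => ((Num.sqrt (2 * pi))^-1 * ctr Jg (x - y))%:C).
  apply/funext => x; apply: fourier_modulated => // w.
  by rewrite /Jg /gexp /lor sqrrN.
by rewrite !pairing_real => -[].
Qed.

End BesselIdentity.

(** * Change of scale in integrals *)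

Section Scaling.
Context {R : realType}.
Notation mu := (@lebesgue_measure R).

Lemma scaled_lebesgue (s : R) : exists pm : {measure set (measurableTypeR R) -> \bar R},
  forall A, pm A = mu ((fun x : R => s * x)%R @^-1` A).
Proof.
pose phi (x : measurableTypeR R) : measurableTypeR R := s * x.
have mphi : measurable_fun [set: measurableTypeR R] phi by exact: mulrl_measurable.
by unshelve eexists (pushforward mu phi).
Qed.

Lemma integral_scale_ge0 (s : R) (f : R -> \bar R) : 0 < s -> measurable_fun setT f ->
  (forall x, 0 <= f x)%E ->
  (\int[mu]_x f x = s%:E * \int[mu]_x f (s * x)%R)%E.
Proof.
move=> s0 mf f0; have s0' : 0 <= s := ltW s0.
have [pm pmE] := scaled_lebesgue s.
transitivity (\int[mscale (NngNum s0') pm]_x f x)%E.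
  apply: eq_measure_integral => A mA _.
  apply: (@lebesgue_measure_unique R (mscale (NngNum s0') pm)) => // X [[a b] _ <-].
  rewrite [RHS]/(s%:E * pm _)%E pmE /=.
  transitivity (s%:E * mu [set` `]s^-1 * a, s^-1 * b]%R])%E; last first.
    congr (_ * mu _)%E; apply/seteqP; split=> x /=; rewrite !in_itv/=.
      by rewrite ltr_pdivrMl// ler_pdivlMl.
    by rewrite ltr_pdivrMl// ler_pdivlMl.
  rewrite !lebesgue_measure_itv /= !lte_fin ltr_pM2l ?invr_gt0//.
  case: ifP => _; last by rewrite mule0.
  by rewrite -!EFinB -EFinM; congr (_%:E); field; rewrite gt_eqF.
rewrite ge0_integral_mscale//; congr (_ * _)%E.
pose phi (x : measurableTypeR R) : measurableTypeR R := s * x.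
have mphi : measurable_fun [set: measurableTypeR R] phi by exact: mulrl_measurable.
have := @ge0_integral_pushforward _ _ _ _ R _ mphi mu setT f measurableT mf (fun y _ => f0 y).
rewrite preimage_setT => <-.
by apply: eq_measure_integral => A mA _; rewrite pmE.
Qed.

Lemma Rintegral_scale_nneg (s : R) (f : R -> R) : 0 < s ->
  mu.-integrable setT (EFin \o f) -> (forall x, 0 <= f x) ->
  mu.-integrable setT (EFin \o (fun x => f (s * x))) /\
  \int[mu]_x f x = s * \int[mu]_x f (s * x).
Proof.
move=> s0 iF f0; have mf := measurable_integrable iF.
have mE : measurable_fun setT (EFin \o f) by exact/measurable_EFinP.
have E : (\int[mu]_x (f x)%:E = s%:E * \int[mu]_x (f (s * x))%:E)%E.
  exact: (integral_scale_ge0 s0 mE (fun x => f0 x)).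
have msf : measurable_fun setT (fun x => f (s * x)).
  by apply: measurableT_comp => //; exact: mulrl_measurable.
have lty : (\int[mu]_x (f (s * x))%:E < +oo)%E.
  rewrite ltey; apply/eqP => h; move: E; rewrite h gt0_muley ?lte_fin// => E.
  have := integral_fune_fin_num measurableT iF.
  by rewrite /= E.
have isf := integrable_ge0_fin msf (fun x => f0 _) lty.
split => //; rewrite /Rintegral E fineM//.
exact: (integral_fune_fin_num measurableT isf).
Qed.

Lemma Rintegral_scale (s : R) (f : R -> R) : 0 < s -> mu.-integrable setT (EFin \o f) ->
  \int[mu]_x f x = s * \int[mu]_x f (s * x).
Proof.
move=> s0 iF; have mf := measurable_integrable iF.
have iA := integrable_abs iF.
have iP := integrable_addr iA iF; have iN := integrable_subr iA iF.
have P0 x : 0 <= `|f x| + f x by have := ler_norm (- f x); rewrite normrN; lra.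
have N0 x : 0 <= `|f x| - f x by have := ler_norm (f x); lra.
have [iP' EP] := Rintegral_scale_nneg s0 iP P0.
have [iN' EN] := Rintegral_scale_nneg s0 iN N0.
(* The formula is known for nonnegative functions, and [g] is half the difference of the nonnegative
   functions [|g| + g] and [|g| - g]. *)
have split2 (g : R -> R) : mu.-integrable setT (EFin \o (fun x => `|g x| + g x)) ->
    mu.-integrable setT (EFin \o (fun x => `|g x| - g x)) ->
    \int[mu]_x g x = 2^-1 * (\int[mu]_x (`|g x| + g x) - \int[mu]_x (`|g x| - g x)).
  move=> h1 h2; rewrite -RintegralB// -RintegralZl//; last exact: integrable_subr.
  by apply: eq_Rintegral => x _; field.
by rewrite (split2 f)// (split2 (fun x => f (s * x)))// EP EN; ring.
Qed.

End Scaling.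

(** * Local integrability, and almost everywhere inequalities from integrals *)

Section LocalIntegrability.
Context {R : realType}.
Notation mu := (@lebesgue_measure R).

Lemma integrable_Lfun_bounded (p : R) (f : R -> R) (D : set (measurableTypeR R)) : 1 <= p ->
  f \in Lfun mu p%:E -> measurable D -> (mu D < +oo)%E ->
  mu.-integrable D (EFin \o f).
Proof.
move=> p1 fp mD D_oo; have mf := Lfun_measurable fp.
have i1 : mu.-integrable D (EFin \o (fun=> 1 : R)).
  apply/integrableP; split; first exact/measurable_EFinP/measurable_cst.
  by under eq_integral do rewrite /= normr1; rewrite integral_cst// mul1e.
have i2 : mu.-integrable D (EFin \o (fun x => `|f x| `^ p)).
  by apply: (integrableS measurableT) => //; exact: integrable_powR.
have := integrableD mD i1 i2.
apply: le_integrable => //.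
  by apply/measurable_EFinP; exact: measurable_funTS.
move=> x _ /=; rewrite lee_fin [leRHS]ger0_norm ?addr_ge0 ?powR_ge0//.
exact: ler_1_powR.
Qed.

Lemma Rintegral_Lfun_bounded (p : R) (f : R -> R) (D : set (measurableTypeR R)) : 1 <= p ->
  f \in Lfun mu p%:E -> measurable D -> (mu D < +oo)%E ->
  \int[mu]_(x in D) `|f x| <= fine (mu D) + \int[mu]_x (`|f x| `^ p).
Proof.
move=> p1 fp mD D_oo.
have iD := integrable_Lfun_bounded p1 fp mD D_oo.
have i1 : mu.-integrable D (EFin \o (fun=> 1 : R)).
  apply/integrableP; split; first exact/measurable_EFinP/measurable_cst.
  by under eq_integral do rewrite /= normr1; rewrite integral_cst// mul1e.
have i2 : mu.-integrable D (EFin \o (fun x => `|f x| `^ p)).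
  by apply: (integrableS measurableT) => //; exact: integrable_powR.
have i12 : mu.-integrable D (EFin \o (fun x => 1 + `|f x| `^ p)).
  by have := integrableD mD i1 i2; apply: eq_integrable.
apply: (@le_trans _ _ (\int[mu]_(x in D) (1 + `|f x| `^ p))).
  apply: le_Rintegral => //; first exact: integrable_norm.
  by move=> x _; exact: ler_1_powR.
rewrite RintegralD// Rintegral_cst// mul1r lerD2l.
rewrite /Rintegral fine_le//.
- exact: integral_fune_fin_num.
- by apply: integral_fune_fin_num => //; exact: integrable_powR.
- apply: ge0_subset_integral => //.
  by have /measurable_int := integrable_powR p1 fp.
Qed.

Lemma locally_integrable_Lfun (p : R) (f : R -> R) : 1 <= p ->
  f \in Lfun mu p%:E -> locally_integrable [set: R] f.
Proof.
move=> p1 fp; split => //; first exact: Lfun_measurable fp.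
  exact: openT.
move=> K _ cK.
have mK : measurable K by exact: compact_measurable.
have := integrable_Lfun_bounded p1 fp mK (compact_finite_measure cK).
by move=> /integrableP[].
Qed.

(** At a Lebesgue point [x] the value [u x] is the derivative of a primitive of [u], here started at
    [x - 1], and the hypothesis makes this primitive nonincreasing. *)
Lemma ae_le0_of_itv (u : R -> R) : locally_integrable [set: R] u ->
  (forall a b, a < b -> \int[mu]_(x in `]a, b]) u x <= 0) ->
  {ae mu, forall x, u x <= 0}.
Proof.
move=> lu ule; have := lebesgue_differentiation lu.
case=> N [mN N0 sub]; exists N; split => //.
apply: subset_trans sub; apply: subsetC => x /= lx.
have iu (a b : R) : mu.-integrable `[a, b] (EFin \o u).
  have [mu_ _ h] := lu.
  apply/integrableP; split; first by apply/measurable_EFinP; exact: measurable_funTS.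
  by apply: h => //; exact: segment_compact.
pose a := x - 1; pose F y := \int[mu]_(t in `[a, y]) u t.
have xu : x < x + 1 by lra.
have ax : a < x by rewrite /a; lra.
have [|dF F'] := @FTC1_lebesgue_pt R u (BLeft a) x (x + 1) xu (iu _ _) _ lx.
  by first [exact: ax | rewrite bnd_simp; exact: ltW| exact: ltW].
have Fdecr y z : a <= y -> y < z -> F z <= F y.
  move=> ay yz.
  have := @Rintegral_itvB R u (BLeft a) (BRight z) y (iu a z).
  rewrite !bnd_simp => /(_ ay (ltW yz)).
  by rewrite -/(F z) -/(F y) => E; have := ule y z yz; rewrite -E subr_le0.
rewrite -F'.
rewrite derive1E; apply: limr_le; first exact: dF.
near=> h; rewrite /= /GRing.scale /= mulr1.
have [h0|h0] := leP 0 h.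
  move: h0; rewrite le_eqVlt => /predU1P[<-|h0]; first by rewrite add0r subrr mulr0.
  rewrite pmulr_rle0 ?invr_gt0// subr_le0; apply: Fdecr; rewrite /a; lra.
rewrite nmulr_rle0 ?invr_lt0// subr_ge0; apply: Fdecr; last lra.
have : `|h| < 1 by near: h; exact: dnbhs0_lt.
rewrite ltr_norml /a; lra.
Unshelve. all: by end_near. Qed.

End LocalIntegrability.

(** * Gaussian averages of functions in L^p *)

Section GaussianAverage.
Context {R : realType}.
Notation mu := (@lebesgue_measure R).

Lemma Lfun_le (p C : R) (u v : R -> R) : 1 <= p -> v \in Lfun mu p%:E ->
  measurable_fun setT u -> (forall x, `|u x| <= C * `|v x|) -> u \in Lfun mu p%:E.
Proof.
move=> p1 vp m_u uv; have p0 : 0 < p by rewrite (lt_le_trans _ p1).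
have mv := Lfun_measurable vp.
rewrite inE; apply/andP; split; rewrite inE //=.
rewrite /finite_norm Lnorm_EFinE.
apply: poweR_lty.
apply: (@le_lt_trans _ _ (\int[mu]_x (`|C| `^ p * `|v x| `^ p)%:E)%E).
  apply: ge0_le_integral => //.
  - apply/measurable_EFinP; apply: (measurableT_comp (measurable_powR p)).
    exact: measurableT_comp.
  - apply/measurable_EFinP; apply: measurable_funM => //.
    apply: (measurableT_comp (measurable_powR p)); exact: measurableT_comp.
  - move=> x _; rewrite lee_fin -powRM//; apply: ge0_ler_powR.
    + exact: ltW.
    + by rewrite nnegrE.
    + by rewrite nnegrE mulr_ge0.
    + by apply: (le_trans (uv x)); rewrite ler_wpM2r// ler_norm.
have := integrable_mull (`|C| `^ p) (integrable_powR p1 vp).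
move=> /(integral_fune_lt_pinfty measurableT); exact.
Qed.

Lemma Lfun_comp_shift (p s : R) (f : R -> R) : 1 <= p -> f \in Lfun mu p%:E ->
  (fun x => f (x + s)) \in Lfun mu p%:E.
Proof.
move=> p1 fp; have mf := Lfun_measurable fp.
have ms : measurable_fun setT (fun x : R => f (x + s)).
  by apply: measurableT_comp => //; exact: measurable_funD.
rewrite inE; apply/andP; split; rewrite inE //=.
rewrite /finite_norm Lnorm_EFinE; apply: poweR_lty.
rewrite (@integral_shift _ s (fun x => (`|f x| `^ p)%:E)).
  by have /integral_fune_lt_pinfty := integrable_powR p1 fp; apply.
apply/measurable_EFinP; apply: (measurableT_comp (measurable_powR p)).
exact: measurableT_comp.
Qed.

(** This is [exp (r ^ 2 Delta / 2) f] times [sqrt (2 pi)]. With the scale in the argument of [f]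
    rather than in the kernel, [r = 0] is allowed and returns a multiple of [f]. *)
Definition avg (r : R) (f : R -> R) (y : R) : R :=
  \int[mu]_s (f (y + r * s) * gexp 1 s).

Lemma integrable_avg (p r : R) (f : R -> R) (y : R) : 1 <= p -> 0 <= r ->
  f \in Lfun mu p%:E ->
  mu.-integrable setT (EFin \o (fun s => f (y + r * s) * gexp 1 s)).
Proof.
move=> p1 r0 fp; have mf := Lfun_measurable fp.
have ig : mu.-integrable setT (EFin \o @gexp R 1) by exact: integrable_gexp.
have msr : measurable_fun setT (fun s => f (y + r * s)).
  by apply: measurableT_comp => //; apply: measurable_funD => //; exact: mulrl_measurable.
move: r0; rewrite le_eqVlt => /predU1P[<-|r0].
  have := integrable_mull (f y) ig; apply: eq_integrable => // s _ /=.
  by rewrite mul0r addr0.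
have ip : mu.-integrable setT (EFin \o (fun s => `|f (y + r * s)| `^ p)).
  have [] := @Rintegral_scale_nneg R r (fun x => `|f (x + y)| `^ p) r0.
  - exact: (integrable_powR p1 (Lfun_comp_shift y p1 fp)).
  - by move=> x; exact: powR_ge0.
  by move=> h _; move: h; apply: eq_integrable => // s _ /=; rewrite addrC.
apply: (integrable_le _ (integrable_addr ig ip)).
  by apply: measurable_funM => //; exact: measurable_gexp.
move=> s; have g0 := gexp_gt0 1 s; have g1 : gexp 1 s <= 1 by exact: gexp_le1.
rewrite normrM (gtr0_norm g0).
have := ler_wpM2r (ltW g0) (ler_1_powR p1 (normr_ge0 (f (y + r * s)))).
move=> /le_trans; apply; rewrite mulrDl mul1r lerD2l.
by rewrite ler_piMr// powR_ge0.
Qed.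

Lemma measurable_avg (r : R) (f : R -> R) : measurable_fun setT f ->
  measurable_fun setT (avg r f).
Proof.
move=> mf; apply: (@measurable_Rintegral_param R (fun z => f (z.1 + r * z.2) * gexp 1 z.2)).
apply: measurable_funM.
  apply: measurableT_comp => //; apply: measurable_funD; first exact: measurable_fst.
  by apply: measurable_funM => //; exact: measurable_snd.
by apply: measurableT_comp; [exact: measurable_gexp|exact: measurable_snd].
Qed.

Lemma avg0 (f : R -> R) y : avg 0 f y = Num.sqrt (2 * pi) * f y.
Proof.
rewrite /avg; under eq_Rintegral do rewrite mul0r addr0.
rewrite RintegralZl//; last exact: integrable_gexp.
by rewrite integral_gexp// divr1 mulrC.
Qed.

Lemma ctr_gexp_le_lor (t : R) : 0 < t ->
  exists2 C, 0 < C & forall z, `|ctr (gexp t) z| <= C * lor z.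
Proof.
move=> t0; have s0 : 0 < Num.sqrt t by rewrite sqrtr_gt0.
have [C C0 h] := ctr_le_lor s0.
exists (C * (16 * (1 + t)) / Num.sqrt t).
  by rewrite divr_gt0// mulr_gt0//; lra.
by move=> z; apply: h => //; exact: (C2bd_gexp (ltW t0) (lexx t)).
Qed.

Lemma lorB_sym (x y : R) : lor (x - y) = lor (y - x).
Proof. by rewrite /lor -sqrrN opprB. Qed.

Lemma integrable_kernel (p C : R) (f K : R -> R) (y : R) : 1 <= p ->
  f \in Lfun mu p%:E -> measurable_fun setT K -> (forall z, `|K z| <= C * lor z) ->
  mu.-integrable setT (EFin \o (fun x => f x * K (x - y))).
Proof.
move=> p1 fp mK KC; have mf := Lfun_measurable fp.
have h := integrable_mull C (integrable_abs (Lfun_pois_integrable y p1 fp)).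
apply: (integrable_le _ h).
  apply: measurable_funM => //; apply: measurableT_comp => //.
  exact: measurable_funB.
move=> x; rewrite !normrM (gtr0_norm (lor_gt0 _)) lorB_sym mulrA mulrC.
by rewrite ler_wpM2r.
Qed.

Lemma measurable_ctr (F : R -> R) : measurable_fun setT F ->
  measurable_fun setT (ctr F).
Proof.
move=> mF; apply: (@measurable_Rintegral_param R (fun z => F z.2 * cos (z.1 * z.2))).
apply: measurable_funM; first by apply: measurableT_comp => //; exact: measurable_snd.
apply: measurableT_comp; first exact: continuous_measurable_fun (@continuous_cos R).
by apply: measurable_funM; [exact: measurable_fst|exact: measurable_snd].
Qed.

Lemma integrable_comp_scale (s : R) (f : R -> R) : 0 < s ->
  mu.-integrable setT (EFin \o f) ->
  mu.-integrable setT (EFin \o (fun x => f (s * x))).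
Proof.
move=> s0 iF; have mf := measurable_integrable iF.
have [iA _] := Rintegral_scale_nneg s0 (integrable_abs iF) (fun x => normr_ge0 (f x)).
apply: (integrable_le _ iA) => //.
by apply: measurableT_comp => //; exact: mulrl_measurable.
Qed.

Lemma avg_kernel (p t : R) (f : R -> R) (y : R) : 1 <= p -> 0 < t ->
  f \in Lfun mu p%:E ->
  \int[mu]_x (f x * ((Num.sqrt (2 * pi))^-1 * ctr (gexp t) (x - y))) = avg (Num.sqrt t) f y.
Proof.
move=> p1 t0 fp; have mf := Lfun_measurable fp.
set c0 := _^-1; pose K z := c0 * ctr (gexp t) z.
have s0 : 0 < Num.sqrt t by rewrite sqrtr_gt0.
have mK : measurable_fun setT K.
  by apply: measurable_funM => //; apply: measurable_ctr; exact: measurable_gexp.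
have [C _ hC] := ctr_gexp_le_lor t0.
have c00 : 0 <= c0 by rewrite invr_ge0 sqrtr_ge0.
have iK := @integrable_kernel p (c0 * C) f K y p1 fp mK.
have {}iK : mu.-integrable setT (EFin \o (fun x => f x * K (x - y))).
  by apply: iK => z; rewrite /K normrM (ger0_norm c00) -mulrA ler_wpM2l.
have mfK := measurable_integrable iK.
rewrite -(Rintegral_shift y mfK) (Rintegral_scale s0 (integrable_shift y iK)).
have iS := integrable_avg y p1 (ltW s0) fp.
rewrite /avg -RintegralZl//; last exact: (integrable_comp_scale s0 (integrable_shift y iK)).
apply: eq_Rintegral => s _.
rewrite addrK /K ctr_gexp// (_ : Num.sqrt t * s + y = y + Num.sqrt t * s); last by ring.
have -> : gexp t^-1 (Num.sqrt t * s) = gexp 1 s.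
  rewrite /gexp exprMn sqr_sqrtr ?(ltW t0)//; congr expR; field; rewrite gt_eqF//.
have -> : Num.sqrt (2 * pi / t) = Num.sqrt (2 * pi) / Num.sqrt t.
  by rewrite sqrtrM ?mulr_ge0 ?pi_ge0// sqrtrV// ltW.
have q0 : Num.sqrt (2 * pi : R) != 0 by rewrite gt_eqF// sqrtr_gt0 mulr_gt0// pi_gt0.
by rewrite /c0; field; rewrite q0 gt_eqF.
Qed.

End GaussianAverage.

(** * Convergence of averages, integrated over an interval *)

Section AverageLimit.
Context {R : realType}.
Notation mu := (@lebesgue_measure R).

Lemma Rintegral_indic (D : set (measurableTypeR R)) (f : R -> R) :
  \int[mu]_(x in D) f x = \int[mu]_x (\1_D x * f x).
Proof.
rewrite Rintegral_mkcond; apply: eq_Rintegral => x _.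
by rewrite patchE indicE; case: ifP => _; rewrite ?mul1r ?mul0r.
Qed.

Lemma integrable_indic (D : set (measurableTypeR R)) (f : R -> R) : measurable D ->
  mu.-integrable D (EFin \o f) ->
  mu.-integrable setT (EFin \o (fun x => \1_D x * f x)).
Proof.
move=> mD /(integrable_mkcond _ mD); apply: eq_integrable => // x _.
rewrite /= patchE indicE; case: ifP => _; by rewrite ?mul1r ?mul0r.
Qed.

Lemma lebesgue_itvoc_lty (a b : R) : (mu [set` `]a, b]%R] < +oo)%E.
Proof.
by rewrite lebesgue_measure_itv /=; case: ifP => _; rewrite -?EFinB ltry.
Qed.

Lemma Rintegral_shift_itv (f : R -> R) (a b s : R) : measurable_fun setT f ->
  \int[mu]_(y in `]a, b]) f (y + s) = \int[mu]_(y in `]a + s, b + s]) f y.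
Proof.
move=> mf; rewrite [LHS]Rintegral_indic [RHS]Rintegral_indic.
rewrite -(@Rintegral_shift _ (fun y => \1_`]a + s, b + s] y * f y) s); last first.
  by apply: measurable_funM => //; exact: measurable_indic.
apply: eq_Rintegral => y _; rewrite !indicE.
rewrite (_ : (y + s \in _) = (y \in `]a, b]%classic))//.
by apply/idP/idP; rewrite !inE /= !in_itv /=; lra.
Qed.

(** After translation the integral is a difference of two values of a primitive, started at a point
    [c] to the left of all the intervals that occur for [s] within 1 of [s0]. *)
Lemma continuous_Rintegral_itv (p : R) (f : R -> R) (a b : R) : 1 <= p ->
  f \in Lfun mu p%:E -> a < b ->
  continuous (fun s => \int[mu]_(y in `]a, b]) f (y + s)).
Proof.
move=> p1 fp ab s0; have mf := Lfun_measurable fp.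
under eq_fun do rewrite Rintegral_shift_itv//.
pose c := a + s0 - 2; pose d := b + s0 + 2.
have icd : mu.-integrable `[c, d] (EFin \o f).
  apply: (integrable_Lfun_bounded p1 fp) => //.
  by rewrite lebesgue_measure_itv /=; case: ifP => _; rewrite -?EFinB ltry.
have cd : c < d by rewrite /c /d; lra.
pose F u := \int[mu]_(y in `[c, u]) f y.
have cF : {in `]c, d[, continuous F}.
  have := parameterized_integral_continuous (ltW cd) icd.
  by move=> /(continuous_within_itvP _ cd)[].
have near_eq : \forall s \near s0, F (b + s) - F (a + s) = \int[mu]_(y in `]a + s, b + s]) f y.
  near=> s.
  have s1 : `|s0 - s| < 1 by near: s; exact: cvgr_dist_lt.
  have [s2 s3] : s0 - 1 < s /\ s < s0 + 1 by move: s1; rewrite ltr_norml; lra.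
  have ic : mu.-integrable `[c, b + s] (EFin \o f).
    apply: (integrable_Lfun_bounded p1 fp) => //.
    by rewrite lebesgue_measure_itv /=; case: ifP => _; rewrite -?EFinB ltry.
  have := @Rintegral_itvB R f (BLeft c) (BRight (b + s)) (a + s) ic.
  rewrite !bnd_simp; apply; rewrite /c; lra.
have : (fun s => F (b + s) - F (a + s)) @ s0 --> F (b + s0) - F (a + s0).
  have cc x : x \in `]c, d[ -> forall u, (fun s => u + s) @ s0 --> x ->
      (fun s => F (u + s)) @ s0 --> F x.
    by move=> xcd u ux; apply: (cvg_comp _ _ ux); exact: cF.
  have cs u : (fun s => u + s) @ s0 --> u + s0.
    by apply: cvgD; [exact: cvg_cst|exact: cvg_id].
  apply: cvgB; apply: cc => //; rewrite in_itv /= /c /d; lra.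
rewrite (nbhs_singleton near_eq).
by apply: cvg_trans; apply: near_eq_cvg.
Unshelve. all: by end_near. Qed.

(** The bound is independent of the shift [s]: times a Gaussian, it is the dominating function in
    the exchange of integrals and in the limit below. *)
Lemma abs_Rintegral_itv_le (p : R) (f : R -> R) (a b s : R) : 1 <= p ->
  f \in Lfun mu p%:E ->
  \int[mu]_(y in `]a, b]) `|f (y + s)| <=
  fine (mu [set` `]a, b]%R]) + \int[mu]_x (`|f x| `^ p).
Proof.
move=> p1 fp; have mf := Lfun_measurable fp.
have := Rintegral_Lfun_bounded p1 (Lfun_comp_shift s p1 fp) (measurable_itv `]a, b]) (lebesgue_itvoc_lty a b).
rewrite (@Rintegral_shift R (fun x => `|f x| `^ p))//.
exact: measurable_integrable (integrable_powR p1 fp).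
Qed.

Lemma Rintegral_itv_avg (p : R) (f : R -> R) (a b r : R) : 1 <= p -> 0 <= r ->
  f \in Lfun mu p%:E ->
  \int[mu]_(y in `]a, b]) avg r f y =
  \int[mu]_s (gexp 1 s * \int[mu]_(y in `]a, b]) f (y + r * s)).
Proof.
move=> p1 r0 fp; have mf := Lfun_measurable fp.
pose D := [set` `]a, b]%R] : set (measurableTypeR R).
have mD : measurable D by exact: measurable_itv.
have Doo : (mu D < +oo)%E by exact: lebesgue_itvoc_lty.
pose H y s := \1_D y * (f (y + r * s) * gexp 1 s).
have mH : measurable_fun setT (fun z : R * R => H z.1 z.2).
  apply: measurable_funM.
    by apply: (measurableT_comp (measurable_indic _)) => //; exact: measurable_fst.
  apply: measurable_funM.
    apply: measurableT_comp => //; apply: measurable_funD; first exact: measurable_fst.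
    by apply: measurable_funM => //; exact: measurable_snd.
  by apply: measurableT_comp; [exact: measurable_gexp|exact: measurable_snd].
have mHs : measurable_fun setT (fun z : R * R => H z.2 z.1).
  apply: measurable_funM.
    by apply: (measurableT_comp (measurable_indic _)) => //; exact: measurable_snd.
  apply: measurable_funM.
    apply: measurableT_comp => //; apply: measurable_funD; first exact: measurable_snd.
    by apply: measurable_funM => //; exact: measurable_fst.
  by apply: measurableT_comp; [exact: measurable_gexp|exact: measurable_fst].
have ifs s : mu.-integrable D (EFin \o (fun y => f (y + s))).
  exact: (integrable_Lfun_bounded p1 (Lfun_comp_shift s p1 fp)).
have Hy y : mu.-integrable setT (EFin \o H y).
  exact: (integrable_mull _ (integrable_avg y p1 r0 fp)).
have Hs s : mu.-integrable setT (EFin \o H^~ s).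
  have := integrable_mull (gexp 1 s) (integrable_indic mD (ifs (r * s))).
  by apply: eq_integrable => // y _; rewrite /H /=; congr (_%:E); ring.
set B := fine (mu D) + \int[mu]_x (`|f x| `^ p).
have Hoo : (\int[mu]_y \int[mu]_s `|H y s|%:E < +oo)%E.
  rewrite (tonelli (H := fun y s => `|H y s|%:E)); last 2 first.
  - by apply/measurable_EFinP; exact: measurableT_comp.
  - by move=> y s; rewrite lee_fin.
  apply: (@le_lt_trans _ _ (\int[mu]_s (B * gexp 1 s)%:E)%E).
    apply: ge0_le_integral => //.
    - by move=> s _; apply: integral_ge0 => y _; rewrite lee_fin.
    - apply: (@measurable_ge0_integral_param R (fun z => `|H z.2 z.1|%:E)).
        by apply/measurable_EFinP; exact: measurableT_comp.
      by move=> z; rewrite lee_fin.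
    - by apply/measurable_EFinP; apply: measurable_funM => //; exact: measurable_gexp.
    - move=> s _.
      have := abs_Rintegral_itv_le a b (r * s) p1 fp; rewrite -/B.
      rewrite -(ler_pM2r (gexp_gt0 1 s)) -lee_fin; apply: le_trans.
      rewrite Rintegral_indic -RintegralZr//; last first.
        by apply: integrable_indic => //; exact: integrable_norm.
      rewrite /Rintegral fineK; last first.
        apply: integral_fune_fin_num => //.
        have := integrable_mull (gexp 1 s) (integrable_indic mD (integrable_norm (ifs (r * s)))).
        by apply: eq_integrable => // y _ /=; congr (_%:E); ring.
      apply: ge0_le_integral => //.
      + apply/measurable_EFinP; apply: measurableT_comp => //.
        exact: (measurable_integrable (Hs s)).
      + apply/measurable_EFinP; apply: measurable_funM => //; apply: measurable_funM.
          exact: measurable_indic.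
        apply: measurableT_comp => //; apply: measurableT_comp => //.
        exact: measurable_funD.
      + move=> y _; rewrite lee_fin /H !normrM (gtr0_norm (gexp_gt0 _ _)) mulrA.
        by rewrite (ger0_norm (_ : 0 <= \1_D y))// indicE.
  have := integral_fune_lt_pinfty measurableT (integrable_mull B (integrable_gexp ltr01)).
  by [].
have E := fubini_Rintegral mH Hoo Hy Hs.
rewrite [LHS]Rintegral_indic; transitivity (\int[mu]_y \int[mu]_s H y s).
  apply: eq_Rintegral => y _.
  exact: (esym (RintegralZl (\1_D y) measurableT (integrable_avg y p1 r0 fp))).
rewrite E; apply: eq_Rintegral => s _.
rewrite (Rintegral_indic D (fun y => f (y + r * s))).
rewrite -(RintegralZl (gexp 1 s) measurableT (integrable_indic mD (ifs (r * s)))).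
by apply: eq_Rintegral => y _; rewrite /H; ring.
Qed.

(** Integration over an interval turns the shift of [f] into a bounded continuous function of the
    shift, so that dominated convergence against the Gaussian applies. *)
Lemma cvg_Rintegral_itv_avg (p : R) (f : R -> R) (a b r : R) (r_ : nat -> R) :
  1 <= p -> f \in Lfun mu p%:E -> a < b -> 0 <= r -> (forall n, 0 <= r_ n) ->
  r_ n @[n --> \oo] --> r ->
  (\int[mu]_(y in `]a, b]) avg (r_ n) f y) @[n --> \oo] --> \int[mu]_(y in `]a, b]) avg r f y.
Proof.
move=> p1 fp ab r0 rn0 rnr.
have E s : 0 <= s -> \int[mu]_(y in `]a, b]) avg s f y =
    \int[mu]_t (gexp 1 t * \int[mu]_(y in `]a, b]) f (y + s * t)).
  by move=> s0; exact: (Rintegral_itv_avg _ _ p1 s0 fp).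
rewrite (E r r0); under eq_fun do rewrite E//.
pose Z s := \int[mu]_(y in `]a, b]) f (y + s).
have cZ : continuous Z by exact: (continuous_Rintegral_itv p1 fp ab).
set B := fine (mu [set` `]a, b]%R]) + \int[mu]_x (`|f x| `^ p).
have ZB s : `|Z s| <= B.
  apply: (le_trans _ (abs_Rintegral_itv_le a b s p1 fp)).
  apply: le_normr_Rintegral => //.
  apply: (integrable_Lfun_bounded p1 (Lfun_comp_shift s p1 fp)) => //.
  exact: lebesgue_itvoc_lty.
have mZ s : measurable_fun setT (fun t => gexp 1 t * Z (s * t)).
  apply: measurable_funM; first exact: measurable_gexp.
  apply: measurableT_comp; first exact: continuous_measurable_fun cZ.
  exact: mulrl_measurable.
have gB s t : `|gexp 1 t * Z (s * t)| <= B * gexp 1 t.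
  by rewrite normrM (gtr0_norm (gexp_gt0 _ _)) mulrC ler_wpM2r// ltW// gexp_gt0.
have iB : mu.-integrable setT (EFin \o (fun t => B * gexp 1 t)).
  exact: integrable_mull (integrable_gexp ltr01).
have iZ s : mu.-integrable setT (EFin \o (fun t => gexp 1 t * Z (s * t))).
  exact: (integrable_le (mZ s) iB (gB s)).
have := @dominated_cvg _ _ R mu setT measurableT
  (fun n t => (gexp 1 t * Z (r_ n * t))%:E) (fun t => (gexp 1 t * Z (r * t))%:E)
  (fun t => (B * gexp 1 t)%:E).
move=> H; apply: fine_cvg; rewrite /Rintegral fineK; last first.
  exact: (integral_fune_fin_num measurableT (iZ r)).
apply: H => //.
- by move=> n; apply/measurable_EFinP; exact: mZ.
- move=> t _; apply: cvg_EFin; first by near=> n.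
  apply: cvgMl_tmp; apply: (cvg_comp (fun n => r_ n * t) Z); last exact: cZ.
  exact: cvgMr_tmp.
- by move=> n t _; rewrite /= lee_fin; exact: gB.
Unshelve. all: by end_near. Qed.

End AverageLimit.

(** * The high-frequency part of a Bessel potential *)

Section HighFrequencyPart.
Context {R : realType}.
Notation mu := (@lebesgue_measure R).

Lemma kernel_abs_le (p C : R) (f K : R -> R) (y : R) : 1 <= p ->
  f \in Lfun mu p%:E -> measurable_fun setT K -> (forall z, `|K z| <= C * lor z) ->
  `|\int[mu]_x (f x * K (x - y))| <= C * pois (fun t => `|f t|) y.
Proof.
move=> p1 fp mK KC; have mf := Lfun_measurable fp.
have ip : mu.-integrable setT (EFin \o (fun t => lor (y - t) * `|f t|)).
  have := integrable_abs (Lfun_pois_integrable y p1 fp).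
  by apply: eq_integrable => // t _ /=; rewrite normrM (gtr0_norm (lor_gt0 _)).
rewrite /pois -RintegralZl//; apply: le_abs_Rintegral.
- apply: measurable_funM => //; apply: measurableT_comp => //; exact: measurable_funB.
- exact: integrable_mull.
- by move=> x; rewrite normrM mulrC mulrA ler_wpM2r// lorB_sym.
Qed.

Lemma Lfun_kernel (p C : R) (f K : R -> R) : 1 <= p ->
  f \in Lfun mu p%:E -> measurable_fun setT K -> (forall z, `|K z| <= C * lor z) ->
  (fun y => \int[mu]_x (f x * K (x - y))) \in Lfun mu p%:E.
Proof.
move=> p1 fp mK KC; have mf := Lfun_measurable fp.
apply: (@Lfun_le _ p C _ _ p1 (Lfun_pois p1 fp)).
  apply: (@measurable_Rintegral_param R (fun z => f z.2 * K (z.2 - z.1))).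
  apply: measurable_funM; first by apply: measurableT_comp => //; exact: measurable_snd.
  apply: measurableT_comp => //.
  by apply: measurable_funB; [exact: measurable_snd|exact: measurable_fst].
move=> y; apply: (le_trans (kernel_abs_le y p1 fp mK KC)).
by rewrite (ger0_norm (pois_ge0 _ _)).
Qed.

Lemma Lfun_avg (p r : R) (f : R -> R) : 1 <= p -> 0 <= r ->
  f \in Lfun mu p%:E -> avg r f \in Lfun mu p%:E.
Proof.
move=> p1 r0 fp; have mf := Lfun_measurable fp.
move: r0; rewrite le_eqVlt => /predU1P[<-|r0].
  apply: (@Lfun_le _ p (Num.sqrt (2 * pi)) _ _ p1 fp); first exact: measurable_avg.
  by move=> y; rewrite avg0 normrM ger0_norm.
have r2 : 0 < r ^+ 2 by rewrite exprn_gt0.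
have [C _ hC] := ctr_gexp_le_lor r2.
have c00 : 0 <= (Num.sqrt (2 * pi))^-1 :> R by rewrite invr_ge0 sqrtr_ge0.
have -> : avg r f = (fun y => \int[mu]_x (f x * ((Num.sqrt (2 * pi))^-1 * ctr (gexp (r ^+ 2)) (x - y)))).
  by apply/funext => y; rewrite (avg_kernel y p1 r2 fp) sqrtr_sqr gtr0_norm.
apply: (@Lfun_kernel p ((Num.sqrt (2 * pi))^-1 * C) f
  (fun z => (Num.sqrt (2 * pi))^-1 * ctr (gexp (r ^+ 2)) z)) => //.
  by apply: measurable_funM => //; apply: measurable_ctr; exact: measurable_gexp.
by move=> z; rewrite normrM (ger0_norm c00) -mulrA ler_wpM2l.
Qed.

Lemma Lfun_add (p : R) (u v : R -> R) : 1 <= p -> u \in Lfun mu p%:E ->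
  v \in Lfun mu p%:E -> (fun x => u x + v x) \in Lfun mu p%:E.
Proof.
move=> p1 up vp; have p1' : (1 <= p%:E)%E by rewrite lee_fin.
exact: (@Lfun_addr_closed _ _ R mu p%:E p1').2.
Qed.

Lemma Lfun_mull (p c : R) (u : R -> R) : 1 <= p -> u \in Lfun mu p%:E ->
  (fun x => c * u x) \in Lfun mu p%:E.
Proof.
move=> p1 up; have m_u := Lfun_measurable up.
apply: (@Lfun_le R p `|c| (fun x => c * u x) u p1 up); first exact: measurable_funM.
by move=> x; rewrite normrM.
Qed.

Lemma Lfun_sum (p : R) (m : nat) (c : nat -> R) (u : nat -> R -> R) : 1 <= p ->
  (forall j, u j \in Lfun mu p%:E) ->
  (fun x => \sum_(j < m) c j * u j x) \in Lfun mu p%:E.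
Proof.
move=> p1 up; elim: m => [|m ih].
  rewrite (_ : (fun x => _) = (fun x => 0 * u 0%N x)); first exact: Lfun_mull.
  by apply/funext => x; rewrite big_ord0 mul0r.
rewrite (_ : (fun x => _) = (fun x => \sum_(j < m) c j * u j x + c m * u m x)).
  by apply: Lfun_add => //; exact: Lfun_mull.
by apply/funext => x; rewrite big_ord_recr.
Qed.

Lemma Rintegral_lin_comb (D : set (measurableTypeR R)) (m : nat) (c : nat -> R)
    (u : nat -> R -> R) : measurable D ->
  (forall j, mu.-integrable D (EFin \o u j)) ->
  mu.-integrable D (EFin \o (fun x => \sum_(j < m) c j * u j x)) /\
  \int[mu]_(x in D) (\sum_(j < m) c j * u j x) =
  \sum_(j < m) c j * \int[mu]_(x in D) u j x.
Proof.
move=> mD iu; have icu j : mu.-integrable D (EFin \o (fun x => c j * u j x)).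
  by have := integrableZl mD (c j) (iu j); apply: eq_integrable.
elim: m => [|m [ih1 ih2]].
  have -> : (fun x => \sum_(j < 0) c j * u j x) = (fun=> 0).
    by apply/funext => x; rewrite big_ord0.
  split; last by rewrite Rintegral_cst// mul0r big_ord0.
  exact: integrable0.
have -> : (fun x => \sum_(j < m.+1) c j * u j x) =
    (fun x => \sum_(j < m) c j * u j x + c m * u m x).
  by apply/funext => x; rewrite big_ord_recr.
split; last by rewrite RintegralD// ih2 RintegralZl// big_ord_recr.
by have := integrableD mD ih1 (icu m); apply: eq_integrable.
Qed.

Lemma cvg_lin_comb (m : nat) (c : nat -> R) (u : nat -> nat -> R) (l : nat -> R) :
  (forall j, u j n @[n --> \oo] --> l j) ->
  (\sum_(j < m) c j * u j n) @[n --> \oo] --> \sum_(j < m) c j * l j.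
Proof.
move=> ul; elim: m => [|m ih].
  by under eq_fun do rewrite big_ord0; rewrite big_ord0; exact: cvg_cst.
under eq_fun do rewrite big_ord_recr; rewrite big_ord_recr.
by apply: cvgD => //; exact: cvgMl_tmp.
Qed.

Lemma ae_impl2 (P Q S : R -> Prop) : (forall x, P x -> Q x -> S x) ->
  {ae mu, forall x, P x} -> {ae mu, forall x, Q x} -> {ae mu, forall x, S x}.
Proof.
move=> PQS hP hQ; apply: (negligibleS _ (negligibleU hP hQ)) => x /= nS.
by apply/not_andP => -[Px Qx]; exact: nS (PQS x Px Qx).
Qed.

(** The regularisation [1 / (n + 1)] is removed in integrals over intervals, where the averages
    converge; the inequality between integrals then gives back one almost everywhere. *)
Lemma ae_le_lin_comb_avg (p : R) (f h : R -> R) (m : nat) (c t : nat -> R) :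
  1 <= p -> f \in Lfun mu p%:E -> h \in Lfun mu p%:E -> (forall j, 0 <= t j) ->
  (forall (n : nat) y,
     \sum_(j < m) c j * avg (Num.sqrt (t j + n.+1%:R^-1)) f y <= h y) ->
  {ae mu, forall y, \sum_(j < m) c j * avg (Num.sqrt (t j)) f y <= h y}.
Proof.
move=> p1 fp hp t0 H.
pose v y := \sum_(j < m) c j * avg (Num.sqrt (t j)) f y.
have vp : v \in Lfun mu p%:E.
  apply: (@Lfun_sum p m c (fun j => avg (Num.sqrt (t j)) f) p1) => j.
  exact: Lfun_avg.
have vhp : (fun y => v y + -1 * h y) \in Lfun mu p%:E.
  by apply: Lfun_add => //; exact: Lfun_mull.
have : {ae mu, forall y, v y + -1 * h y <= 0}.
  apply: ae_le0_of_itv; first exact: (locally_integrable_Lfun p1 vhp).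
  move=> a b ab; have mab := measurable_itv `]a, b].
  have iD u : u \in Lfun mu p%:E -> mu.-integrable `]a, b] (EFin \o u).
    by move=> up; exact: (integrable_Lfun_bounded p1 up mab (lebesgue_itvoc_lty a b)).
  rewrite RintegralD//; last 2 first.
  - exact: iD.
  - by apply: iD; exact: Lfun_mull.
  rewrite RintegralZl//; last exact: iD.
  rewrite mulN1r subr_le0.
  have [_ ->] := @Rintegral_lin_comb `]a, b] m c (fun j => avg (Num.sqrt (t j)) f) mab
    (fun j => iD _ (Lfun_avg p1 (sqrtr_ge0 _) fp)).
  have lim : (\sum_(j < m) c j * \int[mu]_(y in `]a, b]) avg (Num.sqrt (t j + n.+1%:R^-1)) f y)
      @[n --> \oo] --> \sum_(j < m) c j * \int[mu]_(y in `]a, b]) avg (Num.sqrt (t j)) f y.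
    apply: (@cvg_lin_comb m c
      (fun j n => \int[mu]_(y in `]a, b]) avg (Num.sqrt (t j + n.+1%:R^-1)) f y)
      (fun j => \int[mu]_(y in `]a, b]) avg (Num.sqrt (t j)) f y)) => j.
    apply: (cvg_Rintegral_itv_avg p1 fp ab) => //.
    have tj : (t j + n.+1%:R^-1 : R) @[n --> \oo] --> t j + 0.
      by apply: cvgD; [exact: cvg_cst|exact: cvg_harmonic].
    rewrite addr0 in tj.
    exact: (cvg_comp _ (@Num.sqrt R) tj (@sqrt_continuous R (t j))).
  apply: (ler_cvg_to lim (cvg_cst (\int[mu]_(y in `]a, b]) h y))).
  apply: nearW => n.
  have [iS <-] := @Rintegral_lin_comb `]a, b] m c (fun j => avg (Num.sqrt (t j + n.+1%:R^-1)) f) mab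
    (fun j => iD _ (Lfun_avg p1 (sqrtr_ge0 _) fp)).
  by apply: le_Rintegral => //; exact: iD.
case=> N [mN N0 sub]; exists N; split => //; apply: subset_trans sub.
by apply: subsetC => y /=; rewrite mulN1r subr_le0.
Qed.

(** Up to a constant, the convolution kernel of [exp (t Delta / 2) (1 - Delta)^-(k + 1)], which maps
    [g] to the smoothed [f]. *)
Definition bker (k : nat) (t z : R) : R := ctr (fun w => lor w ^+ k.+1 * gexp t w) z.

Lemma integrable_lorX_gexp (k : nat) (t : R) : 0 < t ->
  mu.-integrable setT (EFin \o (fun w => lor w ^+ k.+1 * gexp t w)).
Proof.
move=> t0; apply: (integrable_le _ (integrable_gexp t0)).
  apply: measurable_funM; last exact: measurable_gexp.
  by apply: measurable_funX; exact: measurable_lor.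
move=> w; rewrite normrM (gtr0_norm (gexp_gt0 _ _)) ler_piMl ?(ltW (gexp_gt0 _ _))//.
by rewrite normrX (gtr0_norm (lor_gt0 _)) exprn_ile1 ?lor_ge0 ?lor_le1.
Qed.

(** Used for integrability of single kernels. The constant degenerates as [d] tends to 0;
    quantitative bounds come from the alternating combination instead. *)
Lemma bker_le_lor (k : nat) (d : R) : 0 < d ->
  exists2 B, 0 < B & forall z, `|bker k d z| <= B * lor z.
Proof.
move=> d0; have s0 : 0 < Num.sqrt d by rewrite sqrtr_gt0.
have [C C0 hC] := ctr_le_lor s0.
have l10 : C2bd (@lor R) (fun=> 10).
  by apply: C2bd_le C2bd_lor _ => w; have := lor_le1 w; lra.
have h := C2bd_mul (C2bd_pow k.+1 l10) (C2bd_gexp (ltW d0) (lexx d)).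
pose M := 4 * ((4 * 10 : R) ^+ k.+1 * (16 * (1 + d))).
have M0 : 0 < M.
  by rewrite /M; apply: mulr_gt0 => //; apply: mulr_gt0; [apply: exprn_gt0|]; lra.
have h2 : C2bd (fun w => lor w ^+ k.+1 * gexp d w) (fun w => M * lor (Num.sqrt d * w)).
  by apply: C2bd_le h _ => w; rewrite /M !mulrA.
exists (C * M / Num.sqrt d); first by rewrite divr_gt0// mulr_gt0.
by move=> z; exact: (hC _ s0 (lexx _) _ _ h2 z).
Qed.

Lemma measurable_bker (k : nat) (d : R) : measurable_fun setT (bker k d).
Proof.
apply: measurable_ctr; apply: measurable_funM; last exact: measurable_gexp.
by apply: measurable_funX; exact: measurable_lor.
Qed.

Lemma ctr_lin_comb (m : nat) (c : nat -> R) (F : nat -> R -> R) (z : R) :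
  (forall j, mu.-integrable setT (EFin \o F j)) ->
  ctr (fun w => \sum_(j < m) c j * F j w) z = \sum_(j < m) c j * ctr (F j) z.
Proof.
move=> iF; rewrite /ctr.
have [_ <-] := @Rintegral_lin_comb setT m c (fun j w => F j w * cos (z * w)) measurableT
  (fun j => integrable_ctr z (iF j)).
by apply: eq_Rintegral => w _; rewrite mulr_suml; apply: eq_bigr => j _; rewrite mulrA.
Qed.

Lemma gexpD (s t w : R) : gexp (s + t) w = gexp s w * gexp t w.
Proof. by rewrite /gexp -expRD; congr expR; ring. Qed.

Lemma gexpX (t w : R) (n : nat) : gexp t w ^+ n = gexp (n%:R * t) w.
Proof. by rewrite /gexp -expRM_natl; congr expR; ring. Qed.

(** The coefficients of [(1 - x) ^ (k + 1)]. *)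
Definition alt_bin (k j : nat) : R := (-1) ^+ j * 'C(k.+1, j)%:R.

Lemma damp_pow_expand (k : nat) (t d w : R) :
  damp t w ^+ k.+1 * gexp d w =
  \sum_(j < k.+2) alt_bin k j * (lor w ^+ k.+1 * gexp (j%:R * t + d) w).
Proof.
rewrite /damp exprMn exprBn mulr_suml mulr_suml; apply: eq_bigr => j _.
by rewrite expr1n mulr1 gexpX gexpD /alt_bin -mulr_natr; ring.
Qed.

(* The operator [1 - exp (t Delta / 2)], iterated [k + 1] times, gains [t ^ k]
   on the Bessel potential of [g] and leaves an integrable kernel. *)
Theorem high_frequency_bound (k : nat) : exists2 K : R, 0 < K &
  forall (p t : R) (f g : R -> R), 1 <= p -> 0 < t -> t <= 1 ->
    f \in Lfun mu p%:E -> g \in Lfun mu p%:E ->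
    bessel_potential_of (2 * k + 2)%:R g f ->
    {ae mu, forall y,
      `|f y + \sum_(j < k.+1) alt_bin k j.+1 / (2 * pi) *
                \int[mu]_x (g x * bker k (j.+1%:R * t) (x - y))|
        <= K * t ^+ k * pois (fun x => `|g x|) y}.
Proof.
have [C C0 hC] := C2bd_damp_pow (R := R) k.
have [D D0 hD] := ctr_le_lor (@ltr01 R).
pose c0 := (Num.sqrt (2 * pi : R))^-1.
have q0 : 0 < Num.sqrt (2 * pi : R) by rewrite sqrtr_gt0 mulr_gt0// pi_gt0.
have c00 : 0 < c0 by rewrite invr_gt0.
(* One [c0] normalises the Fourier transform, the other is the normalisation missing in [avg]. *)
exists (c0 * (c0 * (D * C))); first by rewrite !mulr_gt0.
move=> p t f g p1 t0 t1 fp gp Hfg.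
have tk : 0 <= t ^+ k by rewrite exprn_ge0 ?ltW.
pose M := c0 * (D * C * t ^+ k).
(* At a positive time the tested Bessel identity says that the average of [f] is a convolution of
   [g]. *)
have id (d : R) (y : R) : 0 < d ->
    avg (Num.sqrt d) f y = \int[mu]_x (g x * (c0 * bker k d (x - y))).
  by move=> d0; rewrite -(avg_kernel y p1 d0 fp) (bessel_gaussian_identity y d0 Hfg).
have bker_bd (d : R) := @bker_le_lor k d.
have mbker d := measurable_bker k d.
have comb (n : nat) y : \sum_(j < k.+2) alt_bin k j * avg (Num.sqrt (j%:R * t + n.+1%:R^-1)) f y =
    \int[mu]_x (g x * (c0 * ctr (fun w => damp t w ^+ k.+1 * gexp n.+1%:R^-1 w) (x - y))).
  have d0 (j : nat) : 0 < j%:R * t + n.+1%:R^-1.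
    by rewrite ltr_wpDl ?invr_gt0// mulr_ge0// ltW.
  under eq_bigr do rewrite id//.
  have ig (j : nat) : mu.-integrable setT (EFin \o (fun x => g x * (c0 * bker k (j%:R * t + n.+1%:R^-1) (x - y)))).
    have [B _ hB] := bker_bd _ (d0 j).
    apply: (@integrable_kernel _ p (c0 * B) g (fun z => c0 * bker k (j%:R * t + n.+1%:R^-1) z)) => //.
      exact: measurable_funM.
    by move=> z; rewrite normrM (gtr0_norm c00) -mulrA ler_wpM2l// ltW.
  have [_ <-] := @Rintegral_lin_comb setT k.+2 (alt_bin k)
     (fun j x => g x * (c0 * bker k (j%:R * t + n.+1%:R^-1) (x - y))) measurableT ig.
  apply: eq_Rintegral => x _.
  have -> : (fun w => damp t w ^+ k.+1 * gexp n.+1%:R^-1 w) =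
      (fun w => \sum_(j < k.+2) alt_bin k j * (lor w ^+ k.+1 * gexp (j%:R * t + n.+1%:R^-1) w)).
    by apply/funext => w; exact: damp_pow_expand.
  rewrite (@ctr_lin_comb k.+2 (alt_bin k)
    (fun j w => lor w ^+ k.+1 * gexp (j%:R * t + n.+1%:R^-1) w)); last first.
    by move=> j; exact: integrable_lorX_gexp.
  by rewrite !mulr_sumr; apply: eq_bigr => j _; rewrite /bker; ring.
have bound (n : nat) y :
    `|\sum_(j < k.+2) alt_bin k j * avg (Num.sqrt (j%:R * t + n.+1%:R^-1)) f y|
    <= M * pois (fun x => `|g x|) y.
  rewrite comb.
  have n0 : 0 <= n.+1%:R^-1 :> R by rewrite invr_ge0.
  have n1 : n.+1%:R^-1 <= 1 :> R by rewrite invf_le1// ler1n.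
  have hh := hC t n.+1%:R^-1 (ltW t0) t1 n0 n1.
  have hh2 : C2bd (fun w => damp t w ^+ k.+1 * gexp n.+1%:R^-1 w) (fun w => C * t ^+ k * lor (1 * w)).
    by apply: C2bd_le hh _ => w; rewrite mul1r.
  apply: (@kernel_abs_le p M g (fun z => c0 * ctr (fun w => damp t w ^+ k.+1 * gexp n.+1%:R^-1 w) z)) => //.
    apply: measurable_funM => //; apply: measurable_ctr.
    by apply: continuous_measurable_fun; exact: (C2bd_continuous hh).
  move=> z; rewrite normrM (gtr0_norm c00) /M.
  have := ler_wpM2l (ltW c00) (hD 1 ltr01 (lexx 1) _ _ hh2 z).
  by rewrite divr1 !mulrA.
have hp : (fun y => M * pois (fun x => `|g x|) y) \in Lfun mu p%:E.
  by apply: Lfun_mull => //; exact: Lfun_pois.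
have A1 := @ae_le_lin_comb_avg p f _ k.+2 (alt_bin k) (fun j => j%:R * t) p1 fp hp
  (fun j => mulr_ge0 (ler0n _ _) (ltW t0)) (fun n y => le_trans (ler_norm _) (bound n y)).
(* The passage to the limit is one-sided, so the two signs of the absolute value are treated
   separately. *)
have A2 : {ae mu, forall y, \sum_(j < k.+2) (- alt_bin k j) * avg (Num.sqrt (j%:R * t)) f y
     <= M * pois (fun x => `|g x|) y}.
  apply: (@ae_le_lin_comb_avg p f _ k.+2 (fun j => - alt_bin k j) (fun j => j%:R * t) p1 fp hp
    (fun j => mulr_ge0 (ler0n _ _) (ltW t0))) => n y.
  apply: (le_trans _ (bound n y)); rewrite -normrN; apply: (le_trans _ (ler_norm _)).
  by rewrite -sumrN; apply: ler_sum => j _; rewrite mulNr.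
apply: ae_impl2 A1 A2 => y B1 B2.
have B : `|\sum_(j < k.+2) alt_bin k j * avg (Num.sqrt (j%:R * t)) f y| <= M * pois (fun x => `|g x|) y.
  rewrite ler_norml B1 andbT lerNl; apply: le_trans B2.
  by rewrite -sumrN; apply: ler_sum => j _; rewrite mulNr.
(* The term [j = 0] has scale zero and equals [sqrt (2 pi) * f y]; the others have positive times
   and are convolutions of [g]. *)
move: B; rewrite big_ord_recl /= mul0r sqrtr0 avg0 {1}/alt_bin expr0 bin0 !mul1r.
have -> : \sum_(i < k.+1) alt_bin k (bump 0 i) * avg (Num.sqrt ((bump 0 i)%:R * t)) f y =
   Num.sqrt (2 * pi) * \sum_(j < k.+1) alt_bin k j.+1 / (2 * pi) *
                \int[mu]_x (g x * bker k (j.+1%:R * t) (x - y)).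
  rewrite mulr_sumr; apply: eq_bigr => j _.
  have jt : 0 < j.+1%:R * t by rewrite mulr_gt0.
  rewrite id// -[(bump 0 j)%N]/(j.+1).
  have [B _ hB] := bker_bd _ jt.
  have ig : mu.-integrable setT (EFin \o (fun x => g x * bker k (j.+1%:R * t) (x - y))).
    exact: (integrable_kernel y p1 gp (mbker _) hB).
  have -> : \int[mu]_x (g x * (c0 * bker k (j.+1%:R * t) (x - y))) =
     c0 * \int[mu]_x (g x * bker k (j.+1%:R * t) (x - y)).
    by rewrite -RintegralZl//; apply: eq_Rintegral => x _; ring.
  have E : (2 * pi : R) = Num.sqrt (2 * pi) ^+ 2.
    by rewrite sqr_sqrtr// mulr_ge0// pi_ge0.
  rewrite (_ : alt_bin k j.+1 / (2 * pi) = alt_bin k j.+1 / Num.sqrt (2 * pi) ^+ 2).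
    by rewrite /c0; field; rewrite gt_eqF.
  by rewrite -E.
rewrite -mulrDr normrM (gtr0_norm q0) => B.
rewrite -(ler_pM2l q0) (le_trans B)// /M /c0 !mulrA mulfV ?gt_eqF// mul1r.
by rewrite le_eqVlt; apply/orP; left; apply/eqP; ring.
Qed.

End HighFrequencyPart.

(** * Antiderivatives and mean value inequalities *)

Section Primitive.
Context {R : realType}.
Local Notation mu := (@lebesgue_measure R).
Implicit Types f F : R -> R.

Lemma derive_continuous f (df : R -> R) : (forall x : R, is_derive x 1 f (df x)) -> continuous f.
Proof.
move=> h x; apply: differentiable_continuous.
by apply/derivable1_diffP; have := h x => ?; exact: ex_derive.
Qed.

Lemma mvt f (df : R -> R) (a b : R) : a < b -> (forall x : R, is_derive x 1 f (df x)) ->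
  exists2 c, a < c < b & f b - f a = df c * (b - a).
Proof.
move=> ab h; have [|c] := MVT ab (fun x _ => h x).
  by apply: continuous_subspaceT => x; exact: (derive_continuous h).
by rewrite in_itv/=; exists c.
Qed.

Lemma nonneg_derive_le f (df : R -> R) (a b : R) : a <= b ->
  (forall x : R, is_derive x 1 f (df x)) -> (forall x, a < x < b -> 0 <= df x) -> f a <= f b.
Proof.
rewrite le_eqVlt => /predU1P[-> //|ab] h df0.
have [c cab E] := mvt ab h.
by rewrite -subr_ge0 E mulr_ge0 ?df0// subr_ge0 ltW.
Qed.

Lemma le_derive_le f g (df dg : R -> R) (a b : R) : a <= b ->
  (forall x : R, is_derive x 1 f (df x)) -> (forall x : R, is_derive x 1 g (dg x)) ->
  (forall x, a < x < b -> df x <= dg x) -> f b - f a <= g b - g a.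
Proof.
move=> ab hf hg le.
suff : g a - f a <= g b - f b by lra.
apply: (@nonneg_derive_le (fun x => g x - f x) (fun x => dg x - df x)) => // x.
by move/le; lra.
Qed.

Lemma continuous_integrable_itv f (a b : R) (x y : bool) : continuous f ->
  mu.-integrable [set` Interval (BSide x a) (BSide y b)] (EFin \o f).
Proof.
move=> cf; apply: (@integrableS _ _ _ mu `[a, b]) => //.
  by move=> z /=; rewrite !itv_boundlr /= => /andP[xa yb]; case: x y xa yb => -[];
    rewrite /= ?bnd_simp => /= *; rewrite ?bnd_simp; apply/andP; split=> //; apply/ltW.
apply: continuous_compact_integrable; first exact: segment_compact.
exact: continuous_subspaceT.
Qed.

(* [int_0^t f] for either sign of [t]: both integrals start at the same point, to
   the left of [0] and [t]. *)
Definition antider f (t : R) : R :=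
  \int[mu]_(y in `]- (`|t| + 2), t]) f y - \int[mu]_(y in `]- (`|t| + 2), 0]) f y.

(** The starting point can be moved to any [- M] far enough to the left, hence be the same for all
    points near [t], as differentiation requires. *)
Lemma antiderE f (M t : R) : continuous f -> `|t| + 2 <= M ->
  antider f t = \int[mu]_(y in `]- M, t]) f y - \int[mu]_(y in `]- M, 0]) f y.
Proof.
move=> cf tM; rewrite /antider; set N := `|t| + 2 in tM *.
have H u : - N <= u -> \int[mu]_(y in `]- N, u]) f y =
    \int[mu]_(y in `]- M, u]) f y - \int[mu]_(y in `]- M, - N]) f y.
  move=> Nu; rewrite Rintegral_itvB ?bnd_simp//; last by rewrite lerN2.
  exact: continuous_integrable_itv.
have := ler_norm (- t); rewrite normrN => h; have := normr_ge0 t => h0.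
by rewrite !H /N; lra.
Qed.

Lemma is_derive_antider f (t : R) : continuous f -> is_derive t 1 (antider f) (f t).
Proof.
move=> cf; pose M : R := `|t| + 4.
pose F (u : R) : R := \int[mu]_(y in `]- M, u]) f y.
have tM : - M < t by rewrite /M ltrNl; have := ler_norm (- t); rewrite normrN; lra.
have [dF vF] : derivable F t 1 /\ F^`()%classic t = f t.
  apply: (@continuous_FTC1 _ f (BRight (- M)) t (t + 1)); rewrite ?ltrDl ?bnd_simp//.
  - exact: continuous_integrable_itv.
  - exact: cf.
have dF1 : is_derive t 1 F (f t).
  by split; [exact: dF|rewrite -vF derive1E].
have dF2 : is_derive t 1 (fun u => F u - F 0) (f t).
  by apply: (is_derive_eq (is_deriveB dF1 (is_derive_cst (F 0) t 1))); rewrite subr0.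
apply: (near_eq_is_derive _ dF2); near=> u.
rewrite (@antiderE f M)//.
have : `|u - t| < 1 by near: u; exists 1 => //= z; rewrite /= distrC.
by have := ler_normD t (u - t); rewrite addrC subrK /M; lra.
Unshelve. all: by end_near.
Qed.

Lemma antider0 f : antider f 0 = 0.
Proof. by rewrite /antider subrr. Qed.

Lemma Rintegral_derive f F (a b : R) : a <= b -> continuous f ->
  (forall x : R, is_derive x 1 F (f x)) -> \int[mu]_(x in `[a, b]) f x = F b - F a.
Proof.
rewrite le_eqVlt => /predU1P[-> cf h|ab cf h].
  by rewrite subrr set_itv1 Rintegral_set1.
have cF := derive_continuous h.
rewrite /Rintegral (@continuous_FTC2 _ f F)//.
- exact: continuous_subspaceT.
- split=> [x _|//|//].
  + by have := h x => ?; exact: ex_derive.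
  + by apply: cvg_at_right_filter; exact: cF.
  + by apply: cvg_at_left_filter; exact: cF.
- by move=> x _; rewrite derive1E; apply: derive_val.
Qed.

End Primitive.

(** * The oscillator equation and iterated convolutions with the sine *)

Section Oscillator.
Context {R : realType}.
Implicit Types f F : R -> R.

Lemma continuous_mul f g : continuous f -> continuous g -> continuous (fun x : R => f x * g x).
Proof. by move=> cf cg x; apply: cvgM; [exact: cf|exact: cg]. Qed.

Lemma derive0_cst F : (forall x : R, is_derive x 1 F 0) -> forall x, F x = F 0.
Proof. by move=> h x; exact: (is_derive_0_is_cst x 0 h). Qed.

Lemma antider_unique f F : continuous f -> (forall x : R, is_derive x 1 F (f x)) ->
  F 0 = 0 -> F =1 antider f.
Proof.
move=> cf hF F0 x; apply/eqP; rewrite -subr_eq0; apply/eqP.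
have d (y : R) : is_derive y 1 (fun x => F x - antider f x) 0.
  have := is_derive_antider y cf => h.
  by apply: (is_derive_eq (is_deriveB (hF y) h)); rewrite subrr.
by rewrite (derive0_cst d) F0 antider0 subrr.
Qed.

(* [Sop f t] is [int_0^t sin (t - s) f s ds] and [Cop f t] is the same with [cos],
   expanded by the addition formulas so that only antiderivatives remain. *)
Definition Sop f (t : R) : R :=
  sin t * antider (fun x => f x * cos x) t - cos t * antider (fun x => f x * sin x) t.

Definition Cop f (t : R) : R :=
  cos t * antider (fun x => f x * cos x) t + sin t * antider (fun x => f x * sin x) t.

Lemma Sop0 f : Sop f 0 = 0.
Proof. by rewrite /Sop !antider0 !mulr0 subr0. Qed.

Lemma Cop0 f : Cop f 0 = 0.
Proof. by rewrite /Cop !antider0 !mulr0 addr0. Qed.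

Lemma is_derive_Sop f (t : R) : continuous f -> is_derive t 1 (Sop f) (Cop f t).
Proof.
move=> cf.
have h1 := is_derive_antider t (continuous_mul cf (@continuous_cos R)).
have h2 := is_derive_antider t (continuous_mul cf (@continuous_sin R)).
apply: (is_derive_eq (is_deriveB (is_deriveM (is_derive_sin t) h1)
  (is_deriveM (is_derive_cos t) h2))).
by rewrite /GRing.scale /= /Cop; ring.
Qed.

Lemma is_derive_Cop f (t : R) : continuous f -> is_derive t 1 (Cop f) (f t - Sop f t).
Proof.
move=> cf.
have h1 := is_derive_antider t (continuous_mul cf (@continuous_cos R)).
have h2 := is_derive_antider t (continuous_mul cf (@continuous_sin R)).
apply: (is_derive_eq (is_deriveD (is_deriveM (is_derive_cos t) h1)
  (is_deriveM (is_derive_sin t) h2))).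
rewrite /GRing.scale /= /Sop; have := cos2Dsin2 t => E.
transitivity (f t * (cos t ^+ 2 + sin t ^+ 2) - (sin t * antider (fun x => f x * cos x) t
  - cos t * antider (fun x => f x * sin x) t)); first by ring.
by rewrite E mulr1.
Qed.

Lemma continuous_Sop f : continuous f -> continuous (Sop f).
Proof. by move=> cf; exact: (derive_continuous (fun x => is_derive_Sop x cf)). Qed.

(* The energy [y ^ 2 + y' ^ 2] of a solution of [y'' + y = 0] is constant. *)
Lemma oscillator_unique0 (y z : R -> R) :
  (forall t : R, is_derive t 1 y (z t)) -> (forall t : R, is_derive t 1 z (- y t)) ->
  y 0 = 0 -> z 0 = 0 -> forall t, y t = 0 /\ z t = 0.
Proof.
move=> hy hz y0 z0 t.
have := @derive0_cst (fun t => y t * y t + z t * z t).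
have d (s : R) : is_derive s 1 (fun t => y t * y t + z t * z t) 0.
  have hys := hy s; have hzs := hz s.
  apply: (is_derive_eq (is_deriveD (is_deriveM hys hys) (is_deriveM hzs hzs))).
  by rewrite /GRing.scale /=; ring.
move=> /(_ d t); rewrite y0 z0 mulr0 addr0 => E.
by split; apply/eqP; rewrite -sqrf_eq0 expr2; apply/eqP; nra.
Qed.

Lemma oscillator_unique (r y z : R -> R) : continuous r ->
  (forall t : R, is_derive t 1 y (z t)) -> (forall t : R, is_derive t 1 z (r t - y t)) ->
  y 0 = 0 -> z 0 = 0 -> y =1 Sop r.
Proof.
move=> cr hy hz y0 z0 t; apply/eqP; rewrite -subr_eq0; apply/eqP.
have [||||->//] := @oscillator_unique0 (fun t => y t - Sop r t) (fun t => z t - Cop r t) _ _ _ _ t.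
- move=> s; have := is_derive_Sop s cr => h.
  exact: (is_deriveB (hy s) h).
- move=> s; have := is_derive_Cop s cr => h.
  by apply: (is_derive_eq (is_deriveB (hz s) h)); ring.
- by rewrite y0 Sop0 subrr.
- by rewrite z0 Cop0 subrr.
Qed.

Lemma antider_Sop f : continuous f ->
  antider (Sop f) =1 (fun t => antider f t - Cop f t).
Proof.
move=> cf t; apply/esym; move: t; apply: antider_unique.
- exact: continuous_Sop.
- move=> s; have := is_derive_Cop s cf => h; have := is_derive_antider s cf => h2.
  by apply: (is_derive_eq (is_deriveB h2 h)); ring.
- by rewrite antider0 Cop0 subrr.
Qed.

(** Two convolutions commute. Here [y = antider f - Cop f] has derivative [Sop f] and satisfies
    [y'' + y = antider f] with zero data at 0, which determines it. *)
Lemma Sop_antider f : continuous f -> Sop (antider f) =1 antider (Sop f).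
Proof.
move=> cf t; rewrite antider_Sop//; apply/esym; move: t.
apply: (@oscillator_unique (antider f) (fun t => antider f t - Cop f t) (Sop f)).
- exact: (derive_continuous (fun x => is_derive_antider x cf)).
- move=> s; have := is_derive_Cop s cf => h; have := is_derive_antider s cf => h2.
  by apply: (is_derive_eq (is_deriveB h2 h)); ring.
- by move=> s; apply: (is_derive_eq (is_derive_Sop s cf)); ring.
- by rewrite antider0 Cop0 subrr.
- exact: Sop0.
Qed.

Definition monom (k : nat) (t : R) : R := t ^+ k / k`!%:R.

(** The convolution of [t ^ k / k!] with [n] copies of the sine. Its Laplace transform is
    [s ^ -(k + 1) * (s ^ 2 + 1) ^ -n], from which the identities below can be read off. *)
Definition sops (k n : nat) : R -> R := iter n Sop (monom k).

Lemma is_derive_exprn (k : nat) (t : R) :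
  is_derive t 1 (fun x : R => x ^+ k) (k%:R * t ^+ k.-1).
Proof.
elim: k => [|k ih].
  have -> : (fun x : R => x ^+ 0) = cst 1 by apply/funext => x; rewrite expr0.
  by rewrite mul0r; exact: is_derive_cst.
have -> : (fun x : R => x ^+ k.+1) = (fun x => x * x ^+ k).
  by apply/funext => x; rewrite exprS.
apply: (is_derive_eq (is_deriveM (is_derive_id t 1) ih)).
rewrite /GRing.scale /= -natr1; case: k {ih} => [|k]; first by rewrite expr0; ring.
by rewrite exprS /=; ring.
Qed.

Lemma is_derive_monom (k : nat) (t : R) :
  is_derive t 1 (monom k) (k%:R * (t ^+ k.-1 / k`!%:R)).
Proof.
have h0 : is_derive t 1 (fun x : R => x ^+ k) (k%:R * t ^+ k.-1).
  exact: is_derive_exprn.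
by apply: (is_derive_eq (is_deriveM h0 (is_derive_cst (k`!%:R^-1 : R) t 1)));
  rewrite /GRing.scale /=; ring.
Qed.

Lemma is_derive_monomS (k : nat) (t : R) : is_derive t 1 (monom k.+1) (monom k t).
Proof.
apply: (is_derive_eq (is_derive_monom k.+1 t)); rewrite /monom factS natrM /=.
have k0 : k`!%:R != 0 :> R by rewrite pnatr_eq0 -lt0n fact_gt0.
by have k1 : k.+1%:R != 0 :> R by []; rewrite invfM mulrCA [k.+1%:R * _]mulrA divff ?mul1r.
Qed.

Lemma continuous_monom (k : nat) : continuous (monom k).
Proof. exact: (derive_continuous (is_derive_monom k)). Qed.

Lemma continuous_sops (k n : nat) : continuous (sops k n).
Proof. by elim: n => [|n ih]; [exact: continuous_monom|exact: continuous_Sop]. Qed.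

Lemma sopsS (k n : nat) : sops k n.+1 = Sop (sops k n). Proof. by []. Qed.

Lemma sops_antider (k n : nat) : sops k.+1 n = antider (sops k n).
Proof.
elim: n => [|n ih].
  apply/funext; apply: antider_unique; first exact: continuous_monom.
    exact: is_derive_monomS.
  by rewrite /sops /= /monom expr0n mul0r.
rewrite sopsS ih; apply/funext => t; rewrite sopsS Sop_antider//.
exact: continuous_sops.
Qed.

Lemma Cop_monom (k : nat) : Cop (monom k.+1) =1 sops k 1.
Proof.
apply: (@oscillator_unique _ _ (fun t => monom k.+1 t - Sop (monom k.+1) t)).
- exact: continuous_monom.
- by move=> t; apply: is_derive_Cop; exact: continuous_monom.
- move=> t; have h := is_derive_Sop t (@continuous_monom k.+1).
  exact: (is_deriveB (is_derive_monomS k t) h).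
- exact: Cop0.
- by rewrite Sop0 /monom expr0n mul0r subrr.
Qed.

Lemma sops_rec0 (k j : nat) : exists2 ds : R -> R,
  (forall t : R, is_derive t 1 (sops k j) (ds t)) &
  forall t, (k + 2 * j)%:R * sops k j t - t * ds t = (2 * j)%:R * sops k j.+1 t.
Proof.
elim: j => [|j [ds hds E]].
  exists (fun t => k%:R * (t ^+ k.-1 / k`!%:R)); first exact: is_derive_monom.
  move=> t; rewrite addn0 mul0r /sops /= /monom.
  case: k => [|k]; first by rewrite !mul0r mulr0 subrr.
  by rewrite exprS /=; ring.
exists (Cop (sops k j)); first by move=> t; apply: is_derive_Sop; exact: continuous_sops.
pose y t := (k + 2 * j.+1)%:R * sops k j.+1 t - t * Cop (sops k j) t
  - (2 * j.+1)%:R * sops k j.+2 t.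
pose z t := (k + 2 * j.+1)%:R * Cop (sops k j) t
  - (Cop (sops k j) t + t * (sops k j t - sops k j.+1 t))
  - (2 * j.+1)%:R * Cop (sops k j.+1) t.
move=> t; apply/eqP; rewrite -subr_eq0; apply/eqP.
have dC n (s : R) := is_derive_Cop s (@continuous_sops k n).
have dS n (s : R) : is_derive s 1 (sops k n.+1) (Cop (sops k n) s).
  exact: (is_derive_Sop s (@continuous_sops k n)).
have [] := @oscillator_unique0 y z _ _ _ _ t => //.
- move=> s.
  apply: (is_derive_eq (is_deriveB (is_deriveB (is_deriveM (is_derive_cst ((k + 2 * j.+1)%:R : R) s 1) (dS j s))
    (is_deriveM (is_derive_id s 1) (dC j s))) (is_deriveM (is_derive_cst ((2 * j.+1)%:R : R) s 1) (dS j.+1 s)))).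
  by rewrite /GRing.scale /= /cst -!sopsS /z; ring.
- move=> s.
  have d1 := is_deriveM (is_derive_cst ((k + 2 * j.+1)%:R : R) s 1) (dC j s).
  have d2 := is_deriveD (dC j s) (is_deriveM (is_derive_id s 1) (is_deriveB (hds s) (dS j s))).
  have d3 := is_deriveM (is_derive_cst ((2 * j.+1)%:R : R) s 1) (dC j.+1 s).
  apply: (is_derive_eq (is_deriveB (is_deriveB d1 d2) d3)).
  rewrite /GRing.scale /= /cst -!sopsS /y; have := E s; rewrite !natrD !natrM -!natr1.
  set a := k%:R; set b := j%:R; set s0 := sops k j s; set s1 := sops k j.+1 s.
  set s2 := sops k j.+2 s; set c := Cop _ _; set d := ds s => H.
  rewrite -[(_ - _) s]/(s0 - s1); lra.
- by rewrite /y !sopsS !Sop0 Cop0; ring.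
- by rewrite /z !sopsS !Sop0 !Cop0; ring.
Qed.

Lemma sops_rec (k j : nat) (t : R) :
  (k + 2 + 2 * j)%:R * sops k j.+1 t - t * Cop (sops k j) t
  = (2 * j.+1)%:R * sops k j.+2 t.
Proof.
have [ds hds] := sops_rec0 k j.+1.
have -> : ds = Cop (sops k j).
  apply/funext => s; have [_ <-] := hds s.
  by have [_ <-] := is_derive_Sop s (@continuous_sops k j).
by move=> <-; congr (_%:R * _ - _); rewrite mulnS addnA.
Qed.

(** The convolution of [f] with [1 - cos] at [T] is the increment on [[0, T]] of a function whose
    derivative is the integrand: its sign and size then follow from the mean value theorem. *)
Lemma one_sub_cos_conv f (T : R) : continuous f -> exists g : R -> R,
  [/\ forall s : R, is_derive s 1 g (f s * (1 - cos (T - s))), g 0 = 0 &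
      g T = antider (Sop f) T].
Proof.
move=> cf; exists (fun s => antider f s - (cos T * antider (fun x => f x * cos x) s
   + sin T * antider (fun x => f x * sin x) s)); split => [s| |].
- have h0 := is_derive_antider s cf.
  have h1 := is_derive_antider s (continuous_mul cf (@continuous_cos R)).
  have h2 := is_derive_antider s (continuous_mul cf (@continuous_sin R)).
  apply: (is_derive_eq (is_deriveB h0 (is_deriveD (is_deriveM (is_derive_cst (cos T) s 1) h1)
    (is_deriveM (is_derive_cst (sin T) s 1) h2)))).
  by rewrite /GRing.scale /= cosB; ring.
- by rewrite !antider0; ring.
- by rewrite antider_Sop.
Qed.

Lemma sin_conv f (T : R) : continuous f -> exists g : R -> R,
  [/\ forall s : R, is_derive s 1 g (f s * sin (T - s)), g 0 = 0 & g T = Sop f T].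
Proof.
move=> cf; exists (fun s => sin T * antider (fun x => f x * cos x) s
   - cos T * antider (fun x => f x * sin x) s); split => [s| |//].
- have h1 := is_derive_antider s (continuous_mul cf (@continuous_cos R)).
  have h2 := is_derive_antider s (continuous_mul cf (@continuous_sin R)).
  apply: (is_derive_eq (is_deriveB (is_deriveM (is_derive_cst (sin T) s 1) h1)
    (is_deriveM (is_derive_cst (cos T) s 1) h2))).
  by rewrite /GRing.scale /= sinB; ring.
- by rewrite !antider0; ring.
Qed.

End Oscillator.

(** * Positivity and growth of the convolution powers of [1 - cos] *)

Section OscillatorBounds.
Context {R : realType}.
Implicit Types f : R -> R.

Lemma one_sub_cos_ge0 (x : R) : 0 <= 1 - cos x.
Proof. by rewrite subr_ge0 cos_le1. Qed.

Lemma one_sub_cos_gt0 (x : R) : 0 < `|x| -> `|x| < 1 -> 0 < 1 - cos x.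
Proof.
move=> x0 x1; rewrite subr_gt0 -cos_norm -[ltRHS]cos0.
have p2 := pihalf_ge1 R.
rewrite ltr_cos// in_itv/= ?lexx ?pi_ge0// ltW//=.
by rewrite ltW// (lt_le_trans x1)//; lra.
Qed.

Lemma antider_Sop_ge0 f (T : R) : continuous f -> (forall s, 0 <= s -> 0 <= f s) ->
  0 <= T -> 0 <= antider (Sop f) T.
Proof.
move=> cf f0 T0; have [g [dg g0 <-]] := one_sub_cos_conv T cf.
rewrite -g0; apply: (nonneg_derive_le T0 dg) => s /andP[s0 _].
by rewrite mulr_ge0 ?f0 ?one_sub_cos_ge0// ltW.
Qed.

(* A zero at [T] would make [1 - cos (T - s)] vanish for all small [s], hence
   [cos] equal to [1] at two distinct points less than [1] apart. *)
Lemma antider_Sop_gt0 f (T : R) : continuous f -> (forall s, 0 <= s -> 0 <= f s) ->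
  (forall s, 0 < s -> s < 1 -> 0 < f s) -> 0 < T -> 0 < antider (Sop f) T.
Proof.
move=> cf f0 f1 T0; have [g [dg g0 <-]] := one_sub_cos_conv T cf.
(* Strict positivity of [f] is given below 1 only, since [1 - cos], the first function to which the
   lemma is applied, vanishes at [2 * pi]. *)
pose m := Num.min T 1.
have [m0 mT m1] : [/\ 0 < m, m <= T & m <= 1].
  by rewrite lt_min T0 ltr01 ge_min lexx ge_min lexx orbT.
have mono a b : 0 <= a -> a <= b -> g a <= g b.
  move=> a0 ab; apply: (nonneg_derive_le ab dg) => s /andP[s0 _].
  by rewrite mulr_ge0 ?f0 ?one_sub_cos_ge0// ltW// (le_lt_trans a0).
rewrite lt_neqAle -{2}g0 mono ?(ltW T0)// andbT eq_sym; apply/eqP => gT.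
have gc s : 0 <= s -> s <= T -> g s = 0.
  move=> s0 sT; have := mono _ _ s0 sT; have := mono _ _ (lexx 0) s0.
  by rewrite g0 gT => a b; apply/eqP; rewrite eq_le a b.
have cos1 s : 0 < s -> s < m -> cos (T - s) = 1.
  move=> s0 sm.
  have d0 : is_derive s 1 g 0.
    apply: (near_eq_is_derive _ (is_derive_cst (0 : R) s 1)).
    have /near_in_itvoo : s \in `]0, m[%R by rewrite in_itv/= s0.
    apply: filterS => u.
    rewrite in_itv/= => /andP[u0 um]; rewrite gc//; first exact: ltW.
    by rewrite (le_trans _ mT)// ltW.
  have [_ E1] := dg s; have [_ E2] := d0.
  have : f s * (1 - cos (T - s)) = 0 by rewrite -E1 E2.
  move/eqP; rewrite mulf_eq0 gt_eqF ?f1 ?(lt_le_trans sm)//= subr_eq0 => /eqP.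
  by move=> <-.
have h1 : cos (T - m / 3) = 1 by apply: cos1; lra.
have h2 : cos (T - 2 * m / 3) = 1 by apply: cos1; lra.
have s1 : sin (T - m / 3) = 0.
  by have := cos2Dsin2 (T - m / 3); rewrite h1 => E; apply/eqP; rewrite -sqrf_eq0; apply/eqP; lra.
have := @one_sub_cos_gt0 (m / 3).
have -> : m / 3 = T - m / 3 - (T - 2 * m / 3) by field.
rewrite cosB h1 h2 s1 mul0r addr0 mul1r subrr ltxx.
have -> : T - m / 3 - (T - 2 * m / 3) = m / 3 by field.
by rewrite gtr0_norm; [move=> H; suff : false by []; apply: H; lra|lra].
Qed.

Lemma conv_abs_le f (u g : R -> R) (C T : R) (n : nat) : 0 <= T ->
  (forall s, 0 <= s -> `|f s| <= C * s ^+ n) ->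
  (forall s : R, is_derive s 1 g (f s * u s)) -> g 0 = 0 ->
  forall B, (forall s, `|u s| <= B) -> `|g T| <= C * B * T ^+ n.+1.
Proof.
move=> T0 fC dg g0 B uB.
have B0 : 0 <= B := le_trans (normr_ge0 _) (uB 0).
rewrite -[g T]subr0 -g0.
apply: (le_trans (@mvt_abs_le _ _ _ _ _ (C * T ^+ n * B) T0 dg _)).
  move=> s /andP[s0 sT]; rewrite normrM ler_pM// (le_trans (fC _ s0))//.
  have := le_trans (normr_ge0 _) (fC _ s0).
  rewrite le_eqVlt => /predU1P[E|p].
    have : 0 <= C * T ^+ n by rewrite (le_trans (normr_ge0 (f T)))// fC.
    by rewrite -E.
  rewrite ler_wpM2l ?lerXn2r ?nnegrE//.
  have sn : 0 <= s ^+ n by rewrite exprn_ge0.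
  rewrite leNgt; apply/negP => C0; move: p; rewrite ltNge.
  by rewrite mulr_le0_ge0// ltW.
by rewrite subr0 exprSr (_ : C * T ^+ n * B * T = C * B * (T ^+ n * T)); [|ring].
Qed.

Lemma Sop_abs_le f (C T : R) (n : nat) : continuous f -> 0 <= T ->
  (forall s, 0 <= s -> `|f s| <= C * s ^+ n) -> `|Sop f T| <= C * T ^+ n.+1.
Proof.
move=> cf T0 fC; have [g [dg g0 <-]] := sin_conv T cf.
rewrite -[X in X * _]mulr1; apply: (conv_abs_le T0 fC dg g0) => s.
exact: sin_max.
Qed.

Lemma antider_Sop_abs_le f (C T : R) (n : nat) : continuous f -> 0 <= T ->
  (forall s, 0 <= s -> `|f s| <= C * s ^+ n) -> `|antider (Sop f) T| <= C * 2 * T ^+ n.+1.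
Proof.
move=> cf T0 fC; have [g [dg g0 <-]] := one_sub_cos_conv T cf.
apply: (conv_abs_le T0 fC dg g0) => s.
by rewrite ger0_norm ?one_sub_cos_ge0//; have := cos_geN1 (T - s); lra.
Qed.

(* [antider (Sop f)] is the convolution of [f] with [1 - cos]; since
   [sops k.+1] is [antider] of [sops k], [osc k] is the convolution power of
   order [k + 1] of [1 - cos]. *)
Definition osc (k : nat) : R -> R := sops k k.+1.

Lemma continuous_osc (k : nat) : continuous (osc k).
Proof. exact: continuous_sops. Qed.

Lemma osc0 : osc 0 =1 (fun t => 1 - cos t).
Proof.
move=> t; apply/esym; move: t; apply: (@oscillator_unique _ (monom 0) _ (@sin R)).
- exact: continuous_monom.
- move=> t; have h := is_derive_cos t.
  by apply: (is_derive_eq (is_deriveB (is_derive_cst (1 : R) t 1) h)); rewrite sub0r opprK.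
- move=> t; apply: (is_derive_eq (is_derive_sin t)).
  by rewrite /monom expr0 fact0 divr1; ring.
- by rewrite cos0 subrr.
- exact: sin0.
Qed.

Lemma oscS (k : nat) : osc k.+1 = antider (Sop (osc k)).
Proof. by rewrite /osc sops_antider. Qed.

Lemma osc_ge0 (k : nat) (t : R) : 0 <= t -> 0 <= osc k t.
Proof.
elim: k t => [|k ih] t t0; first by rewrite osc0 one_sub_cos_ge0.
by rewrite oscS antider_Sop_ge0//; exact: continuous_osc.
Qed.

Lemma osc_gt0 (k : nat) (t : R) : 0 < t -> 0 < osc k.+1 t.
Proof.
elim: k t => [|k ih] t t0; rewrite oscS; apply: antider_Sop_gt0 => //;
  try exact: continuous_osc; try exact: osc_ge0.
  by move=> s s0 s1; rewrite osc0 one_sub_cos_gt0// gtr0_norm.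
by move=> s s0 _; exact: ih.
Qed.

Lemma osc_le (k : nat) : exists2 C : R, 0 < C & forall t, 0 <= t -> `|osc k t| <= C * t ^+ k.
Proof.
elim: k => [|k [C C0 hC]].
  exists 2 => // t t0; rewrite osc0 expr0 ger0_norm ?one_sub_cos_ge0//.
  by have := cos_geN1 t; lra.
exists (C * 2); first lra.
by move=> t t0; rewrite oscS; apply: antider_Sop_abs_le => //; exact: continuous_osc.
Qed.

(** In the integrand [(1 - cos s) * (1 - cos (t - s))] the product of cosines is
    [(cos t + cos (t - 2 s)) / 2]. Replacing [cos t] by -1 leaves a lower bound with the explicit
    primitive [h]. *)
Lemma osc1_ge (t : R) : 0 <= t -> t / 2 - 3 / 2 <= osc 1 t.
Proof.
move=> t0; rewrite oscS.
have [g [dg g0 <-]] := one_sub_cos_conv t (@continuous_osc 0).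
pose h (s : R) := s / 2 - sin s + sin (t - s) - sin (t - 2 * s) / 4.
pose h1 (s : R) := 1 / 2 - cos s - cos (t - s) + cos (t - 2 * s) / 2.
have dh (s : R) : is_derive s 1 h (h1 s).
  have d1 : is_derive s 1 (fun s => sin (t - s)) (-1 * cos (t - s)).
    by apply: (is_derive_comp (is_derive_subl t s)); exact: is_derive_sin.
  have d0 : is_derive s 1 (fun s => t - 2 * s) (- 2).
    by apply: is_derive_eq; rewrite /GRing.scale /=; ring.
  have d2 : is_derive s 1 (fun s => sin (t - 2 * s)) (- 2 * cos (t - 2 * s)).
    by apply: (is_derive_comp d0); exact: is_derive_sin.
  have d3 : is_derive s 1 (@sin R) (cos s) := is_derive_sin s.
  have d4 := is_deriveB (is_deriveD (is_deriveB (is_deriveM (is_derive_id s 1)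
    (is_derive_cst (2^-1 : R) s 1)) d3) d1) (is_deriveM d2 (is_derive_cst (4^-1 : R) s 1)).
  by apply: (is_derive_eq d4); rewrite /GRing.scale /= /h1 /cst; field.
have : h t - h 0 <= g t - g 0.
  apply: (le_derive_le t0 dh dg) => s _; rewrite osc0 /h1.
  have e1 : cos t = cos s * cos (t - s) - sin s * sin (t - s).
    by rewrite -cosD; congr cos; ring.
  have e2 : cos (t - 2 * s) = cos (t - s) * cos s + sin (t - s) * sin s.
    by rewrite -cosB; congr cos; ring.
  have := cos_geN1 t; rewrite e1 e2; lra.
rewrite g0 subr0; apply: le_trans; rewrite /h subrr !subr0 !mulr0 subr0 sin0.
have -> : t - 2 * t = - t by ring.
by rewrite sinN; have := sin_le1 t; have := sin_geN1 t; lra.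
Qed.

(** Positivity alone would allow decay. The growth comes from the mean value 1 of [1 - cos]: each
    convolution integrates the previous lower bound, up to terms of lower order. *)
Lemma osc_ge (k : nat) : exists c T : R, [/\ 0 < c, 1 <= T &
  forall t, T <= t -> c * t ^+ k.+1 <= osc k.+1 t].
Proof.
elim: k => [|k [c [T [c0 T1 hT]]]].
  exists (1 / 4), 6; split; [lra|lra|move=> t tT].
  by rewrite expr1; have := @osc1_ge t; lra.
have T0 : 0 <= T by lra.
have n0 : 0 < k.+2%:R :> R by [].
have n1 : k.+2%:R != 0 :> R by [].
have n2 : 2 <= k.+2%:R :> R by rewrite ler_nat.
pose n : R := k.+2%:R.
pose M := T ^+ k.+2.
have M0 : 0 <= M by rewrite exprn_ge0.
(* Beyond this threshold [t ^ (k + 1)] and the boundary term [M / n] are each at most a quarter of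
   the leading term [t ^ (k + 2) / n]. *)
exists (c / (4 * n)), (Num.max T (Num.max (4 * n) M)); split.
- by rewrite divr_gt0// mulr_gt0.
- by rewrite le_max T1.
move=> t; rewrite !ge_max => /and3P[Tt nt Mt]; rewrite oscS.
have t0 : 0 <= t by rewrite (le_trans T0).
have [g [dg g0 <-]] := one_sub_cos_conv t (@continuous_osc k.+1).
(* The derivative of [h] is [c * s ^ (k + 1) * (1 - cos (t - s))] plus the nonpositive term
   [c * (k + 1) * s ^ k * (sin (t - s) - 1)], so that [h] bounds the convolution from below. *)
pose h (s : R) := c * (s ^+ k.+2 / n + s ^+ k.+1 * sin (t - s) - s ^+ k.+1).
pose h1 (s : R) := c * (s ^+ k.+1 + (k.+1%:R * s ^+ k * sin (t - s) - s ^+ k.+1 * cos (t - s))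
   - k.+1%:R * s ^+ k).
have dh (s : R) : is_derive s 1 h (h1 s).
  have d1 : is_derive s 1 (fun s => sin (t - s)) (-1 * cos (t - s)).
    by apply: (is_derive_comp (is_derive_subl t s)); exact: is_derive_sin.
  have d2 := is_derive_exprn k.+1 s; have d3 := is_derive_exprn k.+2 s.
  have d4 := is_deriveB (is_deriveD (is_deriveM d3 (is_derive_cst (n^-1) s 1))
    (is_deriveM d2 d1)) d2.
  apply: (is_derive_eq (is_deriveM (is_derive_cst c s 1) d4)).
  by rewrite /GRing.scale /= /h1 /cst /n; field.
have gT : 0 <= g T.
  rewrite -g0; apply: (nonneg_derive_le T0 dg) => s /andP[s0 _].
  by rewrite mulr_ge0 ?one_sub_cos_ge0// osc_ge0// ltW.
have : h t - h T <= g t - g T.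
  apply: (le_derive_le Tt dh dg) => s /andP[Ts _].
  have s0 : 0 <= s by lra.
  have h2 := ler_wpM2r (one_sub_cos_ge0 (t - s)) (hT _ (ltW Ts)).
  apply: le_trans h2; rewrite /h1 -[leRHS]mulrA ler_pM2l//.
  have p : 0 <= k.+1%:R * s ^+ k by rewrite mulr_ge0// exprn_ge0.
  have := ler_wpM2l p (sin_le1 (t - s)); rewrite mulr1; lra.
move=> H; apply: (@le_trans _ _ (h t - h T)); last lra.
have tk0 : 0 <= t ^+ k.+1 by rewrite exprn_ge0.
have Tk0 : 0 <= T ^+ k.+1 by rewrite exprn_ge0.
have tk1 : 1 <= t ^+ k.+1 by rewrite exprn_ege1// (le_trans T1).
rewrite /h subrr sin0 mulr0 addr0.
have e1 : T ^+ k.+1 * sin (t - T) - T ^+ k.+1 <= 0.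
  by have := ler_wpM2l Tk0 (sin_le1 (t - T)); lra.
pose Y := t ^+ k.+2 / n.
have YE : t * t ^+ k.+1 = n * Y by rewrite -exprS /Y mulrCA divff ?mulr1.
have e2 : t ^+ k.+1 <= Y / 4.
  by rewrite -(ler_pM2l n0) -/n; have := ler_wpM2r tk0 nt; rewrite YE; lra.
have e3 : M / n <= Y / 4.
  apply: le_trans e2; apply: (@le_trans _ _ t).
    by apply: (le_trans _ Mt); rewrite ler_pdivrMr// ler_peMr// -/n; lra.
  by rewrite exprS ler_peMr// exprn_ege1// (le_trans T1).
have -> : c / (4 * n) * t ^+ k.+2 = c * (Y / 4) by rewrite /Y; field.
rewrite -mulrBr ler_pM2l// -/M -/Y.
have y0 := le_trans tk0 e2; move: e1 e2 e3 y0; move: (M / n) (T ^+ _ * sin _) => a b.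
clear YE; move: (T ^+ _) (t ^+ k.+1) Y => x y z; lra.
Qed.

End OscillatorBounds.

(** * The cosine transform of the Wendland function *)

Section WendlandTransform.
Context {R : realType}.
Local Notation mu := (@lebesgue_measure R).
Implicit Types f phi : R -> R.

Lemma continuous_trunc_power (l : nat) : continuous (@trunc_power R l).
Proof.
have cm : continuous (fun r : R => Num.max (1 - r) 0).
  move=> r; apply: (@continuous_max R R (fun r => 1 - r) (fun=> 0)); last exact: cvg_cst.
  by apply: continuousB; [exact: cvg_cst|exact: cvg_id].
by move=> r; exact: (cvg_comp _ _ (cm r) (@exprn_continuous R l _)).
Qed.

Lemma continuous_idM f : continuous f -> continuous (fun t : R => t * f t).
Proof. by move=> cf; apply: continuous_mul => // t; exact: cvg_id. Qed.

Lemma wendland_int_eq0 phi (r : R) : (forall r, 1 <= r -> phi r = 0) -> 1 <= r ->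
  wendland_int phi r = 0.
Proof.
move=> phi0 r1; rewrite /wendland_int [LHS]Rintegral_indic (_ : (fun t => _) = cst 0).
  by rewrite Rintegral_cst ?mul0r.
apply/funext => t; rewrite indicE; case: (boolP (t \in _)); last by rewrite mul0r.
by rewrite inE/= in_itv/= andbT => rt; rewrite phi0 ?mulr0// (le_trans r1).
Qed.

(** As [phi] vanishes beyond 1, the integral stops there. The identity covers all real [r], also
    negative ones, so that two-sided derivatives exist at 0. *)
Lemma wendland_intE phi : continuous phi -> (forall r, 1 <= r -> phi r = 0) ->
  wendland_int phi =1
  (fun r => antider (fun t => t * phi t) 1 - antider (fun t => t * phi t) r).
Proof.
move=> cphi phi0 r; pose F t := t * phi t; pose G := antider F.
have cF : continuous F := continuous_idM cphi.
have dG (t : R) : is_derive t 1 G (F t) by exact: is_derive_antider.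
have F0 t : 1 <= t -> F t = 0 by move=> /phi0; rewrite /F => ->; rewrite mulr0.
have [r1|r1] := leP r 1.
  rewrite /wendland_int -(Rintegral_derive r1 cF dG) [LHS]Rintegral_indic [RHS]Rintegral_indic.
  apply: eq_Rintegral => t _; have [t1|t1] := leP 1 t; first by rewrite -/(F t) F0// !mulr0.
  congr (_ * _); rewrite !indicE (_ : (t \in _) = (t \in [set` `[r, 1]%R]))//.
  apply/idP/idP; rewrite !inE/= !in_itv/= andbT; last by case/andP.
  by move=> ->; rewrite ltW.
rewrite wendland_int_eq0 ?(ltW r1)//.
apply/esym/eqP; rewrite subr_eq0; apply/eqP.
have d0 (t : R) : is_derive t 1 (fun=> 0 : R) (0 : R) by exact: is_derive_cst.
have h1 := le_derive_le (ltW r1) dG d0; have h2 := le_derive_le (ltW r1) d0 dG.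
have : G r - G 1 <= 0 by rewrite -[leRHS](subrr (0:R)); apply: h1 => t /andP[t1 _]; rewrite F0// ltW.
have : 0 <= G r - G 1 by rewrite -[leLHS](subrr (0:R)); apply: h2 => t /andP[t1 _]; rewrite F0// ltW.
rewrite -/F -/G; lra.
Qed.

(** The exponent [k + 1] and the number [j] of integrations are separated, so that inductions can
    run on [j]; the Wendland function is the case [j = k]. *)
Definition wend (k j : nat) : R -> R := iter j wendland_int (trunc_power k.+1).

Lemma wend_props (k j : nat) : [/\ continuous (wend k j),
  forall r, 1 <= r -> wend k j r = 0,
  forall r, 0 <= r -> r < 1 -> 0 < wend k j r &
  forall r : R, is_derive r 1 (wend k j.+1) (- (r * wend k j r))].
Proof.
have D f : continuous f -> (forall r, 1 <= r -> f r = 0) ->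
    forall r : R, is_derive r 1 (wendland_int f) (- (r * f r)).
  move=> cf f0 r; rewrite (funext (wendland_intE cf f0)).
  have h := is_derive_antider r (continuous_idM cf).
  by apply: (is_derive_eq (is_deriveB (is_derive_cst _ r 1) h)); rewrite sub0r.
elim: j => [|j [cj zj pj dj]].
  have c0 := @continuous_trunc_power k.+1.
  have z0 (r : R) : 1 <= r -> trunc_power k.+1 r = 0.
    by move=> r1; rewrite /trunc_power max_r ?expr0n// subr_le0.
  split => //; last exact: D.
  by move=> r _ r1; rewrite /wend /= /trunc_power max_l ?exprn_gt0 ?subr_gt0// subr_ge0 ltW.
have cS : continuous (wend k j.+1) by exact: (derive_continuous dj).
have zS r : 1 <= r -> wend k j.+1 r = 0.
  by move=> r1; rewrite /wend iterS wendland_int_eq0.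
split => //; last exact: D.
move=> r r0 r1; have [c /andP[rc c1]] := mvt r1 dj; rewrite zS// sub0r => E.
have : 0 < c * wend k j c * (1 - r).
  by rewrite mulr_gt0 ?subr_gt0// mulr_gt0 ?pj//; lra.
by lra.
Qed.

Lemma continuous_cosM (w : R) : continuous (fun r : R => cos (w * r)).
Proof.
move=> r; apply: (@continuous_comp _ _ _ ( *%R w) cos); first exact: mulrl_continuous.
exact: continuous_cos.
Qed.

Lemma is_derive_cosM (w r : R) : is_derive r 1 (fun r : R => cos (w * r)) (- w * sin (w * r)).
Proof.
have d : is_derive r 1 (fun r : R => w * r) w.
  by apply: (is_derive_eq (is_deriveM (is_derive_cst w r 1) (is_derive_id r 1)));
    rewrite /GRing.scale /= /cst; ring.
apply: (is_derive_eq (is_derive_comp d (is_derive_cos (w * r)))); ring.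
Qed.

Lemma is_derive_sinM (w r : R) : is_derive r 1 (fun r : R => sin (w * r)) (w * cos (w * r)).
Proof.
have d : is_derive r 1 (fun r : R => w * r) w.
  by apply: (is_derive_eq (is_deriveM (is_derive_cst w r 1) (is_derive_id r 1)));
    rewrite /GRing.scale /= /cst; ring.
exact: (is_derive_comp d (is_derive_sin (w * r))).
Qed.

Definition wtr (k j : nat) (w : R) : R := \int[mu]_(r in `[0, 1]) (wend k j r * cos (w * r)).

Lemma wtrN (k j : nat) (w : R) : wtr k j (- w) = wtr k j w.
Proof. by apply: eq_Rintegral => r _; rewrite mulNr cosN. Qed.

(** Differentiation brings out [r * wend k j r], which is minus the derivative of [wend k j.+1]; an
    integration by parts restores the cosine. The boundary terms vanish, at 1 by the support and at
    0 by the sine. *)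
Lemma is_derive_wtr (k j : nat) (w : R) : is_derive w 1 (wtr k j) (- w * wtr k j.+1 w).
Proof.
have [cj zj pj dj] := wend_props k j; have [cj1 zj1 _ _] := wend_props k j.+1.
have cS (v : R) : continuous (fun r : R => r * wend k j r * sin (v * r)).
  apply: continuous_mul; first exact: continuous_idM.
  exact: (derive_continuous (is_derive_sinM v)).
have cC (v : R) i : continuous (fun r : R => wend k i r * cos (v * r)).
  apply: continuous_mul; first by have [] := wend_props k i.
  exact: continuous_cosM.
have h := @is_derive_under_integral R `[0, 1] (fun w r => wend k j r * cos (w * r))
  (fun w r => - (r * wend k j r * sin (w * r))) (fun r => `|r * wend k j r|) w.
apply: (is_derive_eq (h _ _ _ _ _)) => //; last first.
- have d (r : R) : is_derive r 1 (fun r : R => wend k j.+1 r * sin (w * r))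
     (- (r * wend k j r * sin (w * r)) + w * (wend k j.+1 r * cos (w * r))).
    apply: (is_derive_eq (is_deriveM (dj r) (is_derive_sinM w r))).
    by rewrite /GRing.scale /=; ring.
  have c : continuous (fun r : R => - (r * wend k j r * sin (w * r)) + w * (wend k j.+1 r * cos (w * r))).
    move=> r; apply: cvgD; first by apply: cvgN; exact: cS.
    by apply: cvgM; [exact: cvg_cst|exact: cC].
  have := Rintegral_derive ler01 c d.
  rewrite zj1// mulr0 sin0 mulr0 mul0r subr0 RintegralD//; last 2 first.
  + by apply: continuous_integrable_itv => r; apply: cvgN; exact: cS.
  + apply: continuous_integrable_itv => r; apply: cvgM; [exact: cvg_cst|exact: cC].
  rewrite RintegralZl//; last exact: continuous_integrable_itv.
  by rewrite -/(wtr k j.+1 w); lra.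
- by move=> v r _ _; rewrite normrN normrM ler_piMr// sin_max.
- apply: continuous_integrable_itv => r; apply: cvg_norm; exact: continuous_idM.
- move=> v r; apply: (is_derive_eq (is_deriveM (is_derive_cst (wend k j r) v 1) (_ : is_derive v 1 (fun v => cos (v * r)) (- r * sin (v * r))))).
    have -> : (fun v => cos (v * r)) = (fun v => cos (r * v)).
      by apply/funext => v'; rewrite mulrC.
    by rewrite [v * r]mulrC; exact: is_derive_cosM.
  by rewrite /GRing.scale /= /cst; ring.
- by move=> v; apply: continuous_integrable_itv.
Qed.

(** With [s = w * (1 - r)] the integral becomes the convolution of [s ^ (k + 1)] with the cosine at
    [w], that is, [Cop] of a monomial. *)
Lemma wtr0E (k : nat) (w : R) : w ^+ k.+2 * wtr k 0 w = k.+1`!%:R * sops k 1 w.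
Proof.
rewrite -Cop_monom /Cop.
have cm := @continuous_monom R k.+1.
pose F1 := antider (fun x : R => monom k.+1 x * cos x).
pose F2 := antider (fun x : R => monom k.+1 x * sin x).
pose H (r : R) := - (cos w * F1 (w * (1 - r)) + sin w * F2 (w * (1 - r))).
pose g (r : R) := w ^+ k.+2 / k.+1`!%:R * ((1 - r) ^+ k.+1 * cos (w * r)).
have dH (r : R) : is_derive r 1 H (g r).
  have d0 : is_derive r 1 (fun r : R => w * (1 - r)) (- w).
    by apply: (is_derive_eq (is_deriveM (is_derive_cst w r 1) (is_derive_subl 1 r)));
      rewrite /GRing.scale /= /cst; ring.
  have d1 := is_derive_comp d0 (is_derive_antider _ (continuous_mul cm (@continuous_cos R))).
  have d2 := is_derive_comp d0 (is_derive_antider _ (continuous_mul cm (@continuous_sin R))).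
  apply: (is_derive_eq (is_deriveN (is_deriveD (is_deriveM (is_derive_cst (cos w) r 1) d1)
    (is_deriveM (is_derive_cst (sin w) r 1) d2)))).
  rewrite /GRing.scale /= /cst /g /monom.
  have -> : w * r = w - w * (1 - r) by ring.
  by rewrite cosB exprMn [w ^+ k.+2]exprS; ring.
have cg : continuous g.
  move=> r; apply: cvgM; first exact: cvg_cst.
  apply: cvgM; last exact: continuous_cosM.
  apply: (@continuous_comp _ _ _ (fun r : R => 1 - r) (fun y => y ^+ k.+1)).
    by apply: cvgB; [exact: cvg_cst|exact: cvg_id].
  exact: exprn_continuous.
have := Rintegral_derive ler01 cg dH.
rewrite RintegralZl//; last first.
  apply: continuous_integrable_itv => r; apply: cvgM; last exact: continuous_cosM.
  apply: (@continuous_comp _ _ _ (fun r : R => 1 - r) (fun y => y ^+ k.+1)).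
    by apply: cvgB; [exact: cvg_cst|exact: cvg_id].
  exact: exprn_continuous.
have -> : \int[mu]_(r in `[0, 1]) ((1 - r) ^+ k.+1 * cos (w * r)) = wtr k 0 w.
  apply: eq_Rintegral => r; rewrite inE/= in_itv/= => /andP[_ r1].
  by rewrite /wend /= /trunc_power max_l// subr_ge0.
rewrite /H subrr subr0 mulr0 mulr1 {1}/F1 {1}/F2 !antider0 !mulr0 addr0 oppr0 sub0r opprK => <-.
by rewrite mulrA mulrCA divff ?mulr1// pnatr_eq0 -lt0n fact_gt0.
Qed.

(* Differentiating [w ^+ (k + 2 + 2 j) * wtr k j w] with [is_derive_wtr] gives the
   recurrence [sops_rec]. *)
Lemma wtrE (k j : nat) : exists2 c : R, 0 < c &
  forall w, w ^+ (k.+2 + j.*2) * wtr k j w = c * sops k j.+1 w.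
Proof.
elim: j => [|j [c c0 E]].
  exists k.+1`!%:R; first by rewrite ltr0n fact_gt0.
  by move=> w; rewrite addn0 wtr0E.
exists (c * (2 * j.+1)%:R); first by rewrite mulr_gt0.
move=> w; have d1 := is_deriveM (is_derive_exprn (k.+2 + j.*2) w) (is_derive_wtr k j w).
have d2 : is_derive w 1 (fun w => c * sops k j.+1 w) (c * Cop (sops k j) w).
  have h := is_derive_Sop w (@continuous_sops R k j).
  by apply: (is_derive_eq (is_deriveM (is_derive_cst c w 1) h));
    rewrite /GRing.scale /= /cst; ring.
have [_ E2] := d2; have [_] := d1.
rewrite (_ : _ * wtr k j = (fun w => c * sops k j.+1 w)); last by apply/funext => v; rewrite -E.
rewrite E2 /GRing.scale /= => E3.
rewrite -mulrA -sops_rec mulrBr [c * (w * _)]mulrCA E3 [c * (_ * _)]mulrCA -E.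
have -> : (k.+2 + j.+1.*2 = (k.+2 + j.*2).+2)%N by rewrite doubleS !addnS.
have -> : (k + 2 + 2 * j = k.+2 + j.*2)%N by rewrite addn2 mul2n.
have -> : (k.+2 + j.*2 = (k.+1 + j.*2).+1)%N by [].
by rewrite /= !exprS; ring.
Qed.

Lemma continuous_wtr (k j : nat) : continuous (wtr k j).
Proof. exact: (derive_continuous (is_derive_wtr k j)). Qed.

Lemma wtr_abs_le (k j : nat) (w : R) : `|wtr k j w| <= wtr k j 0.
Proof.
have [cj zj pj _] := wend_props k j.
have p r : r \in `[0, 1]%classic -> 0 <= wend k j r.
  rewrite inE/= in_itv/= => /andP[r0]; rewrite le_eqVlt => /predU1P[->|r1].
    by rewrite zj.
  by rewrite ltW// pj.
have i v : mu.-integrable `[0, 1] (EFin \o (fun r => wend k j r * cos (v * r))).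
  by apply: continuous_integrable_itv; apply: continuous_mul; [|exact: continuous_cosM].
rewrite /wtr; apply: (le_trans (le_normr_Rintegral _ (i w))) => //.
apply: le_Rintegral => //.
- exact: integrable_norm.
- move=> r /mem_set /p h; rewrite mul0r cos0 mulr1 normrM (ger0_norm h).
  by rewrite ler_piMr// cos_max.
Qed.

Lemma wtr0_gt0 (k j : nat) : 0 < wtr k j 0.
Proof.
have [cj _ pj _] := wend_props k j.
rewrite /wtr (_ : (fun r => _) = wend k j); last first.
  by apply/funext => r; rewrite mul0r cos0 mulr1.
have d (r : R) := is_derive_antider r cj.
rewrite (Rintegral_derive ler01 cj d).
by have [c /andP[c0 c1] ->] := mvt ltr01 d; rewrite subr0 mulr1 pj// ltW.
Qed.

Lemma ctr_wendland (k : nat) (w : R) : ctr (wendland1 k) w = 2 * wtr k k w.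
Proof.
have [ck zk _ _] := wend_props k k.
have wE x : wendland1 k x = wend k k `|x| by [].
pose F x := wendland1 k x * cos (w * x).
have cF : continuous F.
  apply: continuous_mul; last exact: continuous_cosM.
  by move=> x; exact: (cvg_comp _ _ (@norm_continuous _ R x) (ck _)).
have dF (x : R) := is_derive_antider x cF.
have oddF : (fun t => - antider F (- t)) =1 antider F.
  apply: antider_unique => //; last by rewrite oppr0 antider0 oppr0.
  move=> t; have d : is_derive t 1 (fun t : R => - t) (- 1).
    by apply: (is_derive_eq (is_deriveN (is_derive_id t 1))).
  apply: (is_derive_eq (is_deriveN (is_derive_comp d (dF _)))).
  by rewrite mulN1r opprK /F mulrN cosN !wE normrN.
have -> : ctr (wendland1 k) w = \int[mu]_(x in `[(- 1), 1]) F x.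
  rewrite /ctr [RHS]Rintegral_indic; apply: eq_Rintegral => x _; rewrite /F indicE.
  case: (boolP (x \in _)); first by rewrite mul1r mulrC.
  rewrite notin_setE/= in_itv/= => x1; rewrite mul0r wE zk ?mul0r//.
  by rewrite leNgt; apply/negP => /ltW; rewrite ler_norml.
have -> : wtr k k w = \int[mu]_(x in `[0, 1]) F x.
  apply: eq_Rintegral => x; rewrite inE/= in_itv/= => /andP[x0 _].
  by rewrite /F wE ger0_norm.
rewrite (Rintegral_derive ler01 cF dF) (Rintegral_derive _ cF dF); last by lra.
by rewrite -[antider F (-1)]opprK oddF antider0; ring.
Qed.

End WendlandTransform.

(** * Two-sided bounds on the symbol of the Wendland function *)

Section Symbol.
Context {R : realType}.
Local Notation mu := (@lebesgue_measure R).

Lemma lor_pow_decay (n : nat) (u : R -> R) (M C : R) : (forall w, `|u (- w)| = `|u w|) ->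
  (forall w, 0 <= w <= 1 -> `|u w| <= M) ->
  (forall w, 1 <= w -> `|u w| * w ^+ n.*2 <= C) ->
  forall w, `|u w| <= (M + C) * (2 * lor w) ^+ n.
Proof.
move=> uN uM uC w.
wlog w0 : w / 0 <= w => [H|].
  have [/H//|w0] := leP 0 w; rewrite -uN.
  have -> : lor w = lor (- w) by rewrite /lor sqrrN.
  by apply: H; lra.
have M0 : 0 <= M by apply: le_trans (uM 0 _) => //; rewrite lexx ler01.
have C0 : 0 <= C by apply: le_trans (uC 1 _) => //; rewrite expr1n mulr1.
have [w1|w1] := leP w 1.
  apply: (@le_trans _ _ M); first by rewrite uM ?w0.
  rewrite -[leLHS]mulr1 ler_pM//; first lra.
  by apply: exprn_ege1; apply: lor_ge_half; rewrite ger0_norm.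
have wn : 0 < w ^+ n.*2 by rewrite exprn_gt0//; lra.
have h : 1 <= (2 * lor w) ^+ n * w ^+ n.*2.
  rewrite -mul2n exprM -exprMn; apply: exprn_ege1.
  have w2 : 0 < w ^+ 2 by rewrite exprn_gt0//; lra.
  rewrite -ler_pdivrMr// mul1r; apply: lor_inv_sqr.
  by rewrite ger0_norm// ltW.
rewrite -(ler_pM2r wn); apply: (le_trans (uC _ (ltW w1))).
rewrite -mulrA -[leLHS]mulr1 ler_pM//; lra.
Qed.

Lemma sops_abs_le (k i : nat) : exists2 C : R, 0 < C &
  forall w, 0 <= w -> `|sops k (k + i).+1 w| <= C * w ^+ (k + i).
Proof.
elim: i => [|i [C C0 h]]; first by rewrite addn0; exact: osc_le.
exists C => // w w0; rewrite addnS sopsS; apply: Sop_abs_le => //.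
exact: continuous_sops.
Qed.

(** Each differentiation of the symbol raises the second index and brings a factor [w]. By [wtrE]
    the product of [wtr k (k + i) w] with [w ^ (k + 2 + 2 (k + i))] is O([w ^ (k + i)]) for large
    [w], which leaves the decay [w ^ -(2 k + 2)] after multiplication by [w ^ i]. *)
Lemma wtr_decay (k i : nat) : exists2 C : R, 0 < C &
  forall w, `|w ^+ i * wtr k (k + i) w| <= C * lor w ^+ k.+1.
Proof.
have [C C0 hC] := sops_abs_le k i; have [c c0 hc] := @wtrE R k (k + i).
pose M : R := wtr k (k + i) 0; have M0 : 0 < M := wtr0_gt0 k (k + i).
exists ((M + c * C) * 2 ^+ k.+1); first by rewrite mulr_gt0 ?exprn_gt0 ?addr_gt0 ?mulr_gt0.
move=> w; rewrite -mulrA -exprMn.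
apply: (@lor_pow_decay k.+1 (fun w => w ^+ i * wtr k (k + i) w)) => {}w.
- by rewrite wtrN !normrM !normrX normrN.
- move=> /andP[w0 w1]; rewrite normrM -[M]mul1r ler_pM ?wtr_abs_le//.
  by rewrite ger0_norm ?exprn_ge0// exprn_ile1.
- move=> w1; have w0 : 0 < w by lra.
  have wn : 0 < w ^+ (k + i) by rewrite exprn_gt0.
  rewrite -(ler_pM2r wn) -mulrA.
  apply: (@le_trans _ _ `|c * sops k (k + i).+1 w|).
    rewrite -hc; have -> : (k.+2 + (k + i).*2 = i + (k.+1.*2 + (k + i)))%N.
      by rewrite -!addnn; lia.
    have -> : w ^+ (i + (k.+1.*2 + (k + i))) * wtr k (k + i) w =
        (w ^+ i * wtr k (k + i) w) * (w ^+ k.+1.*2 * w ^+ (k + i)) by rewrite !exprD; ring.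
    by rewrite (normrM (w ^+ i * _)) (ger0_norm (_ : 0 <= w ^+ k.+1.*2 * _))// mulr_ge0 ?exprn_ge0// ltW.
  by rewrite normrM (gtr0_norm c0) -mulrA ler_pM2l// hC// ltW.
Qed.

Definition wsym (k : nat) (w : R) : R := ctr (wendland1 k) w.

(** Up to a power of [w] the symbol is [osc k], positive for [w > 0] and at least of order [w ^ k]
    for large [w]. On the remaining compact interval continuity and positivity give a minimum. For
    [k = 0] the zeros of [1 - cos] would forbid such a bound. *)
Lemma wsym_ge (k : nat) : (0 < k)%N -> exists2 c : R, 0 < c &
  forall w, c * lor w ^+ k.+1 <= wsym k w.
Proof.
case: k => // k _; set n := k.+1.
have [c [T [c0 T1 hT]]] := @osc_ge R k; have [d d0 hd] := @wtrE R n n.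
have pos (w : R) : 0 <= w -> 0 < wtr n n w.
  rewrite le_eqVlt => /predU1P[<-|w0]; first exact: wtr0_gt0.
  have wn : 0 < w ^+ (n.+2 + n.*2) by rewrite exprn_gt0.
  by rewrite -(pmulr_rgt0 _ wn) hd mulr_gt0// osc_gt0.
have T0 : 0 <= T by lra.
have [m] := @EVT_min R (wtr n n) 0 T T0 (continuous_subspaceT (@continuous_wtr R n n)).
rewrite in_itv/= => /andP[m0 _] hm.
pose b := Num.min (wtr n n m) (d * c).
have b0 : 0 < b by rewrite lt_min pos//= mulr_gt0.
exists b => // w; rewrite /wsym ctr_wendland.
suff H : b * lor w ^+ n.+1 <= wtr n n w.
  have := exprn_ge0 n.+1 (lor_ge0 w); nra.
wlog w0 : w / 0 <= w => [H|].
  have [/H//|w0] := leP 0 w; rewrite -wtrN.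
  have -> : lor w = lor (- w) by rewrite /lor sqrrN.
  by apply: H; lra.
have l1 : lor w ^+ n.+1 <= 1 by rewrite exprn_ile1 ?lor_ge0 ?lor_le1.
have [wT|wT] := leP w T.
  apply: (@le_trans _ _ b); first by rewrite ler_piMr// ltW.
  by apply: (@le_trans _ _ (wtr n n m)); rewrite ?ge_min ?lexx// hm// in_itv/= w0.
have wp : 0 < w by lra.
have wn : 0 < w ^+ (n.+2 + n.*2) by rewrite exprn_gt0.
rewrite -(ler_pM2l wn) hd; apply: (@le_trans _ _ (d * (c * w ^+ n))); last first.
  by rewrite ler_pM2l// hT// ltW.
have -> : (n.+2 + n.*2 = n + n.+1.*2)%N by rewrite doubleS !addnS !addSn.
have l2 : w ^+ n.+1.*2 * lor w ^+ n.+1 <= 1.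
  rewrite -mul2n exprM -exprMn; apply: exprn_ile1.
    by rewrite mulr_ge0 ?sqr_ge0 ?lor_ge0.
  exact: lor_sqr1.
have wn0 : 0 < w ^+ n by rewrite exprn_gt0.
have -> : w ^+ (n + n.+1.*2) * (b * lor w ^+ n.+1) =
    w ^+ n * (b * (w ^+ n.+1.*2 * lor w ^+ n.+1)) by rewrite exprD; ring.
rewrite [d * _]mulrA [leRHS]mulrC ler_pM2l//; apply: (@le_trans _ _ b); first by rewrite ler_piMr// ltW.
by rewrite ge_min lexx orbT.
Qed.

Lemma C2bd_wsym (k : nat) : exists2 C : R, 0 < C &
  C2bd (wsym k) (fun w => C * lor w ^+ k.+1).
Proof.
have [C0 C00 h0] := wtr_decay k 0; have [C1 C10 h1] := wtr_decay k 1.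
have [C2 C20 h2] := wtr_decay k 2.
pose M : R := wtr k k.+1 0; have M0 : 0 < M := wtr0_gt0 k k.+1.
(* The second derivative contains [wtr k k.+1] without a factor [w]: near 0 it is bounded by its
   value there, and beyond 1 the missing factor can be inserted. *)
have [C3 C30 h3] : exists2 C : R, 0 < C & forall w, `|wtr k k.+1 w| <= C * lor w ^+ k.+1.
  exists ((M + C1) * 2 ^+ k.+1); first by rewrite mulr_gt0 ?exprn_gt0 ?addr_gt0.
  move=> w; rewrite -mulrA -exprMn; apply: lor_pow_decay => {}w.
  - by rewrite wtrN.
  - by move=> _; exact: wtr_abs_le.
  - move=> w1; have := h1 w; rewrite addn1 expr1 normrM.
    have w2 : 0 < w ^+ 2 by rewrite exprn_gt0//; lra.
    have l2 : w ^+ k.+1.*2 * lor w ^+ k.+1 <= 1.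
      rewrite -mul2n exprM -exprMn; apply: exprn_ile1.
        by rewrite mulr_ge0 ?sqr_ge0 ?lor_ge0.
      exact: lor_sqr1.
    have wn : 0 <= w ^+ k.+1.*2 by rewrite exprn_ge0//; lra.
    rewrite (ger0_norm (_ : 0 <= w)); last lra.
    move=> h; have := ler_wpM2r wn h; rewrite -[X in _ <= X]mulrA [X in _ <= _ * X]mulrC.
    have := normr_ge0 (wtr k k.+1 w) => a0.
    have := mulr_ge0 a0 wn => a1; rewrite -mulrA.
    by nra.
exists (2 * (C0 + C1 + C2 + C3)); first by rewrite mulr_gt0// !addr_gt0.
exists (fun w => 2 * (- w * wtr k k.+1 w)).
exists (fun w => 2 * (- wtr k k.+1 w + w ^+ 2 * wtr k k.+2 w)); split.
- move=> w; have -> : wsym k = (fun w => 2 * wtr k k w) by apply/funext => v; exact: ctr_wendland.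
  by apply: (is_derive_eq (is_deriveM (is_derive_cst (2 : R) w 1) (is_derive_wtr k k w)));
    rewrite /GRing.scale /= /cst; ring.
- move=> w; have d1 := is_derive_wtr k k.+1 w.
  have dN : is_derive w 1 (fun w : R => - w) (-1) by exact: is_deriveN (is_derive_id w 1).
  have d2 : is_derive w 1 (fun w => - w * wtr k k.+1 w) (w ^+ 2 * wtr k k.+2 w - wtr k k.+1 w).
    apply: (is_derive_eq (is_deriveM dN d1)); rewrite /GRing.scale /=.
    by move: (wtr k k.+1 w) (wtr k k.+2 w) => a b; ring.
  apply: (is_derive_eq (is_deriveM (is_derive_cst (2 : R) w 1) d2)).
  rewrite /GRing.scale /= /cst mulr0 addr0.
  by move: (wtr k k.+1 w) (wtr k k.+2 w) => a b; ring.
move=> w; have := exprn_ge0 k.+1 (lor_ge0 w); set J := lor w ^+ k.+1 => J0.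
have := h0 w; have := h1 w; have := h2 w; have := h3 w.
rewrite addn0 addn1 addn2 expr0 expr1 mul1r -/J => a3 a2 a1 a0.
have b i : 0 < i -> 0 <= i * J by move=> i0; rewrite mulr_ge0// ltW.
have b0 := b _ C00; have b1 := b _ C10; have b2 := b _ C20; have b3 := b _ C30.
have -> : 2 * (C0 + C1 + C2 + C3) * J = 2 * (C0 * J + C1 * J + C2 * J + C3 * J) by ring.
rewrite /wsym ctr_wendland !normrM !normrN (ger0_norm (ler0n _ 2)) -normrM.
move: a0 a1 a2 a3 b0 b1 b2 b3.
have := ler_normD (- wtr k k.+1 w) (w ^+ 2 * wtr k k.+2 w); rewrite normrN.
move: (C0 * J) (C1 * J) (C2 * J) (C3 * J) => y0 y1 y2 y3.
move: `|- wtr k k.+1 w + _| `|w ^+ 2 * _| `|w * _| `|wtr k k.+1 w| `|wtr k k w|.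
move=> z1 z2 z3 z4 z5 *.
by split; lra.
Qed.

End Symbol.

(** * Factorisation of smooth kernels through the Wendland function *)

Section WendlandKernel.
Context {R : realType}.
Local Notation mu := (@lebesgue_measure R).

(** The quotient and its derivatives are polynomials in the ratios of [F], [G] and their derivatives
    to [G]; the ratios that are not 1 are at most [c^-1], as numerator and denominator share the
    majorant [a]. *)
Lemma C2bd_div (F G a : R -> R) (c : R) : 0 < c -> (forall x, 0 < a x) ->
  (forall x, c * a x <= G x) -> C2bd F a -> C2bd G a ->
  C2bd (fun x => F x / G x) (fun=> c^-1 + 3 * c^-1 ^+ 2 + 2 * c^-1 ^+ 3).
Proof.
move=> c0 a0 aG [F1 [F2 [f1 f2 hF]]] [G1 [G2 [g1 g2 hG]]].
have G0 x : 0 < G x by rewrite (lt_le_trans _ (aG x))// mulr_gt0.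
pose r x := (G x)^-1.
have dr (x : R) : is_derive x 1 r (- r x ^+ 2 * G1 x).
  have Gn : G x != 0 by rewrite gt_eqF.
  by apply: (is_derive_eq (is_deriveV Gn (g1 x))); rewrite /GRing.scale /= /r exprVn; ring.
exists (fun x => F1 x * r x - F x * r x * (G1 x * r x)).
exists (fun x => F2 x * r x - 2 * (F1 x * r x * (G1 x * r x))
  + 2 * (F x * r x * (G1 x * r x) ^+ 2) - F x * r x * (G2 x * r x)); split.
- move=> x; apply: (is_derive_eq (is_deriveM (f1 x) (dr x))).
  by rewrite /GRing.scale /=; ring.
- move=> x; apply: (is_derive_eq (is_deriveB (is_deriveM (f2 x) (dr x))
    (is_deriveM (is_deriveM (f1 x) (dr x)) (is_deriveM (g2 x) (dr x))))).
  by rewrite /GRing.scale /= -[(F * r) x]/(F x * r x) -[(G1 * r) x]/(G1 x * r x); ring.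
move=> x; set d := c^-1; have d0 : 0 <= d by rewrite invr_ge0 ltW.
have rb u : `|u| <= a x -> `|u * r x| <= d.
  move=> ua; rewrite normrM /r normfV (gtr0_norm (G0 x)) ler_pdivrMr//.
  by rewrite (le_trans ua)// /d mulrC ler_pdivlMr// mulrC.
have [/rb p0 /rb p1 /rb p2] := hF x; have [_ /rb q1 /rb q2] := hG x.
have mb (u v e e' : R) : `|u| <= e -> `|v| <= e' -> `|u * v| <= e * e'.
  by move=> ue ve; rewrite normrM ler_pM.
have d2 : 0 <= d ^+ 2 by rewrite exprn_ge0.
have d3 : 0 <= d ^+ 3 by rewrite exprn_ge0.
split.
- by apply: (le_trans p0); lra.
- have := mb _ _ _ _ p0 q1; rewrite -expr2.
  by have := ler_normB (F1 x * r x) (F x * r x * (G1 x * r x)); lra.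
have h1 := mb _ _ _ _ p1 q1; have h2 := mb _ _ _ _ p0 q2.
have h3 := mb _ _ _ _ p0 (mb _ _ _ _ q1 q1).
rewrite -!expr2 -exprS in h1 h2 h3.
set w := F1 x * r x * _ in h1 *; set u := F x * r x * (G2 x * r x) in h2 *.
set v := F x * r x * (_ ^+ 2) in h3 *.
have n2 (y : R) : `|2 * y| = 2 * `|y| by rewrite normrM ger0_norm.
have := ler_normB (F2 x * r x) (2 * w); have := ler_normD (F2 x * r x - 2 * w) (2 * v).
have := ler_normB (F2 x * r x - 2 * w + 2 * v) u; rewrite !n2; lra.
Qed.

Lemma C2bd_lorX (n : nat) : exists2 C : R, 0 < C & C2bd (fun w => lor w ^+ n) (fun w => C * lor w ^+ n).
Proof.
elim: n => [|n [C C0 h]].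
  exists 1 => //; apply: C2bd_le (C2bd_ext (C2bd_cst 1) _) _ => x; rewrite expr0//.
  by rewrite normr1 mulr1.
exists (40 * C); first by rewrite mulr_gt0.
apply: C2bd_le (C2bd_ext (C2bd_mul C2bd_lor h) _) _ => x; first by rewrite exprS.
by rewrite exprS (_ : 4 * _ = 40 * C * (lor x * lor x ^+ n)); [|ring].
Qed.

Lemma C2bd_symbol_quotient (k : nat) : (0 < k)%N -> exists2 B : R, 0 < B &
  C2bd (fun w : R => lor w ^+ k.+1 / wsym k w) (fun=> B).
Proof.
move=> k0; have [c c0 hc] := @wsym_ge R k k0; have [C1 C10 h1] := @C2bd_wsym R k.
have [C2 C20 h2] := C2bd_lorX k.+1.
pose C := C1 + C2; have C0 : 0 < C by rewrite addr_gt0.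
have J0 w : 0 < lor w ^+ k.+1 :> R by rewrite exprn_gt0 ?lor_gt0.
have cC : 0 < c / C by rewrite divr_gt0.
exists ((c / C)^-1 + 3 * (c / C)^-1 ^+ 2 + 2 * (c / C)^-1 ^+ 3).
  by rewrite !addr_gt0 ?mulr_gt0 ?exprn_gt0 ?invr_gt0.
apply: (@C2bd_div _ _ (fun w => C * lor w ^+ k.+1)) => //.
- by move=> w; rewrite mulr_gt0.
- by move=> w; rewrite mulrA divfK ?gt_eqF.
- by apply: C2bd_le h2 _ => w; rewrite ler_pM2r// lerDr ltW.
- by apply: C2bd_le h1 _ => w; rewrite ler_pM2r// lerDl ltW.
Qed.

Lemma fubini_bound (H : R -> R -> R) (D : R -> R) :
  measurable_fun setT (fun z : R * R => H z.1 z.2) ->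
  (forall x, mu.-integrable setT (EFin \o H x)) ->
  (forall y, mu.-integrable setT (EFin \o H^~ y)) ->
  mu.-integrable setT (EFin \o D) -> (forall x, \int[mu]_y `|H x y| <= D x) ->
  \int[mu]_x \int[mu]_y H x y = \int[mu]_y \int[mu]_x H x y.
Proof.
move=> mH Hx Hy iD HD; apply: fubini_Rintegral => //.
apply: (@le_lt_trans _ _ (\int[mu]_x (D x)%:E)%E); last first.
  exact: (integral_fune_lt_pinfty measurableT iD).
apply: ge0_le_integral => //.
- by move=> x _; apply: integral_ge0 => y _; rewrite lee_fin.
- apply: (@measurable_ge0_integral_param R (fun z => `|H z.1 z.2|%:E)).
    by apply/measurable_EFinP; exact: measurableT_comp.
  by move=> z; rewrite lee_fin.
- exact: (measurable_int mu iD).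
- move=> x _; have h := integrable_abs (Hx x).
  have := HD x; rewrite -lee_fin; apply: le_trans.
  rewrite /Rintegral fineK//; exact: (integrable_fin_num measurableT h).
Qed.

Lemma fubini_prod (H : R -> R -> R) (F G : R -> R) :
  measurable_fun setT (fun z : R * R => H z.1 z.2) ->
  mu.-integrable setT (EFin \o F) -> mu.-integrable setT (EFin \o G) ->
  (forall x y, `|H x y| <= F x * G y) ->
  \int[mu]_x \int[mu]_y H x y = \int[mu]_y \int[mu]_x H x y.
Proof.
move=> mH iF iG HFG.
have mHx x : measurable_fun setT (H x).
  exact: (measurableT_comp mH (measurable_fun_pair (measurable_cst x) (@measurable_id _ _ setT))).
have mHy y : measurable_fun setT (H^~ y).
  exact: (measurableT_comp mH (measurable_fun_pair (@measurable_id _ _ setT) (measurable_cst y))).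
have Hx x := integrable_le (mHx x) (integrable_mull (F x) iG) (HFG x).
apply: (@fubini_bound H (fun x => (\int[mu]_y G y) * F x)) => //.
- by move=> y; apply: (integrable_le (mHy y) (integrable_mull (G y) iF)) => x; rewrite mulrC.
- exact: integrable_mull.
- move=> x; rewrite mulrC -(RintegralZl (F x) measurableT iG).
  apply: le_Rintegral => //; [exact: integrable_abs|exact: integrable_mull].
Qed.

Lemma wendland1_sym (k : nat) (x y : R) : wendland1 k (x - y) = wendland1 k (y - x).
Proof. by rewrite /wendland1 distrC. Qed.

Lemma wendland1_eq0 (k : nat) (x : R) : 1 <= `|x| -> wendland1 k x = 0.
Proof. by have [_ + _ _] := @wend_props R k k; exact. Qed.

Lemma continuous_wendland1 (k : nat) : continuous (@wendland1 R k).
Proof.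
have [ck _ _ _] := @wend_props R k k.
by move=> x; exact: (cvg_comp _ _ (@norm_continuous _ R x) (ck _)).
Qed.

Lemma measurable_wendland1 (k : nat) : measurable_fun setT (@wendland1 R k).
Proof. by apply: continuous_measurable_fun; exact: continuous_wendland1. Qed.

Lemma wendland1_le_lor (k : nat) : exists2 C : R, 0 < C &
  forall x, `|wendland1 k x| <= C * lor x.
Proof.
have h11 : -1 <= 1 :> R by lra.
have [c _ hc] := @EVT_max R (fun x => `|wendland1 k x|) (-1) 1 h11
   (continuous_subspaceT (fun x => cvg_norm (@continuous_wendland1 k x))).
exists (2 * `|wendland1 k c| + 1); first by rewrite ltr_wpDl// mulr_ge0.
move=> x; have l0 := lor_ge0 x; have n0 := normr_ge0 (wendland1 k c).
have [x1|x1] := leP `|x| 1; last first.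
  by rewrite (wendland1_eq0 k (ltW x1)) normr0; apply: mulr_ge0 => //; apply: addr_ge0 => //; apply: mulr_ge0.
have xi : x \in `[(-1), 1] by rewrite in_itv/= -ler_norml.
by have := hc x xi; have := lor_ge_half x1; nra.
Qed.

Lemma integrable_wendland1 (k : nat) : mu.-integrable setT (EFin \o @wendland1 R k).
Proof.
have [C _ hC] := wendland1_le_lor k.
exact: (integrable_le (measurable_wendland1 k) (integrable_mull C integrable_lor) hC).
Qed.

(** Cosines are eigenfunctions of the convolution with an even function: the sine part has an odd
    integrand. *)
Lemma wendland1_cos (k : nat) (x w : R) :
  \int[mu]_t (wendland1 k (x - t) * cos (w * t)) = cos (w * x) * wsym k w.
Proof.
have iP := @integrable_wendland1 k; have mP := @measurable_wendland1 k.
pose P := @wendland1 R k; pose F t := P t * cos (w * (x - t)).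
have mF : measurable_fun setT F.
  apply: measurable_funM => //; apply: measurableT_comp.
    exact: continuous_measurable_fun (@continuous_cos R).
  by apply: measurable_funM => //; exact: measurable_funB.
transitivity (\int[mu]_t F t).
  rewrite -(Rintegral_reflect x mF); apply: eq_Rintegral => t _.
  by rewrite /F /P (_ : x - (x - t) = t); [|ring].
pose S t := P t * sin (w * t).
have iS : mu.-integrable setT (EFin \o S).
  by apply: integrable_mul_bounded => //; [exact: measurable_sinM|move=> t; exact: sin_max].
have iC := integrable_ctr w iP.
have -> : F = (fun t => cos (w * x) * (P t * cos (w * t)) + sin (w * x) * S t).
  by apply/funext => t; rewrite /F /S mulrBr cosB; ring.
rewrite RintegralD//; try exact: integrable_mull.
rewrite RintegralZl// RintegralZl// (Rintegral_odd (u := S))//.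
- by rewrite mulr0 addr0.
- exact: measurable_integrable.
- by move=> t; rewrite /S mulrN sinN mulrN /P /wendland1 normrN.
Qed.

(** Take for [K] the cosine transform of the symbol of [bker k t] divided by [wsym k]. The quotient
    is bounded with two derivatives and the Gaussian makes it integrable, at the price of
    [1 / Num.sqrt t]. Fubini and [wendland1_cos] multiply the symbol back. *)
Theorem bker_factor (k : nat) (T : R) : (0 < k)%N -> 0 < T -> exists2 C : R, 0 < C &
  forall t, 0 < t -> t <= T -> exists K : R -> R, [/\ measurable_fun setT K,
    forall z, `|K z| <= C / Num.sqrt t * lor z &
    forall x, bker k t x = \int[mu]_z (wendland1 k (x - z) * K z)].
Proof.
move=> k0 T0; have [B B0 hB] := C2bd_symbol_quotient k0.
have sT : 0 < Num.sqrt T by rewrite sqrtr_gt0.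
have [D D0 hD] := ctr_le_lor sT.
pose M := 4 * (B * (16 * (1 + T))).
have M0 : 0 < M by rewrite /M mulr_gt0// mulr_gt0//; lra.
exists (D * M); first exact: mulr_gt0.
move=> t t0 tT; pose F w := lor w ^+ k.+1 / wsym k w * gexp t w.
have st : 0 < Num.sqrt t by rewrite sqrtr_gt0.
have hF : C2bd F (fun w => M * lor (Num.sqrt t * w)).
  apply: C2bd_le (C2bd_mul hB (C2bd_gexp (ltW t0) tT)) _ => w.
  by rewrite /M !mulrA.
have iF := integrable_C2bd_lor st hF; have mF := measurable_integrable iF.
exists (ctr F); split; first exact: measurable_ctr.
  by move=> z; apply: hD hF z; rewrite ?ler_wsqrtr.
move=> x; pose H w z := F w * (wendland1 k (x - z) * cos (w * z)).
have mP := @measurable_wendland1 k.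
have iP : mu.-integrable setT (EFin \o (fun z => `|wendland1 k (x - z)|)).
  have [C _ hC] := wendland1_le_lor k.
  apply: (integrable_le _ (integrable_mull C (integrable_lor_reflect x))) => [|z].
    by do 2 apply: measurableT_comp => //; exact: measurable_funB.
  by rewrite normr_id.
have mH : measurable_fun setT (fun z : R * R => H z.1 z.2).
  apply: measurable_funM; first by apply: measurableT_comp => //; exact: measurable_fst.
  apply: measurable_funM.
    by apply: measurableT_comp => //; apply: measurable_funB => //; exact: measurable_snd.
  apply: measurableT_comp; first exact: continuous_measurable_fun (@continuous_cos R).
  by apply: measurable_funM; [exact: measurable_fst|exact: measurable_snd].
have E := @fubini_prod H (fun w => `|F w|) (fun z => `|wendland1 k (x - z)|) mH
  (integrable_abs iF) iP.
transitivity (\int[mu]_w \int[mu]_z H w z).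
  apply: eq_Rintegral => w _; rewrite RintegralZl//.
    rewrite wendland1_cos /F [w * x]mulrC; field.
    have [c c0 hc] := @wsym_ge R k k0; rewrite gt_eqF//; apply: lt_le_trans (hc w).
    by apply: mulr_gt0 => //; apply: exprn_gt0; exact: lor_gt0.
  apply: (integrable_le _ iP) => [|z].
    apply: measurable_funM; last exact: measurable_cosM.
    by apply: measurableT_comp => //; exact: measurable_funB.
  by rewrite normrM ler_piMr// cos_max.
rewrite E; last first.
  by move=> w z; rewrite /H !normrM ler_wpM2l// ler_piMr// cos_max.
apply: eq_Rintegral => z _; rewrite /ctr -RintegralZl//; last exact: integrable_ctr.
by apply: eq_Rintegral => w _; rewrite /H [z * w]mulrC; ring.
Qed.

End WendlandKernel.

(** * Approximation by a convolution with the Wendland function *)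

Section WendlandConvolution.
Context {R : realType}.
Local Notation mu := (@lebesgue_measure R).

(** Associativity of convolution. The exchange is dominated by [lor] times [pois] of [|g|],
    integrable because this [pois] is again in L^p. *)
Lemma conv_kernel_swap (p C D : R) (g P K : R -> R) (y : R) : 1 <= p ->
  g \in Lfun mu p%:E -> measurable_fun setT P -> measurable_fun setT K ->
  (forall z, `|P z| <= D * lor z) -> (forall z, `|K z| <= C * lor z) ->
  \int[mu]_x (g x * \int[mu]_z (P (y - z) * K (x - z))) =
  \int[mu]_z (P (y - z) * \int[mu]_x (g x * K (x - z))).
Proof.
move=> p1 gp mP mK PD KC; have mg := Lfun_measurable gp.
have C0 : 0 <= C by have := le_trans (normr_ge0 _) (KC 0); rewrite pmulr_lge0// lor_gt0.
have D0 : 0 <= D by have := le_trans (normr_ge0 _) (PD 0); rewrite pmulr_lge0// lor_gt0.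
pose H z x := P (y - z) * (g x * K (x - z)).
have mH : measurable_fun setT (fun u : R * R => H u.1 u.2).
  apply: measurable_funM.
    by apply: measurableT_comp => //; apply: measurable_funB => //; exact: measurable_fst.
  apply: measurable_funM; first by apply: measurableT_comp => //; exact: measurable_snd.
  by apply: measurableT_comp => //; apply: measurable_funB; [exact: measurable_snd|exact: measurable_fst].
have iPK x : mu.-integrable setT (EFin \o (fun z => P (y - z) * K (x - z))).
  apply: (integrable_le _ (integrable_mull (D * C) (integrable_lor_reflect y))) => [|z].
    by apply: measurable_funM; apply: measurableT_comp => //; exact: measurable_funB.
  rewrite normrM -mulrA [C * _]mulrC mulrA ler_pM//.
  by apply: (le_trans (KC _)); rewrite ler_piMr// lor_le1.
have E := @fubini_bound R H (fun z => (D * C) * (lor (y - z) * pois (fun t => `|g t|) z)) mH.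
rewrite -[RHS](_ : \int[mu]_z \int[mu]_x H z x = _); last first.
  apply: eq_Rintegral => z _; rewrite RintegralZl//.
  exact: (integrable_kernel z p1 gp mK KC).
rewrite E.
- apply: eq_Rintegral => x _; rewrite -RintegralZl//.
  by apply: eq_Rintegral => z _; rewrite /H mulrCA.
- by move=> z; apply: integrable_mull; exact: (integrable_kernel z p1 gp mK KC).
- move=> x; have := integrable_mull (g x) (iPK x); apply: eq_integrable => // z _.
  by rewrite /H /= mulrCA.
- by apply: integrable_mull; exact: (Lfun_pois_integrable y p1 (Lfun_pois p1 gp)).
- move=> z; rewrite -[\int[mu]_x _](_ : `|P (y - z)| * \int[mu]_x (`|g x| * `|K (x - z)|) = _); last first.
    rewrite -RintegralZl//; first by apply: eq_Rintegral => x _; rewrite /H !normrM.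
    have := integrable_abs (integrable_kernel z p1 gp mK KC).
    by apply: eq_integrable => // x _; rewrite /= normrM.
  have agp : (fun x => `|g x|) \in Lfun mu p%:E.
    by apply: (Lfun_le (C := 1) p1 gp); [exact: measurableT_comp|move=> x; rewrite normr_id mul1r].
  have aKC u : `| `|K u| | <= C * lor u by rewrite normr_id.
  have := kernel_abs_le z p1 agp (measurableT_comp (@normr_measurable R setT) mK) aKC.
  rewrite (_ : pois (fun t => `| `|g t| |) z = pois (fun t => `|g t|) z); last first.
    by congr pois; apply/funext => t; rewrite normr_id.
  move=> /(le_trans (ler_norm _)) h.
  have I0 : 0 <= \int[mu]_x (`|g x| * `|K (x - z)|).
    by apply: Rintegral_ge0 => x _; rewrite mulr_ge0.
  have := ler_pM (normr_ge0 (P (y - z))) I0 (PD (y - z)) h.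
  have -> // : D * C * (lor (y - z) * pois (fun t => `|g t|) z) =
    D * lor (y - z) * (C * pois (fun t => `|g t|) z) by ring.
Qed.

Theorem wendland_convolution_approx (k : nat) : (0 < k)%N -> exists2 C : R, 0 < C &
  forall (p t : R) (f g : R -> R), 1 <= p -> 0 < t -> t <= 1 ->
    f \in Lfun mu p%:E -> g \in Lfun mu p%:E ->
    bessel_potential_of (2 * k + 2)%:R g f ->
    exists G : R -> R, [/\ G \in Lfun mu p%:E,
      forall z, `|G z| <= C / Num.sqrt t * pois (fun x => `|g x|) z &
      {ae mu, forall y, `|f y - \int[mu]_z (wendland1 k (y - z) * G z)|
         <= C * t ^+ k * pois (fun x => `|g x|) y}].
Proof.
move=> k0; have [K0 K00 hK] := @high_frequency_bound R k.
(* The times that occur are [(j + 1) * t] with [j <= k] and [t <= 1], hence at most [k + 1]. *)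
have [C1 C10 hC1] := @bker_factor R k k.+1%:R k0 (ltr0Sn _ _).
have [D D0 hD] := @wendland1_le_lor R k.
(* The terms of positive time move to the other side of the expansion, whence the sign. *)
pose c j : R := - (alt_bin k j.+1 / (2 * pi)).
pose S : R := \sum_(j < k.+1) `|c j|.
have S0 : 0 <= S by apply: sumr_ge0.
have SC := mulr_ge0 S0 (ltW C10).
exists (K0 + S * C1 + 1); first lra.
move=> p t f g p1 t0 t1 fp gp Hfg.
have st : 0 < Num.sqrt t by rewrite sqrtr_gt0.
have /choice[K Kj] : forall j : nat, exists K : R -> R, (j < k.+1)%N ->
  [/\ measurable_fun setT K, forall z, `|K z| <= C1 / Num.sqrt t * lor z &
    forall x, bker k (j.+1%:R * t) x = \int[mu]_z (wendland1 k (x - z) * K z)].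
  (* Outside the range of summation the kernel is a dummy, and nothing is claimed about it. *)
  move=> j; have [jk|jk] := leqP k.+1 j; first by exists (fun=> 0).
  have jt : 0 < j.+1%:R * t by rewrite mulr_gt0.
  have jT : j.+1%:R * t <= k.+1%:R.
    by rewrite -[leRHS]mulr1 ler_pM ?ler_nat// ltW.
  have [K [mK bK eK]] := hC1 _ jt jT; exists K => _; split => // z.
  apply: (le_trans (bK z)); rewrite ler_wpM2r ?lor_ge0// ler_wpM2l ?(ltW C10)//.
  rewrite lef_pV2 ?posrE ?sqrtr_gt0// ler_wsqrtr// ler_peMl// ?ler1n//.
  exact: ltW.
pose u j z := if (j < k.+1)%N then \int[mu]_x (g x * K j (x - z)) else 0.
pose G z := \sum_(j < k.+1) c j * u j z.
have up j : u j \in Lfun mu p%:E.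
  rewrite /u; case: (ltnP j k.+1) => [/Kj[mK bK _]|_]; first exact: (Lfun_kernel p1 gp mK bK).
  have := Lfun_mull 0 p1 gp; rewrite (_ : (fun x => 0 * g x) = (fun=> 0))//.
  by apply/funext => x; rewrite mul0r.
have Gp : G \in Lfun mu p%:E by exact: Lfun_sum.
have pg z : 0 <= pois (fun x => `|g x|) z by apply: pois_ge0.
exists G; split => //.
- move=> z; apply: (@le_trans _ _ (\sum_(j < k.+1) `|c j| * (C1 / Num.sqrt t * pois (fun x => `|g x|) z))).
    apply: (le_trans (ler_norm_sum _ _ _)); apply: ler_sum => j _.
    rewrite normrM ler_wpM2l// /u ltn_ord; have [mK bK _] := Kj _ (ltn_ord j).
    exact: (kernel_abs_le z p1 gp mK bK).
  rewrite -mulr_suml -/S !mulrA; do 2 (rewrite ler_wpM2r ?pg ?invr_ge0 ?sqrtr_ge0//).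
  by have := ltW K00; lra.
have [N [mN N0 sub]] := hK p t f g p1 t0 t1 fp gp Hfg.
exists N; split => //; apply: subset_trans sub; apply: subsetC => y /=.
have -> : f y - \int[mu]_z (wendland1 k (y - z) * G z) =
   f y + \sum_(j < k.+1) alt_bin k j.+1 / (2 * pi) *
                \int[mu]_x (g x * bker k (j.+1%:R * t) (x - y)).
  have iu j : mu.-integrable setT (EFin \o (fun z => wendland1 k (y - z) * u j z)).
    apply: (integrable_le _ (integrable_mull D (integrable_abs (Lfun_pois_integrable y p1 (up j))))) => [|z].
      apply: measurable_funM; last exact: Lfun_measurable (up j).
      by apply: (measurableT_comp (@measurable_wendland1 R k)); exact: measurable_funB.
    by rewrite !normrM mulrA ler_wpM2r// (ger0_norm (lor_ge0 _)).
  have [_] := @Rintegral_lin_comb R setT k.+1 c (fun j z => wendland1 k (y - z) * u j z) measurableT iu.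
  rewrite (_ : (fun x => _) = (fun z => wendland1 k (y - z) * G z)); last first.
    by apply/funext => z; rewrite /G mulr_sumr; apply: eq_bigr => j _; rewrite mulrCA.
  move=> ->; congr (_ + _); rewrite -sumrN; apply: eq_bigr => j _.
  rewrite /c mulNr opprK; congr (_ * _); rewrite /u ltn_ord.
  have [mK bK eK] := Kj _ (ltn_ord j).
  rewrite -(conv_kernel_swap y p1 gp (@measurable_wendland1 R k) mK hD bK).
  apply: eq_Rintegral => x _; congr (_ * _); rewrite eK.
  have mF : measurable_fun setT (fun z : R => wendland1 k (x - y - z) * K j z).
    apply: measurable_funM => //.
    by apply: (measurableT_comp (@measurable_wendland1 R k)); exact: measurable_funB.
  rewrite -(Rintegral_reflect x mF); apply: eq_Rintegral => z _; congr (_ * _).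
  by rewrite wendland1_sym; congr (wendland1 k _); ring.
move=> /le_trans; apply; rewrite ler_wpM2r// ler_wpM2r ?exprn_ge0 ?(ltW t0)//.
by lra.
Qed.

End WendlandConvolution.

(** * Taylor expansions of the Wendland function across its breakpoints *)

Section LocalTaylor.
Context {R : realType}.
Local Notation mu := (@lebesgue_measure R).

Definition posp (y : R) : R := Num.max y 0.

Lemma posp_ge0 (y : R) : 0 <= posp y. Proof. by rewrite le_max lexx orbT. Qed.

Lemma continuous_posp : continuous posp.
Proof.
by move=> r; apply: (@continuous_max R R id (fun=> 0)); [exact: cvg_id|exact: cvg_cst].
Qed.

Lemma continuous_pospX (n : nat) : continuous (fun y => posp y ^+ n).
Proof. by move=> y; exact: (cvg_comp _ _ (continuous_posp (x := y)) (@exprn_continuous R n _)). Qed.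

Lemma eq_antider_ge0 (f P dP : R -> R) (x : R) : continuous f ->
  (forall r : R, is_derive r 1 P (dP r)) -> (forall r, 0 <= r -> dP r = f r) -> 0 <= x ->
  antider f x = P x - P 0.
Proof.
move=> cf hP Pf x0; have d (t : R) := is_derive_antider t cf.
have h1 : antider f x - antider f 0 <= P x - P 0.
  by apply: (le_derive_le x0 d hP) => t /andP[t0 _]; rewrite Pf// ltW.
have h2 : P x - P 0 <= antider f x - antider f 0.
  by apply: (le_derive_le x0 hP d) => t /andP[t0 _]; rewrite Pf// ltW.
by apply/eqP; rewrite eq_le; move: h1 h2; rewrite antider0 subr0 => -> ->.
Qed.

Lemma antider_odd (f : R -> R) (x : R) : continuous f -> (forall t, f (- t) = - f t) ->
  antider f x = antider f `|x|.
Proof.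
move=> cf fN; have [x0|x0] := leP 0 x; first by rewrite ger0_norm.
rewrite ltr0_norm//; have d (t : R) := is_derive_antider t cf.
apply/esym; apply: (@antider_unique _ f (fun t => antider f (- t))) => //; last first.
  by rewrite oppr0 antider0.
move=> t; have dN : is_derive t 1 (fun t : R => - t) (- 1) by apply: (is_derive_eq (is_deriveN (is_derive_id t 1))).
by apply: (is_derive_eq (is_derive_comp dN (d _))); rewrite fN mulrNN mul1r.
Qed.

Lemma is_derive_pospX (n : nat) (y : R) :
  is_derive y 1 (fun y => posp y ^+ n.+2) (n.+2%:R * posp y ^+ n.+1).
Proof.
pose f (y : R) := n.+2%:R * posp y ^+ n.+1.
have cf : continuous f by move=> t; apply: cvgM; [exact: cvg_cst|exact: continuous_pospX].
have E : antider f = (fun y => posp y ^+ n.+2).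
  apply/funext => t; have [t0|t0] := leP 0 t.
    have /(_ t cf) -> // := @eq_antider_ge0 f _ _ _ _ (is_derive_exprn n.+2).
      by rewrite expr0n subr0 /posp max_l.
    by move=> r r0; rewrite /f /posp max_l.
  have d (s : R) := is_derive_antider s cf.
  have [c /andP[tc c0]] := mvt t0 d; rewrite antider0 /f /posp (max_r (ltW c0)).
  rewrite expr0n mulr0 mul0r sub0r => /eqP; rewrite oppr_eq0 => /eqP ->.
  by rewrite max_r ?expr0n// ltW.
by rewrite -E; exact: is_derive_antider.
Qed.

Lemma is_derive_pospX_aff (c s x : R) (n : nat) :
  is_derive x 1 (fun x => posp (c + s * x) ^+ n.+2) (s * (n.+2%:R * posp (c + s * x) ^+ n.+1)).
Proof.
have d : is_derive x 1 (fun x => c + s * x) s.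
  by apply: (is_derive_eq (is_deriveD (is_derive_cst c x 1)
    (is_deriveM (is_derive_cst s x 1) (is_derive_id x 1)))); rewrite /GRing.scale /= /cst; ring.
exact: (is_derive_comp d (is_derive_pospX n _)).
Qed.

(** The coefficients may depend on the base point [a], the constant may not. No derivative of order
    [N] is asked for: a truncated power of exponent [N] satisfies this across its breakpoint. *)
Definition taylor (M : R) (N : nat) (f : R -> R) := exists2 C : R, 0 <= C &
  forall a, `|a| <= M -> exists c : nat -> R,
  forall u, `|u| <= M -> `|f (a + u) - \sum_(i < N) c i * u ^+ i| <= C * `|u| ^+ N.

Lemma taylor_lin (M : R) (N : nat) (f g : R -> R) (b : R) : taylor M N f -> taylor M N g ->
  taylor M N (fun x => b * f x + g x).
Proof.
move=> [C C0 hf] [D D0 hg]; exists (`|b| * C + D); first by rewrite addr_ge0// mulr_ge0.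
move=> a aM; have [c hc] := hf a aM; have [d hd] := hg a aM.
exists (fun i => b * c i + d i) => u uM.
have -> : b * f (a + u) + g (a + u) - \sum_(i < N) (b * c i + d i) * u ^+ i =
   b * (f (a + u) - \sum_(i < N) c i * u ^+ i) + (g (a + u) - \sum_(i < N) d i * u ^+ i).
  rewrite [\sum_(i < N) (_ + _) * _](eq_bigr (fun i : 'I_N => b * (c i * u ^+ i) + d i * u ^+ i)).
    by rewrite big_split/= -mulr_sumr; ring.
  by move=> i _; ring.
apply: (le_trans (ler_normD _ _)); rewrite normrM mulrDl -mulrA.
by rewrite lerD ?hd// ler_wpM2l// hc.
Qed.

Lemma taylor_derive (M : R) (N : nat) (f h : R -> R) : (forall x : R, is_derive x 1 f (h x)) ->
  taylor M N h -> taylor M N.+1 f.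
Proof.
move=> df [C C0 H]; exists C => // a aM; have [c hc] := H a aM.
pose c' i := if i is i'.+1 then c i' / i'.+1%:R else f a.
exists c' => u uM.
pose F (v : R) := f (a + v) - \sum_(i < N) c i / i.+1%:R * v ^+ i.+1.
pose G (v : R) := h (a + v) - \sum_(i < N) c i * v ^+ i.
have dF (v : R) : is_derive v 1 F (G v).
  have d1 : is_derive v 1 (fun v => f (a + v)) (h (a + v)).
    by apply: (is_derive_eq (is_derive_comp (is_derive_addl a v) (df _))); rewrite mul1r.
  have d2 : is_derive v 1 (fun v => \sum_(i < N) c i / i.+1%:R * v ^+ i.+1) (\sum_(i < N) c i * v ^+ i).
    rewrite (_ : (fun v => _) = \sum_(i < N) (fun v => c i / i.+1%:R * v ^+ i.+1)); last first.
      by apply/funext => t; rewrite fct_sumE.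
    apply: is_derive_sum => i.
    apply: (is_derive_eq (is_deriveM (is_derive_cst (c i / i.+1%:R : R) v 1) (is_derive_exprn i.+1 v))).
    by rewrite /GRing.scale /= /cst mulr0 addr0 mulrA divfK.
  exact: (is_deriveB d1 d2).
have -> : f (a + u) - \sum_(i < N.+1) c' i * u ^+ i = F u - F 0.
  rewrite big_ord_recl (eq_bigr (fun i : 'I_N => c i / i.+1%:R * u ^+ i.+1))//.
  rewrite /= expr0 mulr1 /F addr0 [X in _ = _ - (_ - X)]big1; first by ring.
  by move=> i _; rewrite expr0n mulr0.
have b B v : `|v| <= B -> B <= M -> `|G v| <= C * B ^+ N.
  move=> vB BM; apply: (le_trans (hc v (le_trans vB BM))).
  by rewrite ler_wpM2l// lerXn2r ?nnegrE ?(le_trans _ vB).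
have [u0|u0] := leP 0 u.
  rewrite (ger0_norm u0) in uM *.
  apply: (le_trans (mvt_abs_le u0 dF (B := C * u ^+ N) _)).
    by move=> x /andP[x0 xu]; apply: b => //; rewrite ger0_norm.
  by rewrite subr0 exprSr mulrA.
rewrite (ltr0_norm u0) in uM *; rewrite distrC.
apply: (le_trans (mvt_abs_le (ltW u0) dF (B := C * (- u) ^+ N) _)).
  by move=> x /andP[x0 xu]; apply: b => //; rewrite ler0_norm// lerN2.
by rewrite sub0r exprSr mulrA.
Qed.

Lemma taylor0 (M : R) (f : R -> R) (B : R) : (forall x, `|x| <= M + M -> `|f x| <= B) -> 0 <= M ->
  taylor M 0 f.
Proof.
move=> fB M0; exists B; first by apply: le_trans (fB 0 _); rewrite ?normr0 ?addr_ge0.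
move=> a aM; exists (fun=> 0) => u uM; rewrite big_ord0 subr0 expr0 mulr1.
by rewrite fB// (le_trans (ler_normD _ _))// lerD.
Qed.

Lemma taylor_pow (M : R) (N n : nat) : 0 <= M -> taylor M N (fun x => x ^+ n).
Proof.
move=> M0; elim: N n => [|N ih] n.
  apply: (@taylor0 _ _ ((M + M) ^+ n)) => // x xM.
  by rewrite normrX lerXn2r ?nnegrE ?addr_ge0.
apply: (@taylor_derive M N _ (fun x => n%:R * x ^+ n.-1)); first by move=> x; exact: is_derive_exprn.
have [C C0 h] := @taylor_lin M N (fun x => x ^+ n.-1) (fun x => x ^+ n.-1) (n%:R - 1) (ih n.-1) (ih n.-1).
exists C => // a aM; have [c hc] := h a aM; exists c => u uM.
by rewrite (_ : n%:R * _ = (n%:R - 1) * (a + u) ^+ n.-1 + (a + u) ^+ n.-1) ?hc//; ring.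
Qed.

Lemma taylor_scale (M : R) (N : nat) (f : R -> R) (b : R) : 0 <= M -> taylor M N f ->
  taylor M N (fun x => b * f x).
Proof.
move=> M0 h; have [C C0 H] := taylor_lin b h (taylor_lin (-1) (taylor_pow N 0 M0) (taylor_pow N 0 M0)).
exists C => // a aM; have [c hc] := H a aM; exists c => u uM.
by rewrite (_ : b * _ = b * f (a + u) + (-1 * (a + u) ^+ 0 + (a + u) ^+ 0)) ?hc//; ring.
Qed.

Lemma taylor_pospX (M c s : R) (N n : nat) : 0 <= M -> `|s| <= 1 -> (N <= n)%N ->
  taylor M N (fun x => posp (c + s * x) ^+ n).
Proof.
move=> M0 s1; elim: N n => [|N ih] n Nn.
  apply: (@taylor0 _ _ ((`|c| + (M + M)) ^+ n)) => // x xM.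
  rewrite normrX lerXn2r ?nnegrE ?addr_ge0// ger0_norm ?posp_ge0//.
  rewrite /posp ge_max; apply/andP; split; last by rewrite !addr_ge0.
  apply: (le_trans (ler_norm _)); apply: (le_trans (ler_normD _ _)); rewrite lerD2l normrM.
  by rewrite -[leRHS]mul1r ler_pM.
(* A truncated power of exponent 1 is not differentiable at its breakpoint, but order 1 only asks
   for a Lipschitz bound. *)
case: n Nn => [//|[|n]] Nn.
  have -> : N = 0%N by lia.
  exists 1 => // a aM; exists (fun=> posp (c + s * a)) => u uM.
  rewrite big_ord1 !expr1 expr0 mulr1 mul1r /posp.
  have su : `|s * u| <= `|u| by rewrite normrM ler_piMl.
  have := ler_norm u; have := ler_norm (- u); rewrite normrN => h1 h2.
  move: su; rewrite mulrDr; move: (s * a) (s * u) => p q; rewrite !ler_norml => /andP[q1 q2].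
  by case: (leP (c + (p + q)) 0); case: (leP (c + p) 0) => *; apply/andP; split; lra.
apply: (@taylor_derive M N _ (fun x => s * (n.+2%:R * posp (c + s * x) ^+ n.+1))).
  by move=> x; exact: is_derive_pospX_aff.
by do 2 apply: taylor_scale => //; exact: ih.
Qed.

(* [n] is the order of the breakpoint at [0], [m] that of the breakpoints [-1] and [1]. *)
Inductive spline (n m : nat) : (R -> R) -> Prop :=
| spline_pow i : spline n m (fun x => x ^+ i)
| spline_mid s i : s ^+ 2 = 1 -> (n <= i)%N -> spline n m (fun x => posp (0 + s * x) ^+ i)
| spline_end s i : s ^+ 2 = 1 -> (m <= i)%N -> spline n m (fun x => posp (1 + s * x) ^+ i)
| spline_lin b f g : spline n m f -> spline n m g -> spline n m (fun x => b * f x + g x).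

Lemma taylor_spline (M : R) (n m N : nat) f : 0 <= M -> (N <= n)%N -> (N <= m)%N ->
  spline n m f -> taylor M N f.
Proof.
move=> M0 Nn Nm; have s1 s : s ^+ 2 = 1 -> `|s| <= 1 :> R.
  by move=> s2; rewrite -(@ler_sqr R) ?nnegrE// real_normK ?num_real// s2 expr1n.
elim=> [i|s i s2 ni|s i s2 ni|b f1 g1 _ h1 _ h2].
- exact: taylor_pow.
- by apply: taylor_pospX; rewrite ?s1//; exact: leq_trans ni.
- by apply: taylor_pospX; rewrite ?s1//; exact: leq_trans ni.
- exact: taylor_lin.
Qed.

Lemma spline_scale (n m : nat) (b : R) f : spline n m f -> spline n m (fun x => b * f x).
Proof.
move=> h; have := spline_lin b h (spline_lin (-1) (spline_pow n m 0) (spline_pow n m 0)).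
by congr spline; apply/funext => x; ring.
Qed.

Lemma spline_sum (n m N : nat) (b : nat -> R) (f : nat -> R -> R) :
  (forall i, (i < N)%N -> spline n m (f i)) -> spline n m (fun x => \sum_(i < N) b i * f i x).
Proof.
elim: N => [|N ih] h.
  have := spline_scale 0 (spline_pow n m 0).
  by congr spline; apply/funext => x; rewrite big_ord0 mul0r.
have := spline_lin (b N) (h N (ltnSn N)) (ih (fun i iN => h i (ltnW iN))).
by congr spline; apply/funext => x; rewrite big_ord_recr /= addrC.
Qed.

Lemma posp_exprS (y : R) (i : nat) : (0 < i)%N -> posp y ^+ i.+1 = y * posp y ^+ i.
Proof.
case: i => // i _; rewrite /posp; case: (leP y 0) => y0; last by rewrite exprS.
by rewrite !expr0n mulr0.
Qed.

(** At the breakpoint 0 the factor [x] raises the order by one and the integration by another; at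
    the breakpoints -1 and 1 only the integration counts. *)
Lemma spline_prim (n m : nat) f : (0 < n)%N -> (0 < m)%N -> spline n m f ->
  exists2 F, spline n.+2 m.+1 F & forall x : R, is_derive x 1 F (- (x * f x)).
Proof.
move=> n0 m0; elim=> [i|s i s2 ni|s i s2 ni|b f1 g1 _ [F hF dF] _ [G hG dG]].
- exists (fun x => - i.+2%:R^-1 * x ^+ i.+2); first by apply: spline_scale; exact: spline_pow.
  move=> x; apply: (is_derive_eq (is_deriveM (is_derive_cst (- i.+2%:R^-1 : R) x 1) (is_derive_exprn i.+2 x))).
  by rewrite /GRing.scale /= /cst mulr0 addr0 mulrA mulNr mulVf// mulN1r exprS.
- exists (fun x => - i.+2%:R^-1 * posp (0 + s * x) ^+ i.+2).
    by apply: spline_scale; exact: spline_mid.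
  move=> x; apply: (is_derive_eq (is_deriveM (is_derive_cst (- i.+2%:R^-1 : R) x 1) (is_derive_pospX_aff 0 s x i))).
  rewrite /GRing.scale /= /cst mulr0 addr0 posp_exprS ?(leq_trans n0)// add0r mulrCA mulNr mulKf//.
  by rewrite mulrN !mulrA -expr2 s2 mul1r.
- case: i ni => [|i ni]; first by case: m m0.
  (* Since [s ^ 2 = 1], the factor is [x = s * ((1 + s * x) - 1)], which yields one power of each
     exponent. *)
  exists (fun x => - i.+3%:R^-1 * posp (1 + s * x) ^+ i.+3 + i.+2%:R^-1 * posp (1 + s * x) ^+ i.+2).
    apply: spline_lin; first by apply: spline_end => //; lia.
    by apply: spline_scale; apply: spline_end => //; lia.
  move=> x; apply: (is_derive_eq (is_deriveD
    (is_deriveM (is_derive_cst (- i.+3%:R^-1 : R) x 1) (is_derive_pospX_aff 1 s x i.+1))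
    (is_deriveM (is_derive_cst (i.+2%:R^-1 : R) x 1) (is_derive_pospX_aff 1 s x i)))).
  rewrite /GRing.scale /= /cst !mulr0 !addr0 posp_exprS// !(mulrCA _ s) mulNr !mulKf//.
  by rewrite (_ : - (x * _) = - (s ^+ 2 * x * posp (1 + s * x) ^+ i.+1)); [ring|rewrite s2; ring].
- exists (fun x => b * F x + G x); first exact: spline_lin.
  move=> x; apply: (is_derive_eq (is_deriveD (is_deriveM (is_derive_cst b x 1) (dF x)) (dG x))).
  by rewrite /GRing.scale /= /cst; ring.
Qed.

(* [(1 - |x|)_+ ^ n = (1 - x)_+ ^ n + (1 + x)_+ ^ n - (1 + |x|) ^ n]. *)
Lemma spline_wend0 (k : nat) : spline 1 k.+1 (fun x => wend k 0 `|x|).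
Proof.
have -> : (fun x => wend k 0 `|x|) = (fun x : R => -1 * (\sum_(i < k.+2) 'C(k.+1, i)%:R *
    (if (i : nat) is j.+1 then 1 * posp (0 + 1 * x) ^+ j.+1 + posp (0 + -1 * x) ^+ j.+1 else x ^+ 0))
    + (1 * posp (1 + 1 * x) ^+ k.+1 + posp (1 + -1 * x) ^+ k.+1)).
  apply/funext => x; rewrite (eq_bigr (fun i : 'I_k.+2 => 1 ^+ (k.+1 - i) * `|x| ^+ i *+ 'C(k.+1, i))).
    rewrite -exprDn /wend /= /trunc_power /posp !mulN1r !mul1r.
    case: (leP 0 x) => x0.
      rewrite ger0_norm// (max_l (_ : 0 <= 1 + x)); last lra.
      by ring.
    rewrite ltr0_norm// (max_l (_ : 0 <= 1 - x)) ?opprK; last lra.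
    by ring.
  case=> [[|i] ik] _ /=; first by rewrite bin0 !expr0 expr1n !mulr1 mulr1n.
  rewrite expr1n !mul1r !add0r mulN1r -[RHS]mulr_natl /posp; congr (_ * _).
  case: (leP 0 x) => x0; first by rewrite (max_r (_ : - x <= 0)) ?oppr_le0// expr0n addr0 ger0_norm.
  by rewrite (max_l (_ : 0 <= - x)) ?oppr_ge0 ?(ltW x0)// expr0n add0r ltr0_norm.
have n1 : (-1) ^+ 2 = 1 :> R by rewrite sqrrN expr1n.
have p1 : 1 ^+ 2 = 1 :> R by rewrite expr1n.
apply: spline_lin; last by apply: spline_lin; exact: spline_end.
apply: (@spline_sum 1 k.+1 k.+2 (fun i => 'C(k.+1, i)%:R) (fun i x =>
   if i is j.+1 then 1 * posp (0 + 1 * x) ^+ j.+1 + posp (0 + -1 * x) ^+ j.+1 else x ^+ 0)).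
by case=> [|i] _; [exact: spline_pow|apply: spline_lin; exact: spline_mid].
Qed.

(** The initial function has order 1 at 0 and [k + 1] at the ends of its support. Gaining two and
    one per integration, both orders become [2 k + 1] after [k] steps. *)
Lemma spline_wend (k j : nat) : spline (j.*2.+1) (k.+1 + j) (fun x => wend k j `|x|).
Proof.
elim: j => [|j ih]; first by rewrite addn0; exact: spline_wend0.
have [//|//|F hF dF] := spline_prim _ _ ih.
have [cj zj pj dj] := @wend_props R k j.
pose f (x : R) := - (x * wend k j `|x|).
have cf : continuous f.
  move=> x; apply: cvgN; apply: cvgM; first exact: cvg_id.
  exact: (cvg_comp _ _ (@norm_continuous _ R x) (cj _)).
have E x : wend k j.+1 `|x| = F x + (wend k j.+1 0 - F 0).
  have -> : F x = antider f x + F 0.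
    have d (y : R) : is_derive y 1 (fun x => F x - F 0) (f y).
      by apply: (is_derive_eq (is_deriveB (dF y) (is_derive_cst (F 0) y 1))); rewrite subr0.
    by rewrite -(antider_unique cf d) ?subrK ?subrr.
  rewrite antider_odd//; last by move=> t; rewrite /f normrN mulNr.
  rewrite (eq_antider_ge0 cf dj) ?normr_ge0//; first by ring.
  by move=> r r0; rewrite /f ger0_norm.
rewrite addnS doubleS (funext E).
have := spline_lin 1 hF (spline_scale (wend k j.+1 0 - F 0) (spline_pow j.*2.+3 (k.+1 + j).+1 0)).
by congr spline; apply/funext => x; ring.
Qed.

Theorem taylor_wendland1 (k : nat) (M : R) : 0 <= M -> taylor M k.*2.+1 (wendland1 k).
Proof.
by move=> M0; apply: (taylor_spline M0 _ _ (spline_wend k k)) => //; rewrite -addnn.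
Qed.

End LocalTaylor.

(** * Local Lagrange interpolation of translates *)

Section LocalInterpolation.
Context {R : realType}.
Local Notation mu := (@lebesgue_measure R).

Definition lweight (N : nat) (x : nat -> R) (i : 'I_N) (z : R) : R := (tnth (lagrange N x) i).[z].

(** Interpolation is exact on the polynomial [v |-> \sum_m c m * (z - v) ^ m], of degree below [N],
    whose value at [v = z] is [c 0]. *)
Lemma lweight_reproduce (N : nat) (x c : nat -> R) (z : R) : (0 < N)%N -> injective x ->
  \sum_(i < N) lweight x i z * (\sum_(m < N) c m * (z - x i) ^+ m) = c 0%N.
Proof.
move=> N0 xI; pose p := (\poly_(m < N) c m) \Po (z%:P - 'X).
have pE v : p.[v] = \sum_(m < N) c m * (z - v) ^+ m.
  by rewrite /p horner_comp !hornerE horner_poly.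
have sp : (size p <= N)%N.
  by rewrite /p size_comp_poly2 ?size_poly// -opprB size_polyN size_XsubC.
have := congr1 (fun q => q.[z]) (lagrange_gen N0 xI sp).
rewrite horner_sum pE => E.
transitivity (\sum_(i < N) (p.[x i]%:P * tnth (lagrange N x) i).[z]).
  by apply: eq_bigr => i _; rewrite hornerCM pE /lweight mulrC.
rewrite -E; case: N N0 {p pE sp E} => // N _.
rewrite big_ord_recl subrr expr0 mulr1 big1 ?addr0// => i _.
by rewrite expr0n mulr0.
Qed.

Lemma lweight_abs_le (N : nat) (x : nat -> R) (z B d : R) (i : 'I_N) : injective x -> 0 < d ->
  (forall j, (j < N)%N -> `|z - x j| <= B) ->
  (forall j, (j < N)%N -> j != i -> d <= `|x i - x j|) ->
  `|lweight x i z| <= (B / d) ^+ N.-1.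
Proof.
move=> xI d0 zB xd; have N0 : (0 < N)%N by apply: leq_ltn_trans (ltn_ord i).
rewrite /lweight lagrangeE// hornerCM !horner_prod -prodfV -big_split/= normr_prod.
have -> : (B / d) ^+ N.-1 = \prod_(j < N | j != i) (B / d).
  by rewrite prodr_const cardC1 card_ord.
apply: ler_prod => j ji; rewrite normr_ge0/= !hornerXsubC normrM mulrC normfV.
have dx := xd _ (ltn_ord j) ji.
by rewrite ler_pM ?invr_ge0 ?zB// lef_pV2 ?posrE ?(lt_le_trans d0).
Qed.

Lemma measurable_lweight (N : nat) (x : nat -> R) (i : 'I_N) :
  measurable_fun setT (lweight x i).
Proof. by apply: continuous_measurable_fun => z; exact: continuous_horner. Qed.

(** Expand the Wendland function at [y - z] with increments [z - x i]: the polynomial part is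
    reproduced exactly, so only the remainders, weighted by the Lagrange basis, are left. The
    weights are products of quotients at most [4 (N + 1) h / (2 h)]. *)
Theorem local_interpolation_error (k : nat) : exists2 C : R, 0 < C &
  forall (h : R) (x : nat -> R) (y z : R), 0 < h -> h <= 1 -> injective x ->
  let N := k.*2.+1 in
  (forall j, (j < N)%N -> `|z - x j| <= 4 * N.+1%:R * h) ->
  (forall i j, (i < N)%N -> (j < N)%N -> i != j -> 2 * h <= `|x i - x j|) ->
  (forall i : 'I_N, `|lweight x i z| <= (2 * N.+1%:R) ^+ N.-1) /\
  `|wendland1 k (y - z) - \sum_(i < N) lweight x i z * wendland1 k (y - x i)|
    <= C * h ^+ N * lor (y - z).
Proof.
pose N := k.*2.+1; pose r : R := 4 * N.+1%:R; pose L : R := (2 * N.+1%:R) ^+ N.-1.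
have r0 : 0 < r by rewrite mulr_gt0.
have M0 : 0 <= 1 + r by lra.
have L0 : 0 <= L by rewrite exprn_ge0// mulr_ge0.
have [D D0 hD] := @taylor_wendland1 R k _ M0.
pose E := N%:R * (L * (D * r ^+ N)).
have E0 : 0 <= E by rewrite /E !mulr_ge0 ?exprn_ge0// ltW.
exists (E * (1 + (1 + r) ^+ 2) + 1).
  by rewrite ltr_wpDl// mulr_ge0// addr_ge0// sqr_ge0.
move=> h x y z h0 h1 xI N' zx xx; subst N'; rewrite -/N in zx xx *.
have hw (i : 'I_N) : `|lweight x i z| <= L.
  have h20 : 0 < 2 * h by lra.
  apply: (le_trans (@lweight_abs_le N x z (r * h) (2 * h) i xI h20 zx _)).
    by move=> j jN ji; apply: xx; rewrite // eq_sym.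
  rewrite /L (_ : r * h / (2 * h) = 2 * N.+1%:R)// /r.
  by field; rewrite gt_eqF.
split=> //.
have C0 : 0 <= (E * (1 + (1 + r) ^+ 2) + 1) * h ^+ N * lor (y - z).
  rewrite mulr_ge0 ?lor_ge0// mulr_ge0 ?exprn_ge0 ?(ltW h0)//.
  by rewrite addr_ge0// mulr_ge0// addr_ge0// sqr_ge0.
have zr j : (j < N)%N -> `|z - x j| <= r.
  by move=> /zx /le_trans; apply; rewrite -/r ler_piMr// ltW.
(* Beyond [1 + r] all the translates vanish at [y]; within it [lor (y - z)] is bounded below and can
   be inserted. *)
have [yz|yz] := leP (1 + r) `|y - z|.
  rewrite wendland1_eq0; last by lra.
  rewrite big1 ?subrr ?normr0// => i _.
  rewrite wendland1_eq0 ?mulr0//.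
  have := zr i (ltn_ord i); have := ler_normD (y - x i) (x i - z).
  by rewrite addrA subrK [`|x i - z|]distrC; lra.
have [c hc] := hD _ (ltW yz).
have c0 : wendland1 k (y - z) = c 0%N.
  have := hc 0; rewrite normr0 addr0 expr0n mulr0 normr_le0 subr_eq0 => /(_ M0)/eqP ->.
  by rewrite big_ord_recl expr0 mulr1 big1 ?addr0// => i _; rewrite expr0n mulr0.
rewrite c0 -(@lweight_reproduce N x c z)// -sumrB.
apply: (@le_trans _ _ (E * h ^+ N)).
  apply: (le_trans (ler_norm_sum _ _ _)).
  apply: (@le_trans _ _ (\sum_(i < N) (L * (D * r ^+ N * h ^+ N)))); last first.
    by rewrite sumr_const card_ord -[leLHS]mulr_natl /E !mulrA.
  apply: ler_sum => i _; rewrite -mulrBr normrM ler_pM// distrC.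
  have ur : `|z - x i| <= 1 + r by have := zr i (ltn_ord i); lra.
  have := hc _ ur; rewrite addrA subrK => /le_trans; apply.
  rewrite -mulrA ler_wpM2l// -exprMn lerXn2r ?nnegrE ?mulr_ge0 ?(ltW r0) ?(ltW h0)//.
  exact: zx.
rewrite -[leRHS]mulrA [h ^+ N * _]mulrC mulrA ler_wpM2r ?exprn_ge0 ?(ltW h0)//.
have l1 : 1 <= (1 + (1 + r) ^+ 2) * lor (y - z).
  rewrite -[leLHS](lorV (y - z)) ler_wpM2r ?lor_ge0// lerD2l -[leLHS]real_normK ?num_real//.
  by rewrite lerXn2r ?nnegrE// ltW.
have := lor_ge0 (y - z); nra.
Qed.

End LocalInterpolation.

(** * Building elements of the shift space *)

Section ShiftSpace.
Context {R : realType}.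
Local Notation mu := (@lebesgue_measure R).
Context (Phi : R -> R) (X : set R).
Context (Phi1 : Phi \in Lfun mu 1).

Lemma shift_space0 : shift_space Phi X (fun=> 0).
Proof.
split.
  have := @Lfun_mull R 1 0 Phi (lexx _) Phi1.
  by rewrite (_ : (fun x => _) = (fun=> 0))//; apply/funext => x; rewrite mul0r.
exists set0, (fun=> 0); split => //.
by apply/funext => x; rewrite fsbig_set0.
Qed.

(** The centre [x] may already belong to [Y], so the coefficients are added instead of listed. *)
Lemma shift_space_add_term (b x : R) (S : R -> R) : X x -> shift_space Phi X S ->
  shift_space Phi X (fun y => S y + b * Phi (y - x)).
Proof.
move=> Xx [S1 [Y [a [fY YX SE]]]]; split.
  apply: (@Lfun_add R 1) => //; apply: (@Lfun_mull R 1) => //.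
  exact: (@Lfun_comp_shift R 1 (- x) Phi (lexx _) Phi1).
pose a' (z : R) := (if z \in Y then a z else 0) + (if z == x then b else 0).
exists (Y `|` [set x]), a'; split.
- by rewrite finite_setU; split.
- by move=> z [/YX//|->].
apply/funext => y; rewrite SE.
have fU : finite_set (Y `|` [set x]) by rewrite finite_setU; split.
rewrite [RHS](eq_fsbigr (fun z => (if z \in Y then a z else 0) * Phi (y - z) +
   (if z == x then b else 0) * Phi (y - z))); last by move=> z _; rewrite /a' mulrDl.
rewrite fsbig_split//=; congr (_ + _).
- rewrite -(fsbig_widen Y (Y `|` [set x])); first last.
  + by move=> z /= [_ nY]; rewrite memNset// mul0r.
  + by move=> z Yz; left.
  by apply: eq_fsbigr => z zY; rewrite zY.
- rewrite -(fsbig_widen [set x] (Y `|` [set x])); first last.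
  + by move=> z /= [_ /eqP/negPf ->]; rewrite mul0r.
  + by move=> z Yz; right.
  by rewrite fsbig_set1 eqxx.
Qed.

Lemma shift_space_add_sum (N : nat) (b x : nat -> R) (S : R -> R) :
  (forall i, X (x i)) -> shift_space Phi X S ->
  shift_space Phi X (fun y => S y + \sum_(i < N) b i * Phi (y - x i)).
Proof.
move=> Xx hS; elim: N => [|N ih].
  by rewrite (_ : (fun y => _) = S)//; apply/funext => y; rewrite big_ord0 addr0.
have := shift_space_add_term (b N) (Xx N) ih.
by congr shift_space; apply/funext => y; rewrite big_ord_recr addrA.
Qed.

Lemma shift_space_sum2 (m N : nat) (b : nat -> nat -> R) (x : nat -> R) :
  (forall i, X (x i)) ->
  shift_space Phi X (fun y => \sum_(n < m) \sum_(i < N) b n i * Phi (y - x (n + i)%N)).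
Proof.
move=> Xx; elim: m => [|m ih].
  have := shift_space0; congr shift_space.
  by apply/funext => y; rewrite big_ord0.
have := @shift_space_add_sum N (b m) (fun i => x (m + i)%N) _ (fun i => Xx _) ih.
by congr shift_space; apply/funext => y; rewrite big_ord_recr.
Qed.

End ShiftSpace.

(** * Quadrature of the convolution on cells *)

Section Quadrature.
Context {R : realType}.
Local Notation mu := (@lebesgue_measure R).

(** Half-open, so that consecutive cells tile an interval without overlap. *)
Definition icell (a b : R) : R -> R := \1_([set` `[a, b[%R] : set R).

Lemma icellE (a b z : R) : icell a b z = (a <= z < b)%R%:R.
Proof. by rewrite /icell indicE mem_setE in_itv. Qed.

Lemma measurable_icell (a b : R) : measurable_fun setT (icell a b).
Proof. by apply: measurable_indic; exact: measurable_itv. Qed.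

Lemma sum_icell (a s z : R) (m : nat) : 0 <= s ->
  \sum_(n < m) icell (a + s * n%:R) (a + s * n.+1%:R) z = icell a (a + s * m%:R) z.
Proof.
move=> s0; elim: m => [|m ih].
  by rewrite big_ord0 mulr0 addr0 icellE; case: ltP => // za; rewrite (lt_geF za).
rewrite big_ord_recr /= ih !icellE.
have h1 : a <= a + s * m%:R by rewrite lerDl mulr_ge0.
have h2 : a + s * m%:R <= a + s * m.+1%:R by rewrite lerD2l ler_wpM2l// ler_nat.
have [am|am] := leP (a + s * m%:R) z.
  by rewrite (le_trans h1 am) andbF add0r.
by rewrite andbT addr0 (lt_le_trans am h2) andbT.
Qed.

Lemma wendland1_Lfun1 (k : nat) : @wendland1 R k \in Lfun mu 1.
Proof. by rewrite Lfun1_integrable; exact: integrable_wendland1. Qed.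

Lemma spaced_nodes (h b : R) (xi : nat -> R) : 0 < h ->
  (forall n, `|b + 4 * h * n%:R - xi n| < h) ->
  forall i j : nat, i != j -> 2 * h <= `|xi i - xi j|.
Proof.
move=> h0 H i j ij; wlog : i j ij / (i < j)%N => [W|ltij].
  case: (ltnP i j) => [/W->//|]; rewrite leq_eqVlt eq_sym (negPf ij)/= => ji.
  by rewrite distrC; apply: W => //; rewrite eq_sym.
have e : 1 <= j%:R - i%:R :> R by rewrite lerBrDl natr1 ler_nat.
have := H i; have := H j; rewrite !ltr_norml => /andP[j1 j2] /andP[i1 i2].
rewrite distrC; apply: le_trans (ler_norm _).
have : 4 * h * 1 <= 4 * h * (j%:R - i%:R) by rewrite ler_wpM2l//; lra.
by lra.
Qed.

(** The nodes of cell [n] are points of [X] chosen near the left ends of the [2 k + 1] cells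
    starting with it, and a coefficient is the integral over the cell of [G] times the Lagrange
    weight. Inside the window of [m] cells the error is that of interpolation; outside, the kernel
    itself is bounded by a multiple of [lor]. *)
Theorem wendland_quadrature (k : nat) : exists2 C : R, 0 < C &
  forall (h p b : R) (X : set R) (G : R -> R) (m : nat), 0 < h -> h <= 1 -> 1 <= p ->
  (forall x, exists2 xi, X xi & `|x - xi| < h) -> G \in Lfun mu p%:E ->
  exists2 S, shift_space (wendland1 k) X S & forall y,
    `|\int[mu]_z (wendland1 k (y - z) * G z) - S y| <=
      C * h ^+ k.*2.+1 * pois (fun z => `|G z|) y +
      C * pois (fun z => `|(1 - icell b (b + 4 * h * m%:R) z) * G z|) y.
Proof.
have [C C0 hC] := @local_interpolation_error R k.
have [D D0 hD] := @wendland1_le_lor R k.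
exists (C + D); first exact: addr_gt0.
move=> h p b X G m h0 h1 p1 cover Gp; pose N := k.*2.+1.
have /choice[xi hxi] : forall n : nat, exists xi, X xi /\ `|b + 4 * h * n%:R - xi| < h.
  by move=> n; have [xi] := cover (b + 4 * h * n%:R); exists xi.
have Xxi n : X (xi n) := (hxi n).1.
have near_xi n := (hxi n).2.
have sep := spaced_nodes h0 near_xi.
have xiI : injective xi.
  move=> i j E; apply/eqP; case: eqVneq => // /sep.
  by rewrite E subrr normr0; lra.
pose x n j := xi (n + j)%N.
have xI n : injective (x n) by move=> i j /xiI/addnI.
pose I n : R -> R := icell (b + 4 * h * n%:R) (b + 4 * h * n.+1%:R).
(* The farthest node lies [N - 1] cells to the right, up to a deviation below [h]: this is the
   source of the distance [4 (N + 1) h]. *)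
have cellP n z : I n z = 0 \/ (I n z = 1 /\ forall j, (j < N)%N -> `|z - x n j| <= 4 * N.+1%:R * h).
  rewrite /I icellE; case: (boolP (_ <= _ < _)) => [/andP[z1 z2]|_]; last by left.
  right; split=> // j jN; have := near_xi (n + j)%N; rewrite -/(x n j) natrD.
  have jr : 1 + j%:R <= N%:R :> R by rewrite nat1r ler_nat.
  have h4 : 4 * h * (1 + j%:R) <= 4 * h * N%:R by rewrite ler_wpM2l//; lra.
  have j0 : 0 <= 4 * h * j%:R by rewrite !mulr_ge0// ltW.
  move: z2; rewrite -(natr1 n) -(natr1 N) ltr_norml => z2 /andP[e1 e2].
  move: (N%:R) jr h4 => Nr jr h4.
  by rewrite ler_norml; apply/andP; split; lra.
have err n z y : I n z != 0 -> (forall i : 'I_N, `|lweight (x n) i z| <= (2 * N.+1%:R) ^+ N.-1) /\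
   `|wendland1 k (y - z) - \sum_(i < N) lweight (x n) i z * wendland1 k (y - x n i)|
      <= C * h ^+ N * lor (y - z).
  case: (cellP n z) => [->|[_ zc] _]; first by rewrite eqxx.
  apply: (hC h (x n) y z h0 h1 (xI n)) => //.
  by move=> i j _ _ ij; apply: sep; rewrite eqn_add2l.
have mG := Lfun_measurable Gp.
(* [inord] extends the weights to all naturals, the form in which linear combinations are
   integrated; only [i < N] is summed. *)
pose L n (i : nat) z := lweight (x n) (inord i : 'I_N) z.
pose w n (i : nat) z : R := I n z * (L n i z * G z).
pose bb n i := \int[mu]_z w n i z.
have mI n : measurable_fun setT (I n) := measurable_icell _ _.
have iIG n : mu.-integrable setT (EFin \o (fun z => I n z * G z)).
  pose A := [set` `[b + 4 * h * n%:R, b + 4 * h * n.+1%:R[%R] : set (measurableTypeR R).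
  have mA : measurable A by exact: measurable_itv.
  apply: (integrable_indic mA); apply: (integrable_Lfun_bounded p1 Gp mA).
  by rewrite lebesgue_measure_itv /=; case: ifP => _; rewrite -?EFinB ltry.
have iw n i : mu.-integrable setT (EFin \o w n i).
  apply: (integrable_le _ (integrable_mull ((2 * N.+1%:R) ^+ N.-1) (integrable_abs (iIG n)))) => [|z].
    by apply: measurable_funM => //; apply: measurable_funM => //; exact: measurable_lweight.
  rewrite /w mulrCA normrM; have [->|In] := eqVneq (I n z) 0.
    by rewrite !mul0r normr0 !mulr0.
  by rewrite ler_wpM2r//; have [hw _] := err n z 0 In; exact: hw.
exists (fun y => \sum_(n < m) \sum_(i < N) bb n i * wendland1 k (y - xi (n + i)%N)).
  exact: (shift_space_sum2 (@wendland1_Lfun1 k) m N bb Xxi).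
move=> y; set P := wendland1 k.
pose s n z := \sum_(i < N) P (y - x n i) * w n i z.
have sP n : mu.-integrable setT (EFin \o s n) /\
    \int[mu]_z s n z = \sum_(i < N) P (y - x n i) * bb n i.
  exact: (@Rintegral_lin_comb R setT N (fun i => P (y - x n i)) (w n) measurableT (iw n)).
have [iS ES] := @Rintegral_lin_comb R setT m (fun=> 1) s measurableT (fun n => (sP n).1).
have -> : \sum_(n < m) \sum_(i < N) bb n i * P (y - xi (n + i)%N) =
    \int[mu]_z (\sum_(n < m) 1 * s n z).
  rewrite ES; apply: eq_bigr => n _; rewrite mul1r (sP n).2.
  by apply: eq_bigr => i _; rewrite mulrC.
have mPy : measurable_fun setT (fun z : R => P (y - z)).
  by apply: (measurableT_comp (@measurable_wendland1 R k)); exact: measurable_funB.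
have iT : mu.-integrable setT (EFin \o (fun z => P (y - z) * G z)).
  apply: (integrable_le _ (integrable_mull D (integrable_abs (Lfun_pois_integrable y p1 Gp)))) => [|z].
    exact: measurable_funM.
  by rewrite !normrM mulrA (ger0_norm (lor_ge0 _)) ler_wpM2r.
rewrite -RintegralB//.
pose J := icell b (b + 4 * h * m%:R).
have JE z : J z = \sum_(n < m) I n z.
  by rewrite /J -sum_icell// mulr_ge0// ltW.
have mJ : measurable_fun setT J := measurable_icell _ _.
have J1 z : `|1 - J z| <= 1 by rewrite /J icellE; case: (_ <= _ < _); rewrite ?subrr ?subr0 ?normr0 ?normr1.
have J2 z : 0 <= J z <= 1 by rewrite /J icellE; case: (_ <= _ < _); rewrite ?lexx ?ler01.
have JGp : (fun z => (1 - J z) * G z) \in Lfun mu p%:E.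
  apply: (Lfun_le (C := 1) p1 Gp); first by apply: measurable_funM => //; exact: measurable_funB.
  by move=> z; rewrite normrM ler_wpM2r.
have hN : 0 <= h ^+ N by rewrite exprn_ge0// ltW.
have iB1 := integrable_abs (Lfun_pois_integrable y p1 Gp).
have iB2 := integrable_abs (Lfun_pois_integrable y p1 JGp).
have poisE (v : R -> R) : \int[mu]_t `|lor (y - t) * v t| = pois (fun z => `|v z|) y.
  by apply: eq_Rintegral => t _; rewrite normrM (ger0_norm (lor_ge0 _)).
apply: (@le_trans _ _ (\int[mu]_z (C * h ^+ N * `|lor (y - z) * G z|
    + D * `|lor (y - z) * ((1 - J z) * G z)|))); last first.
  rewrite RintegralD//; try exact: integrable_mull.
  rewrite RintegralZl// RintegralZl// !poisE -/N -/J.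
  have q1 : 0 <= pois (fun z => `|G z|) y by exact: pois_ge0.
  have q2 : 0 <= pois (fun z => `|(1 - J z) * G z|) y by exact: pois_ge0.
  rewrite lerD// ler_wpM2r//; last by rewrite lerDr ltW.
  by rewrite ler_wpM2r// lerDl ltW.
apply: le_abs_Rintegral.
- apply: measurable_integrable; exact: (integrable_subr iT iS).
- by apply: integrable_addr; exact: integrable_mull.
move=> z.
have -> : P (y - z) * G z - \sum_(n < m) 1 * s n z = (1 - J z) * (P (y - z) * G z) +
   \sum_(n < m) I n z * ((P (y - z) - \sum_(i < N) lweight (x n) i z * P (y - x n i)) * G z).
  rewrite mulrBl mul1r -addrA; congr (_ + _); rewrite JE mulr_suml -!sumrN -big_split/=.
  apply: eq_bigr => n _; rewrite mul1r mulrBl mulrBr addKr /s; congr (- _).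
  rewrite mulr_suml mulr_sumr; apply: eq_bigr => i _.
  by rewrite /w /L inord_val; ring.
rewrite addrC; apply: (le_trans (ler_normD _ _)); apply: lerD; last first.
  rewrite mulrCA normrM [`|lor _ * _|]normrM (ger0_norm (lor_ge0 _)) mulrA.
  by rewrite ler_wpM2r.
apply: (le_trans (ler_norm_sum _ _ _)).
apply: (@le_trans _ _ (\sum_(n < m) I n z * (C * h ^+ N * `|lor (y - z) * G z|))).
  apply: ler_sum => n _; have [->|In] := eqVneq (I n z) 0.
    by rewrite !mul0r normr0.
  have [_ e] := err n z y In.
  have I1 : I n z = 1 by case: (cellP n z) => [E|[]//]; rewrite E eqxx in In.
  rewrite I1 !mul1r !normrM (ger0_norm (lor_ge0 _)) mulrA ler_wpM2r//.
rewrite -mulr_suml -JE -[leRHS]mul1r ler_wpM2r//; last by case/andP: (J2 z).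
by rewrite mulr_ge0// mulr_ge0// ltW.
Qed.

End Quadrature.

(** * Norms in L^p as real numbers *)

Section LpNorm.
Context {R : realType}.
Local Notation mu := (@lebesgue_measure R).

Fact nrm_key : unit. Proof. exact: tt. Qed.

Definition nrm : R -> (R -> R) -> R :=
  locked_with nrm_key (fun p v => (\int[mu]_x (`|v x| `^ p)) `^ p^-1).

Lemma nrmE (p : R) (v : R -> R) : nrm p v = (\int[mu]_x (`|v x| `^ p)) `^ p^-1.
Proof. by rewrite /nrm unlock. Qed.

Lemma nrm_ge0 (p : R) (v : R -> R) : 0 <= nrm p v. Proof. by rewrite nrmE powR_ge0. Qed.

Lemma LnormE (p : R) (v : R -> R) : 1 <= p -> v \in Lfun mu p%:E ->
  Lnorm mu p%:E (EFin \o v) = (nrm p v)%:E.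
Proof.
move=> p1 vp; have iv := integrable_powR p1 vp.
rewrite nrmE Lnorm_EFinE -[X in (X `^ _)%E]fineK ?poweR_EFin//.
exact: (integrable_fin_num measurableT iv).
Qed.

Lemma nrm_le_ae (p : R) (u v : R -> R) : 1 <= p -> measurable_fun setT u ->
  v \in Lfun mu p%:E -> {ae mu, forall x, `|u x| <= `|v x|} ->
  (Lnorm mu p%:E (EFin \o u) <= (nrm p v)%:E)%E.
Proof.
move=> p1 m_u vp uv; rewrite -(LnormE p1 vp); apply: le_Lnorm_ae => //.
exact: Lfun_measurable vp.
Qed.

Lemma nrm_le (p : R) (u v : R -> R) : 1 <= p -> u \in Lfun mu p%:E ->
  v \in Lfun mu p%:E -> (forall x, `|u x| <= `|v x|) -> nrm p u <= nrm p v.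
Proof.
move=> p1 up vp uv.
have := nrm_le_ae p1 (Lfun_measurable up) vp (aeW mu uv).
by rewrite (LnormE p1 up) lee_fin.
Qed.

Lemma nrm_add (p : R) (u v : R -> R) : 1 <= p -> u \in Lfun mu p%:E ->
  v \in Lfun mu p%:E -> nrm p (fun x => u x + v x) <= nrm p u + nrm p v.
Proof.
move=> p1 up vp.
have := minkowski_EFin mu (Lfun_measurable up) (Lfun_measurable vp) p1.
by rewrite (LnormE p1 (Lfun_add p1 up vp)) (LnormE p1 up) (LnormE p1 vp) -EFinD lee_fin.
Qed.

Lemma nrm_scale (p c : R) (u : R -> R) : 1 <= p -> u \in Lfun mu p%:E -> 0 <= c ->
  nrm p (fun x => c * u x) = c * nrm p u.
Proof.
move=> p1 up c0; have p0 : p != 0 by rewrite gt_eqF// (lt_le_trans _ p1).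
rewrite !nrmE; have -> : \int[mu]_x (`|c * u x| `^ p) = c `^ p * \int[mu]_x (`|u x| `^ p).
  rewrite -RintegralZl//; last exact: integrable_powR.
  by apply: eq_Rintegral => x _; rewrite normrM powRM// (ger0_norm c0).
rewrite powRM ?powR_ge0//; last by apply: Rintegral_ge0 => x _; exact: powR_ge0.
by rewrite -powRrM mulfV// powRr1.
Qed.

Lemma nrm_pois (p : R) (v : R -> R) : 1 <= p -> v \in Lfun mu p%:E ->
  nrm p (pois (fun x => `|v x|)) <= pi * nrm p v.
Proof.
move=> p1 vp.
have := young_pois p1 vp.
by rewrite (LnormE p1 (Lfun_pois p1 vp)) (LnormE p1 vp) -EFinM lee_fin.
Qed.

(** Dominated convergence. The window from [- s n] to [s n] is written as [2 n] cells of length [s]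
    in order to fit the quadrature. *)
Lemma nrm_tail (p s e : R) (v : R -> R) : 1 <= p -> v \in Lfun mu p%:E -> 0 < s -> 0 < e ->
  exists n : nat, nrm p (fun z => (1 - icell (- (s * n%:R)) (- (s * n%:R) + s * n.*2%:R) z) * v z) <= e.
Proof.
move=> p1 vp s0 e0; have p0 : 0 < p by rewrite (lt_le_trans _ p1).
pose J n := icell (- (s * n%:R)) (- (s * n%:R) + s * n.*2%:R).
pose u n z := `|(1 - J n z) * v z| `^ p.
have iv := integrable_powR p1 vp; have mv := Lfun_measurable vp.
have mu_ n : measurable_fun setT (u n).
  apply: (measurableT_comp (measurable_powR p)); apply: measurableT_comp => //.
  by apply: measurable_funM => //; apply: measurable_funB => //; exact: measurable_icell.
have uv n z : `|u n z| <= `|v z| `^ p.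
  rewrite ger0_norm ?powR_ge0// ge0_ler_powR ?nnegrE ?(ltW p0)// normrM ler_piMl//.
  by rewrite /J icellE; case: (_ <= _ < _); rewrite ?subrr ?subr0 ?normr0 ?normr1.
have lim : (\int[mu]_z u n z) @[n --> \oo] --> (0 : R).
  have := @dominated_cvg _ _ R mu setT measurableT (fun n z => (u n z)%:E) (fun=> 0%E)
    (fun z => (`|v z| `^ p)%:E).
  rewrite integral0 => H; apply: fine_cvg; rewrite /=; apply: H => //.
  - by move=> n; apply/measurable_EFinP; exact: mu_.
  - move=> z _; apply: cvg_EFin; first by near=> n.
    apply: (cvg_near_cst); near=> n.
    have nz : `|z| / s < n%:R by near: n; exact: nbhs_infty_gtr.
    rewrite /= /u /J icellE; move: nz; rewrite ltr_pdivrMr// mulrC ltr_norml => /andP[z1 z2].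
    have -> : - (s * n%:R) + s * n.*2%:R = s * n%:R by rewrite -addnn natrD; ring.
    rewrite (ltW z1) z2/=.
    by rewrite subrr mul0r normr0 powR0// gt_eqF.
  - by move=> n z _; rewrite /= lee_fin.
have ep : 0 < e `^ p by exact: powR_gt0.
have /cvgrPdist_lt/(_ _ ep)[n _ /(_ n (leqnn n))] := lim.
rewrite /= sub0r normrN => h; exists n; rewrite nrmE -/(J n).
have I0 : 0 <= \int[mu]_z u n z by apply: Rintegral_ge0 => z _; exact: powR_ge0.
have -> : e = (e `^ p) `^ p^-1 by rewrite -powRrM mulfV ?gt_eqF// powRr1// ltW.
rewrite ge0_ler_powR ?nnegrE ?invr_ge0 ?(ltW p0) ?(ltW ep)//.
by rewrite (le_trans (ler_norm _))// ltW.
Unshelve. all: by end_near. Qed.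

End LpNorm.

(** * Covering radius and separation of quasi-uniform sets *)

Section QuasiUniform.
Context {R : realType}.

(** The infimum defining the distance to [X] need not be attained; doubling [H] leaves room for a
    strict inequality. *)
Lemma fill_distance_cover (X : set R) (H x : R) : fill_distance X = H%:E -> 0 < H ->
  exists2 xi, X xi & `|x - xi| < 2 * H.
Proof.
move=> E H0.
have : (ereal_inf [set `|x - xi|%:E | xi in X] <= H%:E)%E.
  by rewrite -E; apply: ereal_sup_ubound; exists x.
move=> le; have lt : (ereal_inf [set `|x - xi|%:E | xi in X] < (2 * H)%:E)%E.
  by rewrite (le_lt_trans le)// lte_fin; lra.
by have [_ [xi Xxi <-]] := ereal_inf_lt lt; rewrite lte_fin; exists xi.
Qed.

Lemma separation_pos (X : set R) : (0 < separation_radius X)%E -> exists2 d : R, 0 < d &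
  forall x y, X x -> X y -> x <> y -> d <= `|x - y|.
Proof.
rewrite /separation_radius pmule_rgt0 ?lte_fin ?invr_gt0//; set I := ereal_inf _ => I0.
have lb x y : X x -> X y -> x <> y -> (I <= `|x - y|%:E)%E.
  by move=> Xx Xy xy; apply: ereal_inf_lbound; exists (x, y).
case: I I0 lb => [d| |] //; rewrite ?lte_fin => d0 lb.
  by exists d => // x y Xx Xy xy; rewrite -lee_fin lb.
(* An infinite infimum means that [X] has no two distinct points, and any [d] will do. *)
by exists 1 => // x y Xx Xy xy; have := lb x y Xx Xy xy.
Qed.

(** A zero fill distance would make [X] dense: a point within [d / 4] of [x0 + d / 2] differs from
    [x0] and is closer to it than the separation [d]. *)
Lemma quasi_uniform_fill (rho : R) (X : set R) : quasi_uniform rho X ->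
  exists2 H : R, 0 < H & fill_distance X = H%:E.
Proof.
move=> [_ fX sX _].
have inf_le x : (ereal_inf [set `|x - xi|%:E | xi in X] <= fill_distance X)%E.
  by apply: ereal_sup_ubound; exists x.
have inf_ge0 x : (0 <= ereal_inf [set `|x - xi|%:E | xi in X])%E.
  by apply: le_ereal_inf_tmp => _ [xi _ <-]; rewrite lee_fin.
have fX0 : (0 <= fill_distance X)%E := le_trans (inf_ge0 0) (inf_le 0).
case E : (fill_distance X) fX fX0 => [H| |]//; rewrite lee_fin => _.
rewrite le_eqVlt => /predU1P[H0|H0]; last by exists H.
exfalso; have [d d0 hd] := separation_pos sX.
have near x e : 0 < e -> exists2 xi, X xi & `|x - xi| < e.
  move=> e0; have lt : (ereal_inf [set `|x - xi|%:E | xi in X] < e%:E)%E.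
    by rewrite (le_lt_trans (inf_le x))// E -H0 lte_fin.
  by have [_ [xi Xxi <-]] := ereal_inf_lt lt; rewrite lte_fin; exists xi.
have [x0 X0 _] := near 0 1 ltr01.
have d4 : 0 < d / 4 by lra.
have [x1 X1] := near (x0 + d / 2) _ d4; rewrite ltr_norml => /andP[a1 a2].
have x01 : x1 <> x0 by move=> E1; move: a1 a2; rewrite E1; lra.
by have := hd _ _ X1 X0 x01; rewrite leNgt ltr_norml => /negP; apply; apply/andP; split; lra.
Qed.

End QuasiUniform.

(** * The error for small and for large fill distance *)

Section Assembly.
Context {R : realType}.
Local Notation mu := (@lebesgue_measure R).

Lemma wendland1_conv_abs_le (k : nat) : exists2 D : R, 0 < D & forall (p : R) (G : R -> R) (y : R),
  1 <= p -> G \in Lfun mu p%:E ->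
  `|\int[mu]_z (wendland1 k (y - z) * G z)| <= D * pois (fun x => `|G x|) y.
Proof.
have [D D0 hD] := @wendland1_le_lor R k; exists D => // p G y p1 Gp.
have := kernel_abs_le y p1 Gp (@measurable_wendland1 R k) hD.
congr (`|_| <= _); apply: eq_Rintegral => z _.
by rewrite wendland1_sym mulrC.
Qed.

Lemma approx_error_fine (k : nat) : (0 < k)%N -> exists2 C : R, 0 < C &
  forall (p h : R) (X : set R) (f g : R -> R), 1 <= p -> 0 < h -> h <= 1 ->
  (forall x, exists2 xi, X xi & `|x - xi| < h) ->
  f \in Lfun mu p%:E -> g \in Lfun mu p%:E -> bessel_potential_of (2 * k + 2)%:R g f ->
  (approx_error p f (shift_space (wendland1 k) X) <= (C * h ^+ (2 * k) * nrm p g)%:E)%E.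
Proof.
move=> k0; have [C1 C10 h1] := @wendland_convolution_approx R k k0.
have [C2 C20 h2] := @wendland_quadrature R k.
have pi0 : 0 < (pi : R) by exact: pi_gt0.
exists (C1 * pi + C2 * (C1 * pi * pi)); first by rewrite addr_gt0// !mulr_gt0.
move=> p h X f g p1 h0 hle cover fp gp Hfg.
have t0 : 0 < h ^+ 2 by rewrite exprn_gt0.
have t1 : h ^+ 2 <= 1 by rewrite exprn_ile1// ltW.
have [G [Gp Gg fG]] := h1 p (h ^+ 2) f g p1 t0 t1 fp gp Hfg.
rewrite sqrtr_sqr (gtr0_norm h0) in Gg.
(* The window of the quadrature depends on [G], and its tail error is only arbitrarily small; hence
   the slack [e]. *)
apply/lee_addgt0Pr => e e0.
have s0 : 0 < 4 * h by rewrite mulr_gt0.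
(* The tail will be multiplied by the quadrature constant [C2] and by the factor [pi] of Young's
   inequality. *)
have e'0 : 0 < e / (C2 * pi) by rewrite divr_gt0// mulr_gt0.
have [n hn] := nrm_tail p1 Gp s0 e'0.
set b := - (4 * h * n%:R) in hn.
set T := (fun z => _) in hn.
have [S XS GS] := h2 h p b X G n.*2 h0 hle p1 cover Gp.
have JGp : T \in Lfun mu p%:E.
  apply: (Lfun_le (C := 1) p1 Gp).
    by apply: measurable_funM; [apply: measurable_funB => //; exact: measurable_icell|exact: Lfun_measurable Gp].
  move=> z; rewrite normrM ler_wpM2r// icellE.
  by case: (_ <= _ < _); rewrite ?subrr ?subr0 ?normr0 ?normr1.
have Pg := Lfun_pois p1 gp; have PG := Lfun_pois p1 Gp; have PT := Lfun_pois p1 JGp.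
pose N := k.*2.+1.
have c1 : 0 <= C1 * (h ^+ 2) ^+ k by rewrite mulr_ge0 ?exprn_ge0// ltW.
have c2 : 0 <= C2 * h ^+ N by rewrite mulr_ge0 ?exprn_ge0// ltW.
have Bp1 := Lfun_mull (C1 * (h ^+ 2) ^+ k) p1 Pg.
have Bp2 := Lfun_mull (C2 * h ^+ N) p1 PG.
have Bp3 := Lfun_mull C2 p1 PT.
have Bp23 := Lfun_add p1 Bp2 Bp3; have Bp := Lfun_add p1 Bp1 Bp23.
have mS : measurable_fun setT S.
  by case: XS => /Lfun_measurable.
have mf := Lfun_measurable fp.
have mfS : measurable_fun setT (fun x => f x - S x) by exact: measurable_funB.
have step : {ae mu, forall x, `|f x - S x| <= `|C1 * (h ^+ 2) ^+ k * pois (fun x => `|g x|) x +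
    (C2 * h ^+ N * pois (fun x => `|G x|) x + C2 * pois (fun x => `|T x|) x)|}.
  case: fG => Z [mZ Z0 sub]; exists Z; split => //; apply: subset_trans sub.
  apply: subsetC => y /= fy; have Sy := GS y.
  apply: le_trans (ler_norm _); apply: (le_trans _ (lerD fy Sy)).
  by apply: le_trans (ler_normD _ _); rewrite addrA subrK.
have A : (approx_error p f (shift_space (wendland1 k) X) <=
    Lnorm mu p%:E (EFin \o (fun x => (f x - S x)%R)))%E.
  by apply: ereal_inf_lbound; exists S.
apply: (le_trans A); apply: (le_trans (nrm_le_ae p1 mfS Bp step)).
rewrite -EFinD lee_fin.
apply: (le_trans (nrm_add p1 Bp1 Bp23)).
rewrite (nrm_scale p1 Pg c1).
have := nrm_add p1 Bp2 Bp3; rewrite (nrm_scale p1 PG c2) (nrm_scale p1 PT (ltW C20)) => n23.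
have ng := nrm_pois p1 gp; have nG := nrm_pois p1 Gp; have nT := nrm_pois p1 JGp.
have GB : nrm p G <= C1 / h * (pi * nrm p g).
  have Ch : 0 <= C1 / h by rewrite divr_ge0// ltW.
  have gB : nrm p G <= nrm p (fun z => C1 / h * pois (fun x => `|g x|) z).
    apply: (nrm_le p1 Gp (Lfun_mull (C1 / h) p1 Pg)) => z.
    exact: le_trans (Gg z) (ler_norm _).
  by apply: (le_trans gB); rewrite (nrm_scale p1 Pg Ch) ler_wpM2l.
pose H := h ^+ (2 * k).
have H0 : 0 <= H by rewrite exprn_ge0// ltW.
have HE : (h ^+ 2) ^+ k = H by rewrite -exprM.
have NE : h ^+ N = H * h by rewrite /N -mul2n exprSr.
rewrite HE in c1 *; rewrite NE in c2 n23 *; rewrite -/H.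
have mul3 (a x y z : R) : 0 <= a -> x <= y * z -> a * x <= a * y * z.
  by move=> a0 xy; rewrite -mulrA ler_wpM2l.
have u1 := mul3 _ _ _ _ c1 ng; have u2 := mul3 _ _ _ _ c2 nG.
have u3 := mul3 _ _ _ _ (ltW C20) nT.
have c3 : 0 <= C2 * (H * h) * pi by rewrite mulr_ge0// ltW.
have c4 : 0 <= C2 * pi by rewrite mulr_ge0// ltW.
have u4 := ler_wpM2l c3 GB; have u5 := ler_wpM2l c4 hn.
have e1 : C2 * (H * h) * pi * (C1 / h * (pi * nrm p g)) = C2 * (C1 * pi * pi) * H * nrm p g.
  by field; rewrite gt_eqF.
have e2 : C2 * pi * (e / (C2 * pi)) = e by rewrite mulrC divfK// gt_eqF// mulr_gt0.
rewrite e1 in u4; rewrite e2 in u5.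
rewrite !mulrDl -!addrA; apply: lerD.
  by rewrite (_ : C1 * pi * H * nrm p g = C1 * H * pi * nrm p g); [|ring].
apply: (le_trans n23); apply: lerD.
  exact: le_trans u2 u4.
exact: le_trans u3 u5.
Qed.

(** The approximant is 0. The decomposition at time [t = 1] bounds the norm of [f] by that of [g],
    which suffices when the fill distance is not small. *)
Lemma approx_error_coarse (k : nat) : (0 < k)%N -> exists2 C : R, 0 < C &
  forall (p : R) (X : set R) (f g : R -> R), 1 <= p ->
  f \in Lfun mu p%:E -> g \in Lfun mu p%:E -> bessel_potential_of (2 * k + 2)%:R g f ->
  (approx_error p f (shift_space (wendland1 k) X) <= (C * nrm p g)%:E)%E.
Proof.
move=> k0; have [C1 C10 h1] := @wendland_convolution_approx R k k0.
have [D D0 hD] := wendland1_conv_abs_le k.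
have pi0 : 0 < (pi : R) by exact: pi_gt0.
exists (C1 * pi + D * (C1 * pi * pi)); first by rewrite addr_gt0// !mulr_gt0.
move=> p X f g p1 fp gp Hfg.
have [G [Gp Gg fG]] := h1 p 1 f g p1 ltr01 (lexx 1) fp gp Hfg.
rewrite sqrtr1 divr1 in Gg.
have Pg := Lfun_pois p1 gp; have PG := Lfun_pois p1 Gp.
have Bp1 := Lfun_mull C1 p1 Pg; have Bp2 := Lfun_mull D p1 PG.
have step : {ae mu, forall x, `|f x - 0| <= `|C1 * pois (fun x => `|g x|) x + D * pois (fun x => `|G x|) x|}.
  case: fG => Z [mZ Z0 sub]; exists Z; split => //; apply: subset_trans sub.
  apply: subsetC => y /=; rewrite expr1n mulr1 subr0 => fy.
  apply: le_trans (ler_norm _); apply: (le_trans _ (lerD fy (hD p G y p1 Gp))).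
  by apply: le_trans (ler_normD _ _); rewrite subrK.
have mf0 : measurable_fun setT (fun x => f x - 0).
  by apply: measurable_funB => //; exact: Lfun_measurable fp.
have A : (approx_error p f (shift_space (wendland1 k) X) <=
    Lnorm mu p%:E (EFin \o (fun x => (f x - 0)%R)))%E.
  by apply: ereal_inf_lbound; exists (fun=> 0) => //; exact: shift_space0 (@wendland1_Lfun1 R k).
apply: (le_trans A); apply: (le_trans (nrm_le_ae p1 mf0 (Lfun_add p1 Bp1 Bp2) step)).
rewrite lee_fin; apply: (le_trans (nrm_add p1 Bp1 Bp2)).
rewrite (nrm_scale p1 Pg (ltW C10)) (nrm_scale p1 PG (ltW D0)).
have ng := nrm_pois p1 gp; have nG := nrm_pois p1 Gp.
have GB : nrm p G <= C1 * (pi * nrm p g).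
  have gB : nrm p G <= nrm p (fun z => C1 * pois (fun x => `|g x|) z).
    apply: (nrm_le p1 Gp Bp1) => z.
    exact: le_trans (Gg z) (ler_norm _).
  by apply: (le_trans gB); rewrite (nrm_scale p1 Pg (ltW C10)) ler_wpM2l// ltW.
rewrite mulrDl; apply: lerD; first by rewrite -mulrA ler_pM2l.
rewrite -[leRHS]mulrA ler_pM2l//; apply: (le_trans nG).
have -> : C1 * pi * pi * nrm p g = pi * (C1 * (pi * nrm p g)) by ring.
by rewrite ler_pM2l.
Qed.

End Assembly.

Theorem theorem3p5 (R : realType) (k : nat) (p rho : R)
    (hk : (1 <= k)%N) (hp : 1 <= p) (hrho : 0 < rho) :
  exists C : R, 0 < C /\
    forall X : set R, quasi_uniform rho X ->
    forall f : R -> R, bessel_space (2 * k + 2)%:R p f ->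
      (approx_error p f (shift_space (wendland1 k) X)
       <= C%:E * fill_distance X ^+ (2 * k) * bessel_norm (2 * k + 2)%:R p f)%E.
Proof.
have [C1 C10 h1] := @approx_error_fine R k hk.
have [C2 C20 h2] := @approx_error_coarse R k hk.
(* The covering radius used below is twice the fill distance, whence the power of 2. *)
pose C := (C1 + C2) * 2 ^+ (2 * k).
have C0 : 0 < C by rewrite mulr_gt0 ?addr_gt0 ?exprn_gt0.
exists C; split=> // X qX f [fp [g0 [g0p hg0]]].
have [H H0 HE] := quasi_uniform_fill qX.
pose c := C * H ^+ (2 * k); have c0 : 0 < c by rewrite mulr_gt0// exprn_gt0.
have -> : (C%:E * fill_distance X ^+ (2 * k) = c%:E)%E by rewrite HE -EFin_expe -EFinM.
(* The Bessel norm is an infimum over densities; dividing by [c > 0] reduces the claim to a single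
   density [g]. *)
rewrite -lee_pdivrMl//; apply: le_ereal_inf_tmp => _ [g [gp hg] <-].
rewrite lee_pdivrMl//; rewrite (LnormE hp gp) -EFinM.
have cE : c = (C1 + C2) * (2 * H) ^+ (2 * k) by rewrite /c /C exprMn mulrA.
have ng0 := @nrm_ge0 R p g.
(* If [2 * H] exceeds 1, so does its power [2 k], and the bound without a power of [H] is enough. *)
have [H1|H1] := leP (2 * H) 1.
  apply: (le_trans (h1 p (2 * H) X f g hp _ H1 _ fp gp hg)).
  - by rewrite mulr_gt0.
  - by move=> x; exact: fill_distance_cover HE H0.
  rewrite lee_fin cE ler_wpM2r// ler_wpM2r ?exprn_ge0 ?mulr_ge0 ?(ltW H0)//.
  by rewrite lerDl ltW.
apply: (le_trans (h2 p X f g hp fp gp hg)); rewrite lee_fin cE ler_wpM2r//.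
have e1 : 1 <= (2 * H) ^+ (2 * k) by rewrite exprn_ege1// ltW.
by nra.
Qed.
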